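(* Let $\lambda>0$ be arbitrary. (1) For all $a>0$ and $B>0$ with $B\le\frac1a$, there exists a u.l.m. point process supported on $a\mathbb{Z}$ that mimics the Poisson process of intensity $\lambda$ at bandwidth $[-B,B]$. (2) For all $a>0$ and $B>\frac1a$, there does not exist a u.l.m. point process supported on $a\mathbb{Z}$ that mimics the Poisson process of intensity $\lambda$ at bandwidth $[-B,B]$.
   Context: A configuration in $\mathbb{R}$ is a locally finite countable (possibly finite or empty) family $u=(u_j)_j$ of real numbers, repetitions allowed and counted with multiplicity (the labelling is irrelevant). For $V\subset\mathbb{R}$ put $\#_V(u)=\#\{j: u_j\in V\}$. A point process on $\mathbb{R}$ is a random configuration, measurable with respect to the $\sigma$-algebra generated by the sets $\{u:\#_V(u)=m\}$ with $V$ a bounded Borel set and $m\ge 0$ an integer. It is supported on $a\mathbb{Z}=\{aj: j\in\mathbb{Z}\}$ if all its points lie in $a\mathbb{Z}$. A point process is u.l.m. (has uniform local moments) if for each $n\ge1$ there is $C_n<\infty$ with $\mathbb{E}[(\#_{[L,L+1]}(u))^n]\le C_n$ for all $L\in\mathbb{R}$. The Poisson process of intensity $\lambda>0$ is the unique point process $w$ on $\mathbb{R}$ such that $\mathbb{E}\sum_{j_1,\dots,j_n\ \text{distinct}}\phi(w_{j_1},\dots,w_{j_n})=\int_{\mathbb{R}^n}\phi(x_1,\dots,x_n)\,\lambda^n\,dx_1\cdots dx_n$ for all $n\ge1$ and $\phi\in C_c(\mathbb{R}^n)$; it is u.l.m. Fourier transform: $\hat\eta(\xi)=\int_{\mathbb{R}^n}\eta(x)e^{-2\pi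 i x\cdot\xi}\,dx$. $\mathcal{S}(\mathbb{R}^n)$ is the Schwartz class. For u.l.m. point processes $u,v$ on $\mathbb{R}$ and $B>0$, $v$ mimics $u$ at the bandwidth $[-B,B]$ if for each $n\ge1$ and all $\eta\in\mathcal{S}(\mathbb{R}^n)$ with $\hat\eta$ supported in $[-B,B]^n$, $\mathbb{E}\sum_{j_1,\dots,j_n\ \text{distinct}}\eta(u_{j_1},\dots,u_{j_n})=\mathbb{E}\sum_{j_1,\dots,j_n\ \text{distinct}}\eta(v_{j_1},\dots,v_{j_n})$. *)

(* Defs.v *)
From HB Require Import structures.
From mathcomp Require Import all_boot all_order all_algebra.
From mathcomp Require Import all_classical all_reals all_analysis.
From mathcomp Require Import complex.

Set Implicit Arguments.
Unset Strict Implicit.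
Unset Printing Implicit Defensive.

Import Order.TTheory GRing.Theory Num.Theory.
Import numFieldNormedType.Exports.

Local Open Scope classical_set_scope.
Local Open Scope ring_scope.

(** Test functions take values in [R[i]].  The integrals of MathComp-Analysis are
real-valued, so complex sums and integrals are taken componentwise.  As with
[Rintegral], the values below are only meaningful in the absolutely convergent
case. *)

Section complex_sums_and_integrals.
Context {R : realType}.

(** Unconditional sum of a real family, as the difference of the sums of its
positive and negative parts. *)
Definition rsum {T : choiceType} (D : set T) (f : T -> R) : R :=
  fine (\esum_(t in D) ((EFin \o f)^\+ t)%E) -
  fine (\esum_(t in D) ((EFin \o f)^\- t)%E).

Definition csum {T : choiceType} (D : set T) (f : T -> R[i]) : R[i] :=
  Complex (rsum D (fun t => complex.Re (f t)))
          (rsum D (fun t => complex.Im (f t))).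

Definition cintegral {d} {T : measurableType d} (mu : {measure set T -> \bar R})
    (f : T -> R[i]) : R[i] :=
  Complex (Rintegral mu [set: T] (fun t => complex.Re (f t)))
          (Rintegral mu [set: T] (fun t => complex.Im (f t))).

End complex_sums_and_integrals.

(** Lebesgue measure on [n.-tuple R] is built by recursion on [n]: the measure on [n.+1.-tuple R] is the image
under [cons] of the product of the measure on [R] and the one on
[n.-tuple R]. *)

Section tuple_cons.
Context d (T : measurableType d) (n : nat).

Definition tcons (p : T * n.-tuple T) : n.+1.-tuple T :=
  [the n.+1.-tuple T of p.1 :: p.2].

Lemma measurable_tcons : measurable_fun [set: T * n.-tuple T] tcons.
Proof. exact: measurable_cons. Qed.

Definition tuncons (t : n.+1.-tuple T) : T * n.-tuple T :=
  (tnth t ord0, [tuple of behead t]).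

Lemma measurable_tuncons : measurable_fun [set: n.+1.-tuple T] tuncons.
Proof.
apply/measurable_fun_pairP; split; first exact: measurable_tnth.
exact: measurable_behead.
Qed.

Lemma tconsK : cancel tcons tuncons.
Proof. by case=> x t; rewrite /tuncons; congr (_, _); exact: val_inj. Qed.

End tuple_cons.

Section cons_measure.
Context d (T : measurableType d) (R : realType) (n : nat).
Variables (mu : {sigma_finite_measure set T -> \bar R})
  (m : {sigma_finite_measure set (n.-tuple T) -> \bar R}).

Definition cons_measure : set (n.+1.-tuple T) -> \bar R :=
  pushforward (mu \x m)%E (@tcons d T n).

Let cons_measure0 : cons_measure set0 = 0%E.
Proof. by rewrite /cons_measure /pushforward preimage_set0 measure0. Qed.

Let cons_measure_ge0 A : (0 <= cons_measure A)%E.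
Proof. exact: (measure_ge0 (mu \x m)%E). Qed.

Let cons_measure_sigma_additive : semi_sigma_additive cons_measure.
Proof.
have mcons A : measurable A -> measurable (@tcons d T n @^-1` A).
  by move=> mA; rewrite -[X in measurable X]setTI; exact: measurable_tcons.
move=> F mF tF mUF; rewrite /cons_measure /pushforward preimage_bigcup.
apply: (@measure_semi_sigma_additive _ _ _ [the measure _ _ of (mu \x m)%E]
  (fun k => @tcons d T n @^-1` F k)).
- by move=> k; exact: mcons.
- apply/trivIsetP => /= i j _ _ ij; rewrite -preimage_setI.
  by move/trivIsetP : tF => /(_ _ _ _ _ ij) ->//; rewrite preimage_set0.
- by rewrite -preimage_bigcup; exact: mcons.
Qed.

HB.instance Definition _ := isMeasure.Build _ _ _ cons_measure
  cons_measure0 cons_measure_ge0 cons_measure_sigma_additive.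

Lemma cons_measure_sigma_finite : sigma_finite setT cons_measure.
Proof.
have /sigma_finiteP[F [TF ndF Foo]] := sigma_finiteT mu.
have /sigma_finiteP[G [TG ndG Goo]] := sigma_finiteT m.
exists (fun k => @tuncons _ _ _ @^-1` (F k `*` G k)).
  rewrite -preimage_bigcup (_ : \bigcup_k _ = setT) ?preimage_setT//.
  rewrite -subTset => -[x y] _.
  have [i _ Fix] : (\bigcup_k F k) x by rewrite -TF.
  have [j _ Gjy] : (\bigcup_k G k) y by rewrite -TG.
  exists (maxn i j) => //; split.
  - by move: x Fix; exact/subsetPset/ndF/leq_maxl.
  - by move: y Gjy; exact/subsetPset/ndG/leq_maxr.
move=> k; have [mF Fk] := Foo k; have [mG Gk] := Goo k; split.
  rewrite -[X in measurable X]setTI.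
  by apply: measurable_tuncons => //; exact: measurableX.
rewrite /cons_measure /pushforward -comp_preimage.
rewrite (_ : _ \o _ = id) ?preimage_id; last first.
  by apply/funext => p; exact: tconsK.
by rewrite product_measure1E// lte_mul_pinfty// ge0_fin_numE.
Qed.

HB.instance Definition _ :=
  @Measure_isSigmaFinite.Build _ _ _ cons_measure cons_measure_sigma_finite.

End cons_measure.

Fixpoint lebesgue_tuple (R : realType) (n : nat) :
    {sigma_finite_measure set (n.-tuple (measurableTypeR R)) -> \bar R} :=
  match n with
  | 0 => \d_([tuple] : 0.-tuple (measurableTypeR R))
  | n'.+1 => cons_measure (@lebesgue_measure R) (lebesgue_tuple R n')
  end.

Definition row_of_tuple {R : realType} {n : nat} (t : n.-tuple R) : 'rV[R]_n :=
  \row_i tnth t i.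

(** Points of R^n are row vectors (so that the library's topology and
directional derivatives apply); [lebesgue_integral_rV f] is the integral of
[f] over R^n. *)
Definition lebesgue_integral_rV {R : realType} {n : nat}
    (f : 'rV[R]_n -> R[i]) : R[i] :=
  cintegral (lebesgue_tuple R n) (fun t => f (row_of_tuple t)).

Section test_functions.
Context {R : realType} {n : nat}.
Implicit Types (f : 'rV[R]_n -> R) (eta phi : 'rV[R]_n -> R[i]).

Definition partials (s : seq 'I_n) f : 'rV[R]_n -> R :=
  foldr (fun i g x => 'D_(delta_mx 0 i) g x) f s.

Definition smooth f : Prop :=
  forall s : seq 'I_n, continuous (partials s f) /\
    forall i x, derivable (partials s f) x (delta_mx 0 i).

Definition rapidly_decreasing f : Prop :=
  forall (s : seq 'I_n) (k : nat), exists C : R,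
    forall x, `|x| ^+ k * `|partials s f x| <= C.

Definition schwartz eta : Prop :=
  [/\ smooth (fun x => complex.Re (eta x)),
      smooth (fun x => complex.Im (eta x)),
      rapidly_decreasing (fun x => complex.Re (eta x)) &
      rapidly_decreasing (fun x => complex.Im (eta x))].

Definition continuous_compactly_supported phi : Prop :=
  [/\ continuous (fun x => complex.Re (phi x)),
      continuous (fun x => complex.Im (phi x)) &
      compact (closure [set x | phi x != 0])].

Definition dotr (x y : 'rV[R]_n) : R := \sum_i x 0 i * y 0 i.

(** [expi t] is e^{it}. *)
Definition expi (t : R) : R[i] := Complex (cos t) (sin t).

Definition fourier eta (xi : 'rV[R]_n) : R[i] :=
  lebesgue_integral_rV (fun x => eta x * expi (- (2 * pi * dotr x xi))).

(** The box is closed, so it contains the support of [fourier eta] as soon as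
it contains the points where [fourier eta] does not vanish. *)
Definition band_limited (B : R) eta : Prop :=
  forall xi, fourier eta xi != 0 -> forall i, `|xi 0 i| <= B.

End test_functions.

(** A configuration is given by the multiplicity of each real number in it. *)
Record configuration (R : realType) := Configuration {
  multiplicity : R -> nat ;
  locally_finite : forall V : set R, bounded_set V ->
    finite_set (V `&` [set x | multiplicity x <> 0%N]) }.

Section configuration_structure.
Context (R : realType).

HB.instance Definition _ := gen_eqMixin (configuration R).
HB.instance Definition _ := gen_choiceMixin (configuration R).

Definition empty_configuration : configuration R.
Proof.
exists (fun=> 0%N) => V _.
by rewrite (_ : _ `&` _ = set0)//; apply/seteqP; split=> x [].
Defined.

HB.instance Definition _ := isPointed.Build (configuration R) empty_configuration.

End configuration_structure.

Section point_processes.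
Context {R : realType}.

(** [count_points V u] is #_V(u), the number of points of [u] in [V] with
multiplicity. *)
Definition count_points (V : set R) (u : configuration R) : \bar R :=
  \esum_(x in V) (multiplicity u x)%:R%:E.

Definition count_events : set (set (configuration R)) :=
  [set E | exists (V : set R) (m : nat), [/\ measurable V, bounded_set V &
    E = [set u | count_points V u = m%:R%:E]]].

(** The points of [u] are labelled by the pairs [(x, k)] with
[k < multiplicity u x], the value of the label [(x, k)] being [x].
[distinct_labels u] is the set of [n]-tuples of distinct labels. *)
Definition distinct_labels (n : nat) (u : configuration R) :
    set (n.-tuple (R * nat)) :=
  [set j : n.-tuple (R * nat) | uniq j /\
     forall i, ((tnth j i).2 < multiplicity u (tnth j i).1)%N].

(** The sum of eta(u_{j_1}, ..., u_{j_n}) over distinct labels. *)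
Definition distinct_sum (n : nat) (eta : 'rV[R]_n -> R[i])
    (u : configuration R) : R[i] :=
  csum (distinct_labels u) (fun j => eta (\row_i (tnth j i).1)).

Definition point_process {d} {T : measurableType d} (P : probability T R) :=
  {RV P >-> g_sigma_algebraType count_events}.

Section properties.
Context {d} {T : measurableType d} {P : probability T R}.
Implicit Type u : point_process P.

Definition supported_on_lattice (a : R) u : Prop :=
  forall (w : T) (x : R), multiplicity (u w) x <> 0%N ->
    exists k : int, x = a * k%:~R.

(** Uniform local moments. *)
Definition ulm u : Prop :=
  forall n, (0 < n)%N -> exists C : R, forall L : R,
      (\int[P]_w (count_points `[L, (L + 1)%R] (u w) ^+ n) <= C%:E)%E.

Definition correlation (n : nat) (eta : 'rV[R]_n -> R[i]) u : R[i] :=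
  cintegral P (fun w => distinct_sum eta (u w)).

(** This determines the law of [u] and implies [ulm u].  Testing it on
nonnegative [phi] shows that the expectations on the left-hand side are
finite. *)
Definition is_poisson (lambda : R) u : Prop :=
  forall n, (0 < n)%N -> forall phi : 'rV[R]_n -> R[i],
    continuous_compactly_supported phi ->
    correlation phi u =
    lebesgue_integral_rV (fun x => phi x * (lambda ^+ n)%:C%C).

End properties.

(** [mimics B v u]: [v] mimics [u] at the bandwidth [[-B, B]].  For [u] and
[v] with uniform local moments, both sides of the equality converge
absolutely. *)
Definition mimics (B : R) {d} {T : measurableType d} {P : probability T R}
    (v : point_process P)
    {d'} {T' : measurableType d'} {P' : probability T' R}
    (u : point_process P') : Prop :=
  forall n, (0 < n)%N -> forall eta : 'rV[R]_n -> R[i],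
    schwartz eta -> band_limited B eta ->
    correlation eta u = correlation eta v.

End point_processes.

(* Main.v *)
(** (1) Take [v] to be [w] with every point moved to a nearest point of [aZ].
Correlation sums of [w] against any integrable function are Lebesgue integrals
(first on boxes, from the tent functions in C_c, then by a Dynkin argument), so
the claim becomes
  [int eta(t) dt = int eta(round t) dt]
for Schwartz [eta] of bandwidth at most [1/a].  The kernel
[4^N / C(2N, N) cos(pi x / a)^(2N)] is a nonnegative trigonometric polynomial
with frequencies in [(1/a)Z] and mean 1 on each period.  Multiplying by the
product of these kernels in all coordinates changes neither of the two
integrals: the left one because the Fourier transform of [eta] vanishes at the
nonzero points of [(1/a)Z^n] (by continuity also on the boundary of the band),
the right one because [eta(round t)] is constant on each cell.  As [N] grows
the kernel concentrates on [aZ], where the two integrands agree.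

(2) Let [phi] be the cosine transform of a smooth bump supported in
[[-delta, delta]] and [psi = phi^2], a nonnegative Schwartz function with
Fourier transform supported near 0.  For small [delta] both [psi(x)] and
[psi(x) exp(2 pi i x / a)] have bandwidth [B > 1/a], and they agree on [aZ].
For a mimicking process this would give
  [lambda int psi = lambda int psi(x) cos(2 pi x / a) dx = 0]. *)

From HB Require Import structures.
Require Import Defs.
From mathcomp Require Import all_boot all_order all_algebra finmap.
From mathcomp Require Import all_classical all_reals all_analysis measurable_realfun.
From mathcomp Require Import complex ring lra zify.

Set Implicit Arguments.
Unset Strict Implicit.
Unset Printing Implicit Defensive.

Import Order.TTheory GRing.Theory Num.Theory.
Import numFieldNormedType.Exports.

Local Open Scope classical_set_scope.
Local Open Scope ring_scope.

(** Neither part inverts a Fourier transform or sums a Poisson formula. In (1) each kernel has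
    finitely many frequencies, and its concentration is computed exactly. With K_N the kernel of
    order N, sin^2(pi x/a) K_N = K_N - (2N+1)/(2N+2) K_(N+1), and all kernels have the same mean, so
    sin^2(pi x/a) has mean 1/(2N+2) against K_N. For this to survive a decaying weight, the weight
    must be constant on the cells of the rounding; hence the rounded weight [rhor], which still
    dominates the derivatives of a Schwartz function near the lattice.

    In (2) the band of the cosine transform has to be found directly. Bumps and their transforms
    form two inductive classes, closed under the operations used. This provides primitives that
    vanish at infinity, so the integrals at frequencies outside the band are 0.

    On the probabilistic side only counts are measurable by definition. Sums over distinct labels
    reduce to counts by removing coincidences one label at a time. As correlations go through
    [fine], an identity between them carries information only once the expectations are known to be
    finite. *)

(** * Intensity measures of random sums *)

Section esum_complements.
Context {R : realType} {T : choiceType}.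
Local Open Scope ereal_scope.
Implicit Types (D : set T) (a : T -> \bar R).

Lemma esum_cvg D (a : nat -> T -> \bar R) (b : T -> \bar R) :
  (forall k t, D t -> 0 <= a k t) ->
  (forall t, D t -> {homo a ^~ t : k l / (k <= l)%N >-> k <= l}) ->
  (forall t, D t -> a ^~ t @ \oo --> b t) ->
  (fun k => \esum_(t in D) a k t) @ \oo --> \esum_(t in D) b t.
Proof.
move=> a0 nda ab.
have ale k t : D t -> a k t <= b t.
  move=> Dt; rewrite -(cvg_lim _ (ab t Dt))//.
  rewrite (cvg_lim _ (ereal_nondecreasing_cvgn (nda t Dt)))//.
  by apply: ereal_sup_ubound; exists k.
have nd : {homo (fun k => \esum_(t in D) a k t) : k l / (k <= l)%N >-> k <= l}.
  by move=> k l kl; apply: le_esum => t Dt; exact: nda.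
have cs := ereal_nondecreasing_is_cvgn nd.
suff -> : \esum_(t in D) b t = limn (fun k => \esum_(t in D) a k t) by [].
apply/eqP; rewrite eq_le; apply/andP; split.
  apply: ge_ereal_sup => _ [X [finX XD] <-].
  have h : (fun k => \sum_(t \in X) a k t) @ \oo --> \sum_(t \in X) b t.
    rewrite fsbig_finite// big_seq.
    have -> : (fun k => \sum_(t \in X) a k t) =
        (fun k => \sum_(t <- fset_set X | t \in fset_set X) a k t).
      by apply/funext => k; rewrite fsbig_finite// big_seq.
    have XDt t : (t \in fset_set X) -> D t by rewrite in_fset_set// inE => /XD.
    apply: cvg_nnesum => t /XDt Dt; last exact: ab.
    by near=> k; exact: a0.
  rewrite -(cvg_lim _ h)//; apply: lee_lim => //.
    by apply/cvg_ex; eexists; exact: h.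
  near=> k; apply: ereal_sup_ubound; exists X => //; exact: conj.
apply: lime_le => //; near=> k; apply: le_esum => t Dt; exact: ale.
Unshelve. all: by end_near. Qed.

Lemma esumZl D a (c : R) : (0 <= c)%R -> (forall t, D t -> 0 <= a t) ->
  \esum_(t in D) (c%:E * a t) = c%:E * \esum_(t in D) a t.
Proof.
rewrite le_eqVlt => /predU1P[<- _|c0 a0].
  by rewrite mul0e esum1// => t _; rewrite mul0e.
have half (b : T -> \bar R) (e : R) : (0 < e)%R -> (forall t, D t -> 0 <= b t) ->
    \esum_(t in D) (e%:E * b t) <= e%:E * \esum_(t in D) b t.
  move=> e0 b0; apply: ge_ereal_sup => _ [X [finX XD] <-].
  rewrite fsbig_finite//= big_seq -ge0_sume_distrr; last first.
    by move=> t; rewrite in_fset_set// inE => /XD /b0.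
  rewrite lee_pmul2l// -big_seq -fsbig_finite//.
  by apply: ereal_sup_ubound; exists X.
apply/eqP; rewrite eq_le half//=.
rewrite -(@lee_pmul2l _ c^-1%:E) ?lte_fin ?invr_gt0// muleA -EFinM mulVf ?gt_eqF//.
rewrite mul1e; apply: le_trans (half _ _ _ _); rewrite ?invr_gt0//; last first.
  by move=> t Dt; rewrite mule_ge0 ?lee_fin ?(ltW c0)// a0.
by apply: le_esum => t Dt; rewrite muleA -EFinM mulVf ?gt_eqF// mul1e.
Qed.

Lemma esum_nneseries D (a : T -> nat -> \bar R) :
  (forall t k, D t -> 0 <= a t k) ->
  \esum_(t in D) \sum_(k <oo) a t k = \sum_(k <oo) \esum_(t in D) a t k.
Proof.
move=> a0.
transitivity (\esum_(t in D) \esum_(k in [set: nat]) a t k).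
  by apply: eq_esum => t Dt; rewrite nneseries_esumT// => k; exact: a0.
rewrite nneseries_esumT; last by move=> k; apply: esum_ge0 => t Dt; exact: a0.
rewrite !esum_esum; last 2 first.
  by move=> k t _; exact: a0.
  by move=> t k Dt _; exact: a0.
rewrite (reindex_esum ([set: nat] `*`` (fun=> D)) _ (fun x => (x.2, x.1)))//.
split=> //=.
- by move=> [k t] [_ /= Dt].
- by move=> [k t] [k' t'] _ _ /= [-> ->].
- by move=> [t k] [/= Dt _]; exists (k, t).
Qed.

End esum_complements.

Lemma ge0_cvg_integral d (T : measurableType d) (R : realType)
    (mu : {measure set T -> \bar R}) (g : nat -> T -> \bar R) (h : T -> \bar R) :
  (forall k, measurable_fun setT (g k)) -> (forall k x, 0 <= g k x)%E ->
  (forall x, {homo g ^~ x : k l / (k <= l)%N >-> (k <= l)%E}) ->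
  (forall x, g ^~ x @ \oo --> h x) ->
  (fun k => \int[mu]_x g k x)%E @ \oo --> (\int[mu]_x h x)%E.
Proof.
move=> mg g0 ndg gh.
have -> : h = fun x => limn (g ^~ x) by apply/funext => x; apply/esym/cvg_lim.
by apply: cvg_monotone_convergence => // x _; exact: ndg.
Qed.

Import HBNNSimple.

Section random_sums.
Local Open Scope ereal_scope.
Context d (T : measurableType d) (R : realType) d' (Y : measurableType d').
Context (L : choiceType) (D : T -> set L) (pos : L -> Y).

(** The random set consists of labels, placed in [Y] by [pos], so that points at the same position
    are counted separately. *)
Definition random_sum (g : Y -> \bar R) (t : T) : \bar R := \esum_(l in D t) g (pos l).

Lemma random_sum_ge0 g t : (forall y, 0 <= g y) -> 0 <= random_sum g t.
Proof. by move=> g0; apply: esum_ge0. Qed.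

Lemma le_random_sum g h t : (forall y, g y <= h y) ->
  random_sum g t <= random_sum h t.
Proof. by move=> gh; apply: le_esum. Qed.

Lemma random_sum_indic0 t : random_sum (EFin \o \1_set0) t = 0.
Proof. by apply: esum1 => l _; rewrite /= indic0. Qed.

Lemma random_sum_indicU (A B : set Y) t : A `&` B = set0 ->
  random_sum (EFin \o \1_(A `|` B)) t =
  random_sum (EFin \o \1_A) t + random_sum (EFin \o \1_B) t.
Proof.
move=> AB; rewrite /random_sum -esumD.
- apply: eq_esum => l _ /=; rewrite -EFinD !indicE in_setU -natrD.
  case: (boolP (_ \in A)) => [/set_mem lA|_] //=.
  case: (boolP (_ \in B)) => [/set_mem lB|_] //=.
  by have : (A `&` B) (pos l) by []; rewrite AB.
- by move=> l _; rewrite lee_fin.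
- by move=> l _; rewrite lee_fin.
Qed.

Lemma random_sum_indic_bigcup (F : (set Y)^nat) t : trivIset setT F ->
  random_sum (EFin \o \1_(\bigcup_k F k)) t =
  \sum_(k <oo) random_sum (EFin \o \1_(F k)) t.
Proof.
move=> tF; rewrite /random_sum -esum_nneseries; last by move=> *; rewrite lee_fin.
by apply: eq_esum => l _ /=; rewrite -indic_bigcup.
Qed.

Section measurability.
Variables (G : set (set Y)) (B : (set Y)^nat).
Hypotheses (mG : @measurable _ Y = <<s G >>) (IG : setI_closed G).
Hypotheses (GB : forall k, G (B k)) (ndB : nondecreasing_seq B).
Hypothesis covB : \bigcup_k B k = setT.
Hypothesis finB : forall k t, random_sum (EFin \o \1_(B k)) t < +oo.
Hypothesis mGsum :
  forall A, G A -> measurable_fun setT (random_sum (EFin \o \1_A)).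

(** Dynkin induction is run on [A] cut by [B k]: the step to complements subtracts sums, which is
    legitimate only inside [B k], where they are finite. The cut is then removed by monotone
    convergence. *)
Lemma measurable_random_sum_indic (A : set Y) : measurable A ->
  measurable_fun setT (random_sum (EFin \o \1_A)).
Proof.
move=> mA.
have key k : measurable_fun setT (random_sum (EFin \o \1_(A `&` B k))).
  rewrite mG in mA; move: A mA; apply: (@dynkin_induction _ _ G) => //.
  - by rewrite setTI; apply: mGsum.
  - by move=> A GA; apply: mGsum; exact: IG.
  - move=> A mA mAB.
    have -> : random_sum (EFin \o \1_(~` A `&` B k)) =
        (random_sum (EFin \o \1_(B k)) \- random_sum (EFin \o \1_(A `&` B k))).
      apply/funext => t /=.
      have {2}-> : B k = (~` A `&` B k) `|` (A `&` B k).
        by rewrite -setIUl setUC setUv setTI.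
      rewrite random_sum_indicU; last first.
        by rewrite setIACA setICl set0I.
      rewrite addeK// ge0_fin_numE ?random_sum_ge0//; last first.
        by move=> y; rewrite lee_fin.
      apply: le_lt_trans (finB k t); apply: le_random_sum => y.
      by rewrite /= lee_fin indicI ler_piMl// indicE; case: (_ \in _).
    by apply: emeasurable_funB => //; exact: mGsum.
  - move=> F mF tF mFB.
    have -> : random_sum (EFin \o \1_((\bigcup_i F i) `&` B k)) =
        (fun t => \sum_(i <oo) random_sum (EFin \o \1_(F i `&` B k)) t).
      apply/funext => t; rewrite setI_bigcupl random_sum_indic_bigcup//.
      exact: trivIset_setIr.
    apply: ge0_emeasurable_sum => // i t _ _.
    by apply: random_sum_ge0 => y; rewrite lee_fin.
apply: (emeasurable_fun_cvg (fun k => random_sum (EFin \o \1_(A `&` B k)))) => //.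
move=> t _; apply: esum_cvg.
- by move=> k l _; rewrite lee_fin.
- move=> l _ i j ij /=; rewrite lee_fin !indicI ler_wpM2l//.
  rewrite !indicE ler_nat; case: (boolP (_ \in B i)) => // /set_mem h.
  by rewrite mem_set//; have /subsetPset := ndB ij; apply.
- move=> l _; apply/fine_cvgP; split; first by near=> k.
  apply: cvg_near_cst.
  have [k _ Bk] : (\bigcup_k B k) (pos l) by rewrite covB.
  near=> j; rewrite /= indicI/= [in X in (_ * X)%R]indicE mem_set ?mulr1//.
  have kj : (k <= j)%N by near: j; exact: nbhs_infty_ge.
  by have /subsetPset := ndB kj; apply.
Unshelve. all: by end_near. Qed.

End measurability.

Section integral.
Variables (P : {measure set T -> \bar R}).
Hypothesis msum : forall A, measurable A ->
  measurable_fun setT (random_sum (EFin \o \1_A)).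

Let intensity0 (A : set Y) := \int[P]_t random_sum (EFin \o \1_A) t.

(** The measurability proof is an argument of the set function because the measure structure
    attached to it below depends on that proof. *)
Definition intensity & (forall A, measurable A ->
  measurable_fun setT (random_sum (EFin \o \1_A))) := intensity0.
Local Notation nu := (intensity msum).

Let nu0 : nu set0 = 0.
Proof.
rewrite /nu; apply: integral0_eq => t _; apply: esum1 => l _.
by rewrite /= indicE in_set0.
Qed.

Let nu_ge0 A : 0 <= nu A.
Proof.
by apply: integral_ge0 => t _; apply: random_sum_ge0 => y; rewrite lee_fin.
Qed.

Let nu_sigma_additive : semi_sigma_additive nu.
Proof.
move=> F mF tF mUF.
rewrite [X in _ --> X](_ : _ = \sum_(0 <= i <oo) nu (F i)).
  by apply: is_cvg_nneseries => *; exact: nu_ge0.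
rewrite /nu -integral_nneseries//; last 2 first.
  by move=> k; exact: msum.
  by move=> k t _; apply: random_sum_ge0 => y; rewrite lee_fin.
by apply: eq_integral => t _; rewrite random_sum_indic_bigcup.
Qed.

HB.instance Definition _ := isMeasure.Build _ _ _ nu nu0 nu_ge0 nu_sigma_additive.

(** Campbell's formula, from indicators to simple functions to monotone limits. *)
Lemma measurable_random_sum (g : Y -> \bar R) :
  measurable_fun setT g -> (forall y, 0 <= g y) ->
  measurable_fun setT (random_sum g) /\
  \int[P]_t random_sum g t = \int[nu]_y g y.
Proof.
move=> mg g0.
have hnn (h : {nnsfun Y >-> R}) : measurable_fun setT (random_sum (fun y => (h y)%:E)) /\
    \int[P]_t random_sum (fun y => (h y)%:E) t = \int[nu]_y (h y)%:E.
  have hE t : random_sum (fun y => (h y)%:E) t =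
      \sum_(r <- fset_set (range h)) r%:E * random_sum (EFin \o \1_(h @^-1` [set r])) t.
    transitivity (\esum_(l in D t) \sum_(r <- fset_set (range h))
       (r%:E * (\1_(h @^-1` [set r]) (pos l))%:E)).
      apply: eq_esum => l _ /=; rewrite fimfunE fsbig_finite//= -sumEFin.
      by apply: eq_bigr => r _; rewrite EFinM.
    rewrite big_seq; under eq_esum do rewrite big_seq.
    rewrite esum_sum; last first.
      move=> l r _; rewrite in_fset_set// inE/= => -[y _ <-].
      by rewrite mule_ge0// lee_fin.
    apply: eq_bigr => r; rewrite in_fset_set// inE/= => -[y _ <-].
    by rewrite esumZl// => l _; rewrite lee_fin.
  have -> : random_sum (fun y => (h y)%:E) = (fun t =>
      \sum_(r <- fset_set (range h)) r%:E * random_sum (EFin \o \1_(h @^-1` [set r])) t).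
    exact/funext.
  split.
    apply: emeasurable_sum => r; apply: measurable_funeM; apply: msum.
    exact: measurable_sfunP.
  rewrite integralT_nnsfun sintegralE fsbig_finite//=.
  rewrite ge0_integral_sum//; last 2 first.
  - move=> r; apply: measurable_funeM; apply: msum; exact: measurable_sfunP.
  - move=> r t _; have [r0|r0] := leP 0%R r.
      by rewrite mule_ge0 ?lee_fin//; apply: random_sum_ge0 => z; rewrite lee_fin.
    (* Nonnegativity is required for every real [r]; a negative one is not a value of [h], and its
       term is 0. *)
    rewrite preimage10 ?random_sum_indic0 ?mule0// => -[y _ hy].
    by move: r0; rewrite -hy ltNge fun_ge0.
  rewrite big_seq [RHS]big_seq; apply: eq_bigr => r.
  rewrite in_fset_set// inE/= => -[y _ <-].
  rewrite ge0_integralZl_EFin//.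
  - by move=> t _; apply: random_sum_ge0 => z; rewrite lee_fin.
  - apply: msum; exact: measurable_sfunP.
pose h := nnsfun_approx measurableT mg.
have hcvg t : (fun k => random_sum (fun y => (h k y)%:E) t) @ \oo --> random_sum g t.
  apply: esum_cvg.
  - by move=> k l _; rewrite lee_fin.
  - by move=> l _ i j ij; rewrite lee_fin; exact/lefP/nd_nnsfun_approx.
  - by move=> l _; apply: cvg_nnsfun_approx.
split.
  apply: (emeasurable_fun_cvg (fun k => random_sum (fun y => (h k y)%:E))) => //.
  by move=> k; exact: (hnn _).1.
transitivity (limn (fun k => \int[P]_t random_sum (fun y => (h k y)%:E) t)).
  rewrite -monotone_convergence//.
  - by apply: eq_integral => t _; apply/esym/cvg_lim.
  - by move=> k; exact: (hnn _).1.
  - by move=> k t _; apply: random_sum_ge0 => y; rewrite lee_fin.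
  - move=> t _ i j ij; apply: le_random_sum => y.
    by rewrite lee_fin; exact/lefP/nd_nnsfun_approx.
under eq_fun do rewrite (hnn _).2.
rewrite -monotone_convergence//.
- by apply: eq_integral => y _; apply/cvg_lim => //; exact: cvg_nnsfun_approx.
- by move=> k; exact/measurable_EFinP.
- by move=> k y _; rewrite lee_fin.
- by move=> y _ i j ij; rewrite lee_fin; exact/lefP/nd_nnsfun_approx.
Qed.

End integral.
End random_sums.

(** * Sums over distinct labels *)

Section distinct_tuples.
Context {R : realType} {L : choiceType}.
Local Open Scope ereal_scope.

Definition distinct_tuples (n : nat) (A : set L) : set (n.-tuple L) :=
  [set j : n.-tuple L | uniq j /\ forall i, A (tnth j i)].

Arguments distinct_tuples : clear implicits.

Lemma distinct_tuples0 (A : set L) : distinct_tuples 0%N A = [set [tuple]].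
Proof.
apply/seteqP; split=> [j _|j ->]; first exact: tuple0.
by split=> // -[].
Qed.

Lemma esum_seq (j : seq L) (a : L -> \bar R) : uniq j -> (forall l, 0 <= a l) ->
  \esum_(l in [set` j]) a l = \sum_(l <- j) a l.
Proof.
move=> uj a0; rewrite esum_fset// fsbig_finite//=; apply: perm_big.
by rewrite uniq_perm// => l; rewrite in_fset_set//; apply/idP/idP => [/set_mem|/mem_set].
Qed.

(* Splitting a free choice of a label according to whether it differs from the
entries of an n-tuple or equals one of them. *)
Lemma esum_distinct_tuplesS n (A : set L) (a : L -> R) (b : n.-tuple L -> R) :
  (forall l, 0 <= a l)%R -> (forall j, 0 <= b j)%R ->
  \esum_(l in A) (a l)%:E \is a fin_num ->
  \esum_(j in distinct_tuples n.+1 A) (a (thead j) * b [tuple of behead j])%:E +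
  \sum_(i < n) \esum_(j in distinct_tuples n A) (a (tnth j i) * b j)%:E =
  (\esum_(l in A) (a l)%:E) * \esum_(j in distinct_tuples n A) (b j)%:E.
Proof.
move=> a0 b0 Afin; rewrite -(fineK Afin) -esumZl; last 2 first.
- by apply: fine_ge0; apply: esum_ge0 => l _; rewrite lee_fin.
- by move=> j _; rewrite lee_fin.
rewrite fineK//.
pose C (j : n.-tuple L) := A `&` ~` [set` j].
transitivity (\esum_(j in distinct_tuples n A)
    (\esum_(l in C j) (a l * b j)%:E + \sum_(i < n) (a (tnth j i) * b j)%:E)).
  rewrite esumD; last 2 first.
  - by move=> j _; apply: esum_ge0 => l _; rewrite lee_fin mulr_ge0.
  - by move=> j _; apply: sume_ge0 => i _; rewrite lee_fin mulr_ge0.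
  rewrite esum_sum; last by move=> *; rewrite lee_fin mulr_ge0.
  congr (_ + _); rewrite esum_esum; last by move=> *; rewrite lee_fin mulr_ge0.
  rewrite (reindex_esum (distinct_tuples n A `*`` C) _
    (fun x => [tuple of x.2 :: x.1])); last first.
    split.
    - move=> [j l] /= [[uj Aj] [Al /= jl]]; split => /=.
        by rewrite uj andbT; apply/negP.
      by move=> i; case: (unliftP ord0 i) => [k|] ->; rewrite ?tnthS ?tnth0.
    - move=> [j l] [j' l'] _ _ /= /(congr1 val)/= [-> jj'].
      by congr (_, _); apply: val_inj.
    - move=> j; case/tupleP: j => l j [/= /andP[lj uj] Aj].
      exists (j, l); last exact: val_inj.
      split => /=; first by split=> // i; have := Aj (lift ord0 i); rewrite tnthS.
      by split; [have := Aj ord0; rewrite tnth0|apply/negP].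
  apply: eq_esum => -[j l] _ /=; rewrite theadE; congr (_ * b _)%:E.
  exact: val_inj.
apply: eq_esum => j [uj Aj].
rewrite (esumID [set` j] A); last by move=> l _; rewrite lee_fin.
rewrite ge0_muleDl; last 2 first.
- by apply: esum_ge0 => l _; rewrite lee_fin.
- by apply: esum_ge0 => l _; rewrite lee_fin.
have -> : A `&` [set` j] = [set` j].
  by apply/setIidPr => l /= /tnthP[i ->]; exact: Aj.
have al0 l : 0 <= (a l)%:E by rewrite lee_fin.
rewrite addeC (esum_seq uj al0).
congr (_ + _).
  rewrite big_tuple ge0_sume_distrl; last by move=> i _; rewrite lee_fin.
  by apply: eq_bigr => i _; rewrite EFinM.
rewrite muleC -esumZl//.
by apply: eq_esum => l _; rewrite EFinM muleC.
Qed.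

End distinct_tuples.
Arguments distinct_tuples {L} n A.

Section labels.
Context {R : realType}.
Implicit Types (u : configuration R) (V : set R).

Definition labels u : set (R * nat) := [set l | (l.2 < multiplicity u l.1)%N].

Lemma distinct_labelsE n u : distinct_labels u = distinct_tuples n (labels u).
Proof. by []. Qed.

Lemma finite_labels u V : bounded_set V -> finite_set (labels u `&` fst @^-1` V).
Proof.
move=> bV; have finV := locally_finite u bV.
apply: (@sub_finite_set _ _ ((V `&` [set x | multiplicity u x <> 0%N]) `*``
  (fun x => `I_(multiplicity u x)))); last exact: finite_setXR.
by move=> [x k] [/= kx Vx]; split => //; split => //= x0; move: kx; rewrite /labels/= x0.
Qed.

Lemma esum_card (T : choiceType) (A : set T) : finite_set A ->
  \esum_(t in A) 1%E = (#|` fset_set A|%:R%:E : \bar R).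
Proof.
move=> finA; have h01 (t : T) : (0 <= 1 :> \bar R)%E by rewrite lee_fin.
rewrite -[A in LHS]fset_setK// esum_seq// sumEFin big_const_seq count_predT.
by rewrite iter_addr_0.
Qed.

Lemma count_pointsE V u :
  count_points V u = \esum_(l in labels u) (\1_V l.1)%:E :> \bar R.
Proof.
transitivity (\esum_(x in V) \esum_(k in `I_(multiplicity u x)) (1%E : \bar R)).
  by apply: eq_esum => x _; rewrite esum_card// (@card_fset_set _ _ (multiplicity u x)).
rewrite esum_esum; last by move=> *; rewrite lee_fin.
transitivity (\esum_(l in labels u `&` fst @^-1` V) (1%E : \bar R)).
  by congr (esum _ _); apply/seteqP; split=> -[x k] /= [].
rewrite esum_mkcondr; apply: eq_esum => l _; rewrite indicE.
by rewrite (_ : (l \in fst @^-1` V) = (l.1 \in V))//; case: ifP.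
Qed.

Lemma count_points_nat V u : bounded_set V ->
  exists m, count_points V u = m%:R%:E :> \bar R.
Proof.
move=> bV; exists #|` fset_set (labels u `&` fst @^-1` V)|.
rewrite count_pointsE -esum_card; last exact: finite_labels.
rewrite esum_mkcondr; apply: eq_esum => l _; rewrite indicE.
by rewrite (_ : (l \in fst @^-1` V) = (l.1 \in V))//; case: ifP.
Qed.

Lemma count_points_fin V u : bounded_set V -> count_points V u \is a fin_num.
Proof. by move=> /count_points_nat-/(_ u)[m ->]. Qed.

End labels.

Section boxes.
Context {R : realType} {n : nat}.
Implicit Types V : 'I_n -> set R.

Definition points (j : n.-tuple (R * nat)) : n.-tuple (measurableTypeR R) :=
  [tuple of map fst j].

Lemma tnth_points j i : tnth (points j) i = (tnth j i).1.
Proof. by rewrite tnth_map. Qed.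

Definition box V : set (n.-tuple (measurableTypeR R)) :=
  [set t | forall i, V i (tnth t i)].

Lemma measurable_box V :
  (forall i, measurable (V i : set (measurableTypeR R))) -> measurable (box V).
Proof.
move=> mV; rewrite (_ : box V = \bigcap_(i in [set: 'I_n]) (@tnth n _ ^~ i @^-1` V i)).
  apply: fin_bigcap_measurable => // i _.
  rewrite -[X in measurable X]setTI.
  exact: (@measurable_tnth _ (measurableTypeR R)).
by apply/seteqP; split=> [t tV i _|t tV i]; [exact: tV|exact: (tV i I)].
Qed.

Lemma box_setI V W : box V `&` box W = box (fun i => V i `&` W i).
Proof.
by apply/seteqP; split=> [t [tV tW] i|t tVW]; [split|split=> i; have [] := tVW i].
Qed.

End boxes.

Lemma indic_box {R : realType} n (V : 'I_n -> set R) t :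
  \1_(box V) t = \prod_(i < n) \1_(V i) (tnth t i) :> R.
Proof.
rewrite indicE; case: (boolP (t \in box V)) => [/set_mem tV|tV].
  by rewrite big1// => i _; rewrite indicE mem_set//; exact: tV.
apply/esym/eqP; rewrite prodf_seq_eq0; apply: contrapT => /negP/hasPn h.
move/negP : tV; apply; apply/mem_set => i.
have := h i (mem_index_enum _); rewrite /= indicE.
by case: (boolP (_ \in V i)) => [/set_mem//|]; rewrite eqxx.
Qed.

Lemma bounded_setS (R : realType) (U V : set R) :
  U `<=` V -> bounded_set V -> bounded_set U.
Proof. by move=> UV [M [Mr h]]; exists M; split => // x Mx y /UV; exact: h. Qed.

(** * Measurability of sums over distinct labels in a box *)

Section measurable_sums.
Context {R : realType} d (T : measurableType d) (w : T -> configuration R).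
Hypothesis measurable_count : forall (V : set R) (m : nat),
  measurable (V : set (measurableTypeR R)) -> bounded_set V ->
  measurable [set t | count_points V (w t) = m%:R%:E].

Local Notation sum_over n :=
  (random_sum (R := R) (fun t => @distinct_labels R n (w t)) (@points R n)).

Lemma measurable_count_points (V : set R) :
  measurable (V : set (measurableTypeR R)) -> bounded_set V ->
  measurable_fun [set: T] (fun t => count_points V (w t) : \bar R).
Proof.
move=> mV bV _ Y mY; rewrite setTI.
(* The count of a bounded set is always a natural number, so every preimage is a countable union of
   the generating events. *)
rewrite (_ : _ @^-1` Y = \bigcup_(m in [set m : nat | Y m%:R%:E])
    [set t | count_points V (w t) = m%:R%:E]).
  by apply: bigcup_measurable => m _; exact: measurable_count.
apply/seteqP; split=> [t /= Yt|t [m /= Ym tm]]; last by rewrite /= tm.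
have [m tm] := count_points_nat (w t) bV.
by exists m => //=; rewrite -tm.
Qed.

(** When the free label coincides with the [i]-th one, coordinate [i] must satisfy both constraints,
    hence the intersection. Iterated, this writes the sum over a box as a polynomial in counts. *)
Lemma box_sumS n (V : 'I_n.+1 -> set R) t : (forall i, bounded_set (V i)) ->
  let V' i := V (lift ord0 i) in
  (sum_over n.+1 (EFin \o \1_(box V)) t +
  \sum_(i < n) sum_over n (EFin \o \1_(box (fun k => if k == i then V' k `&` V ord0 else V' k))) t =
  count_points (V ord0) (w t) * sum_over n (EFin \o \1_(box V')) t)%E.
Proof.
move=> bV V'; rewrite count_pointsE.
rewrite /random_sum !distinct_labelsE -esum_distinct_tuplesS//; last first.
  by rewrite -count_pointsE; exact: count_points_fin.
congr (_ + _)%E.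
  apply: eq_esum => j _ /=; congr _%:E.
  rewrite !indic_box big_ord_recl tnth_points; congr (_ * _).
  apply: eq_bigr => i _; rewrite !tnth_points tnth_behead.
  by congr (\1_(V _) (tnth _ _).1); apply: val_inj; rewrite /= inordK// ltnS.
apply: eq_bigr => i _; rewrite /random_sum.
apply: eq_esum => j _ /=; congr _%:E.
rewrite !indic_box (bigD1 i)//= eqxx indicI/=. rewrite [X in _ = _ * X](bigD1 i)//=.
rewrite !tnth_points mulrA [in RHS](mulrC (\1_(V ord0) _)); congr (_ * _).
by apply: eq_bigr => k /negPf ->.
Qed.

(** The induction covers all boxes at once, because the coincidence terms have modified sides.
    Finiteness is carried along to solve [box_sumS] for its first term. *)
Lemma box_sum_measurable n (V : 'I_n -> set R) :
  (forall i, bounded_set (V i)) ->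
  (forall i, measurable (V i : set (measurableTypeR R))) ->
  (forall t, sum_over n (EFin \o \1_(box V)) t \is a fin_num) /\
  measurable_fun [set: T] (sum_over n (EFin \o \1_(box V))).
Proof.
elim: n V => [|n IH] V bV mV.
  have E t : sum_over 0%N (EFin \o \1_(box V)) t = 1%E.
    rewrite /random_sum distinct_labelsE distinct_tuples0 esum_set1/= indic_box big_ord0//.
  split=> [t|]; first by rewrite E.
  by rewrite (_ : random_sum _ _ _ = cst 1%E)//; exact/funext.
pose V' i := V (lift ord0 i).
have bW i k : bounded_set (if k == i then V' k `&` V ord0 else V' k).
  case: ifP => _; last exact: bV.
  exact: bounded_setS (@subIsetr _ _ _) (bV ord0).
have mW i k : measurable ((if k == i then V' k `&` V ord0 else V' k) : set (measurableTypeR R)).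
  by case: ifP => _; [apply: measurableI|]; exact: mV.
have [finV' mV'] : _ := IH V' (fun=> bV _) (fun=> mV _).
have finW i := (IH _ (bW i) (mW i)).1.
have mmW i := (IH _ (bW i) (mW i)).2.
have sumfin t : (\sum_(i < n) sum_over n (EFin \o \1_(box (fun k => if k == i then V' k `&` V ord0 else V' k))) t \is a fin_num)%E.
  by apply/sum_fin_numP => i _ _; exact: finW.
have E t : sum_over n.+1 (EFin \o \1_(box V)) t =
    (count_points (V ord0) (w t) * sum_over n (EFin \o \1_(box V')) t -
    \sum_(i < n) sum_over n (EFin \o \1_(box (fun k => if k == i then V' k `&` V ord0 else V' k))) t)%E.
  by rewrite -box_sumS// addeK.
split=> [t|].
  by rewrite E fin_numB sumfin andbT fin_numM// count_points_fin.
rewrite (_ : random_sum _ _ _ = (fun t => count_points (V ord0) (w t) * sum_over n (EFin \o \1_(box V')) t)%E \-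
    (fun t => \sum_(i < n) sum_over n (EFin \o \1_(box (fun k => if k == i then V' k `&` V ord0 else V' k))) t)%E)%E; last exact/funext.
apply: emeasurable_funB.
  apply: emeasurable_funM => //; exact: measurable_count_points.
exact: emeasurable_sum.
Qed.

End measurable_sums.

(** * Lebesgue measure on tuples *)

Section open_boxes.
Context {R : realType} {n : nat}.

Definition open_boxes : set (set (n.-tuple (measurableTypeR R))) :=
  [set A | exists a b : 'I_n -> R, A = box (fun i => `]a i, b i[%classic)].

Definition cube (k : nat) : set (n.-tuple (measurableTypeR R)) :=
  box (fun=> `](- k%:R)%R, k%:R[%classic).

Lemma open_boxes_setI : setI_closed open_boxes.
Proof.
move=> _ _ [a [b ->]] [a' [b' ->]].
exists (fun i => Order.max (a i) (a' i)), (fun i => Order.min (b i) (b' i)).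
rewrite box_setI; congr box; apply/funext => i; apply/seteqP; split => x /=;
  rewrite !in_itv/= gt_max lt_min.
  by move=> [/andP[-> ->] /andP[-> ->]].
by move=> /andP[/andP[-> ->] /andP[-> ->]].
Qed.

Lemma cube_open_box k : open_boxes (cube k).
Proof. by exists (fun=> (- k%:R)%R), (fun=> k%:R). Qed.

Lemma cube_nd : nondecreasing_seq cube.
Proof.
move=> k l kl; apply/subsetPset => t tk i; have /= := tk i.
rewrite !in_itv/= => /andP[h1 h2]; apply/andP; split.
  by apply: le_lt_trans h1; rewrite lerN2 ler_nat.
by apply: lt_le_trans h2 _; rewrite ler_nat.
Qed.

Lemma cube_cover : \bigcup_k cube k = setT.
Proof.
apply/seteqP; split => // t _.
exists (\max_(i < n) (Num.truncn `|tnth t i|).+1)%N => // i /=.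
have h : `|tnth t i| < (\max_(i < n) (Num.truncn `|tnth t i|).+1)%N%:R.
  apply: lt_le_trans (truncnS_gt _) _; rewrite ler_nat.
  by rewrite (bigD1 i)//= leq_max leqnn.
by rewrite in_itv/= -ltr_norml.
Qed.

Lemma measurable_open_boxes :
  @measurable _ (n.-tuple (measurableTypeR R)) = <<s open_boxes >>.
Proof.
apply/seteqP; split; last first.
  apply: smallest_sub; first exact: sigma_algebra_measurable.
  by move=> _ [a [b ->]]; apply: measurable_box => i; exact: measurable_itv.
pose T' := g_sigma_algebraType open_boxes.
have mid : measurable_fun [set: T'] (id : T' -> n.-tuple (measurableTypeR R)).
  apply/measurable_fun_tnthP => i.
  apply: (measurability _ (RGenOInfty.measurableE R)) => _ [_ [x ->] <-].
  rewrite setTI.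
  (* A half-line condition on one coordinate is exhausted by bounded boxes. *)
  rewrite (_ : _ @^-1` _ = \bigcup_k (box (fun j => `](if j == i then x else - k%:R)%R, k%:R[%classic) : set T')).
    apply: bigcup_measurable => k _; apply: sub_sigma_algebra.
    by exists (fun j => if j == i then x else - k%:R), (fun=> k%:R).
  apply/seteqP; split => [t /= xt|t [k _ tk]]; last first.
    by have /= := tk i; rewrite !in_itv/= eqxx andbT => /andP[].
  have [k _ tk] : (\bigcup_k cube k) t by rewrite cube_cover.
  exists k => // j /=; have /= := tk j; rewrite !in_itv/=.
  case: eqP => [->|//] /andP[_ ->]; rewrite andbT.
  by move: xt; rewrite in_itv/= andbT.
by move=> A mA; have := mid measurableT A mA; rewrite setTI.
Qed.

End open_boxes.

Section lebesgue_tuple.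
Local Open Scope ereal_scope.
Context {R : realType}.
Local Notation mu := (@lebesgue_measure R).
Local Notation RT n := (n.-tuple (measurableTypeR R)).

Lemma integral_lebesgue_tuple0 (g : RT 0 -> \bar R) :
  measurable_fun setT g -> \int[lebesgue_tuple R 0]_t g t = g [tuple].
Proof. by move=> mg; rewrite /= integral_dirac// diracT mul1e. Qed.

Lemma measurable_fun_tcons n d (Y : measurableType d) (g : RT n.+1 -> Y) :
  measurable_fun setT g ->
  measurable_fun setT (fun p : measurableTypeR R * RT n => g (tcons p)).
Proof. by move=> mg; apply: measurableT_comp => //; exact: measurable_tcons. Qed.

Lemma ge0_integral_lebesgue_tupleS n (g : RT n.+1 -> \bar R) :
  measurable_fun setT g -> (forall t, 0 <= g t) ->
  \int[lebesgue_tuple R n.+1]_t g t =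
  \int[mu]_x \int[lebesgue_tuple R n]_t g (tcons (x, t)).
Proof.
move=> mg g0.
have h := ge0_integral_pushforward (@measurable_tcons _ (measurableTypeR R) n)
  (mu \x lebesgue_tuple R n) measurableT mg.
apply: etrans (etrans (h _) _); last 2 first.
- by move=> y _; exact: g0.
- by rewrite preimage_setT fubini_tonelli1//=; exact: measurable_fun_tcons.
apply: eq_measure_integral => //; exact: (@measurable_tcons _ (measurableTypeR R)).
Qed.

Lemma measurable_prod_tnth n (f : 'I_n -> R -> R) :
  (forall i, measurable_fun [set: measurableTypeR R] (f i : _ -> measurableTypeR R)) ->
  measurable_fun setT (fun t : RT n => (\prod_(i < n) f i (tnth t i))%R).
Proof.
move=> mf; apply: measurable_prod => i _.
apply: (measurableT_comp (mf i)); exact: (@measurable_tnth _ (measurableTypeR R)).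
Qed.

Lemma integral_lebesgue_tuple_prod n (f : 'I_n -> R -> R) :
  (forall i, measurable_fun [set: measurableTypeR R] (f i : _ -> measurableTypeR R)) ->
  (forall i x, 0 <= f i x)%R ->
  \int[lebesgue_tuple R n]_t (\prod_(i < n) f i (tnth t i))%R%:E =
  \prod_(i < n) \int[mu]_x (f i x)%:E.
Proof.
elim: n f => [|n IH] f mf f0.
  under eq_integral do rewrite big_ord0.
  by rewrite integral_lebesgue_tuple0 ?big_ord0.
rewrite ge0_integral_lebesgue_tupleS; last 2 first.
- by apply/measurable_EFinP; exact: measurable_prod_tnth.
- by move=> t; rewrite lee_fin prodr_ge0.
transitivity (\int[mu]_x ((f ord0 x)%:E * \prod_(i < n) \int[mu]_x (f (lift ord0 i) x)%:E)).
  apply: eq_integral => x _; rewrite -IH//.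
  rewrite -ge0_integralZl//; last 3 first.
  - apply/measurable_EFinP.
    exact: (measurable_prod_tnth (f := fun i => f (lift ord0 i))).
  - by move=> t _; rewrite lee_fin prodr_ge0.
  - by rewrite lee_fin.
  apply: eq_integral => t _; rewrite big_ord_recl -EFinM; congr (_ * _)%:E.
  by apply: eq_bigr => i _; rewrite tnthS.
rewrite ge0_integralZr// ?big_ord_recl//.
- by apply/measurable_EFinP; exact: mf.
- by move=> x _; rewrite lee_fin.
- by apply: prode_ge0 => i _; apply: integral_ge0 => x _; rewrite lee_fin.
Qed.

Lemma lebesgue_tuple_box n (a b : 'I_n -> R) : (forall i, (a i < b i)%R) ->
  lebesgue_tuple R n (box (fun i => `]a i, b i[%classic)) =
  (\prod_(i < n) (b i - a i))%:E.
Proof.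
move=> ab.
have mbox : measurable (box (fun i => `]a i, b i[%classic) : set (RT n)).
  by apply: measurable_box => i; exact: measurable_itv.
rewrite -[box _]setIT -integral_indic//.
under eq_integral do rewrite indic_box.
rewrite (integral_lebesgue_tuple_prod (f := fun i => \1_(`]a i, b i[%classic)))//.
rewrite -prodEFin; apply: eq_bigr => i _.
by rewrite integral_indic//= setIT lebesgue_measure_itv/= lte_fin ab -EFinB.
Qed.

End lebesgue_tuple.

(** * Correlations of the Poisson process *)

Section bump_approximation.
Context {R : realType}.
Implicit Types (a b x : R).

(** A parabola made steeper with [k] and cut at height 1: for [a < b] it is continuous, supported in
    [[a, b]], and increases to the indicator of the open interval. *)
Definition trap (k : nat) a b x : R :=
  Num.min 1 (k%:R * Num.max 0 ((x - a) * (b - x))).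

Lemma trap_ge0 k a b x : 0 <= trap k a b x.
Proof. by rewrite le_min ler01 mulr_ge0// le_max lexx. Qed.

Lemma trap_nd a b x : nondecreasing_seq (fun k => trap k a b x).
Proof.
move=> k l kl; rewrite /trap le_min ge_min lexx/= ge_min; apply/orP; right.
by rewrite ler_wpM2r ?ler_nat// le_max lexx.
Qed.

Lemma trap_out k a b x : a < b -> x \notin `]a, b[ -> trap k a b x = 0.
Proof.
move=> ab; rewrite in_itv/= negb_and -!leNgt /trap => h.
have -> : Num.max 0 ((x - a) * (b - x)) = 0.
  by apply/max_idPl; case/orP: h => h; nra.
by rewrite mulr0; apply/min_idPr.
Qed.

Lemma trap_le_indic k a b x : a < b -> trap k a b x <= \1_(`]a, b[%classic) x.
Proof.
move=> ab; rewrite indicE; case: (boolP (x \in `]a, b[%classic)) => h.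
  by rewrite /trap ge_min lexx.
by rewrite trap_out//; apply: contra h => h; rewrite inE.
Qed.

Lemma continuous_trap k a b : continuous (trap k a b).
Proof.
move=> x.
have cm : {for x, continuous ((cst (0 : R^o)) \max (fun y : R => (y - a) * (b - y) : R^o))}.
  apply: continuous_max; first exact: cst_continuous.
  by apply: cvgM; [apply: cvgB; [exact: cvg_id|exact: cvg_cst]
    |apply: cvgB; [exact: cvg_cst|exact: cvg_id]].
have ck : {for x, continuous (fun y : R => k%:R * Num.max 0 ((y - a) * (b - y)) : R^o)}.
  by apply: cvgM; [exact: cvg_cst|exact: cm].
apply: (continuous_min (f := cst (1 : R^o)) _ ck); exact: cst_continuous.
Qed.

Lemma cvg_trap a b x : a < b -> (fun k => trap k a b x) @ \oo --> (\1_(`]a, b[%classic) x : R).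
Proof.
move=> ab; apply: cvg_near_cst; rewrite indicE.
case: (boolP (x \in `]a, b[%classic)) => h; last first.
  by near=> k; rewrite trap_out//; apply: contra h => h; rewrite inE.
move: h; rewrite inE/= in_itv/= => /andP[ax xb].
have p0 : 0 < (x - a) * (b - x) by rewrite mulr_gt0// subr_gt0.
near=> k; rewrite /trap max_r ?(ltW p0)//; apply/min_idPl.
rewrite -ler_pdivrMr// mul1r.
by near: k; exact: nbhs_infty_ger.
Unshelve. all: by end_near. Qed.

Variable n : nat.
Implicit Types A B : 'I_n -> R.

Definition box_trap k A B (x : 'rV[R]_n) : R := \prod_(i < n) trap k (A i) (B i) (x 0 i).

Lemma continuous_box_trap k A B : continuous (box_trap k A B).
Proof.
apply: continuous_big => [|i _ x]; first exact: mul_continuous.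
apply: (@continuous_comp _ _ _ (fun x : 'rV[R]_n => x 0 i)).
  exact: coord_continuous.
exact: continuous_trap.
Qed.

Lemma box_trap_compact k A B : (forall i, A i < B i) ->
  compact (closure [set x | box_trap k A B x != 0]).
Proof.
move=> AB.
have cbox : compact [set v : 'rV[R]_n | forall i, `[A i, B i]%classic (v ord0 i)].
  by apply: (rV_compact (A := fun i => `[A i, B i]%classic)) => i; exact: segment_compact.
apply: (subclosed_compact _ cbox); first exact: closed_closure.
rewrite [X in _ `<=` X]((closure_id _).1 _); last first.
  exact: (compact_closed (@norm_hausdorff _ _) cbox).
apply: closureS => x /=; rewrite /box_trap => h i.
rewrite /= in_itv/=; apply: contrapT => /negP xi; move/negP: h; apply; apply/eqP.
rewrite (bigD1 i)//= trap_out ?mul0r//; apply: contra xi; rewrite in_itv/=.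
by move=> /andP[/ltW -> /ltW ->].
Qed.

Lemma box_trapE k A B (t : n.-tuple R) :
  box_trap k A B (row_of_tuple t) = \prod_(i < n) trap k (A i) (B i) (tnth t i).
Proof. by apply: eq_bigr => i _; rewrite mxE. Qed.

Lemma measurable_box_trap k A B : measurable_fun setT
  (fun t : n.-tuple (measurableTypeR R) => box_trap k A B (row_of_tuple t)).
Proof.
under eq_fun do rewrite box_trapE.
apply: (measurable_prod_tnth (f := fun i => trap k (A i) (B i))) => i.
by apply: continuous_measurable_fun; exact: continuous_trap.
Qed.

Lemma box_trap_ge0 k A B (x : 'rV[R]_n) : 0 <= box_trap k A B x.
Proof. by apply: prodr_ge0 => i _; exact: trap_ge0. Qed.

Lemma box_trap_nd A B (x : 'rV[R]_n) : nondecreasing_seq (fun k => box_trap k A B x).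
Proof.
move=> k l kl; apply: ler_prod => i _; rewrite trap_ge0/=; exact: trap_nd.
Qed.

Lemma box_trap_le k A B (t : n.-tuple R) : (forall i, A i < B i) ->
  box_trap k A B (row_of_tuple t) <= \1_(box (fun i => `]A i, B i[%classic)) t.
Proof.
move=> AB; rewrite box_trapE indic_box; apply: ler_prod => i _.
by rewrite trap_ge0 trap_le_indic.
Qed.

Lemma cvg_box_trap A B (t : n.-tuple R) : (forall i, A i < B i) ->
  (fun k => box_trap k A B (row_of_tuple t)) @ \oo -->
  (\1_(box (fun i => `]A i, B i[%classic)) t : R).
Proof.
move=> AB; under eq_fun do rewrite box_trapE.
rewrite indic_box.
apply: cvg_big => [|i _]; [exact: mul_continuous|exact: cvg_trap].
Qed.

End bump_approximation.

Lemma rsum_ge0E (R : realType) (T : choiceType) (D : set T) (f : T -> R) :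
  (forall t, D t -> 0 <= f t) -> rsum D f = fine (\esum_(t in D) (f t)%:E).
Proof.
move=> f0; rewrite /rsum [X in _ - fine X]esum1 ?subr0.
  by congr fine; apply: eq_esum => t Dt; rewrite funeposE/= max_l// lee_fin f0.
by move=> t Dt; rewrite funenegE/= max_r// lee_fin oppr_le0 f0.
Qed.

Lemma bounded_itv (R : realType) (a b : R) : bounded_set `]a, b[%classic.
Proof.
exists (Num.max `|a| `|b|); split => [|x Mx y /=].
  by rewrite max_real// num_real.
rewrite in_itv/= => /andP[ay yb]; rewrite ltW//; apply: le_lt_trans Mx.
rewrite le_max; case: (leP 0 y) => y0; apply/orP; [right|left].
  by rewrite (ger0_norm y0); apply: le_trans (ler_norm _); exact: ltW.
by rewrite (ltr0_norm y0) -normrN; apply: le_trans (ler_norm _); rewrite lerN2 ltW.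
Qed.

Section point_process_sums.
Context {R : realType} d (T : measurableType d) (P : probability T R).
Variable w : point_process P.

Lemma measurable_count_process (V : set R) (m : nat) :
  measurable (V : set (measurableTypeR R)) -> bounded_set V ->
  measurable [set t | count_points V (w t) = m%:R%:E].
Proof.
move=> mV bV; rewrite -[X in measurable X]setTI.
apply: (measurable_funPT w measurableT [set u | count_points V u = m%:R%:E]).
apply: sub_sigma_algebra.
by exists V, m.
Qed.

Definition sum_over n : (n.-tuple (measurableTypeR R) -> \bar R) -> T -> \bar R :=
  random_sum (fun t => @distinct_labels R n (w t)) (@points R n).

Lemma sum_over_cube_lty n k t : (sum_over (EFin \o \1_(@cube R n k)) t < +oo)%E.
Proof.
have [] := box_sum_measurable measurable_count_process (V := fun=> `](- k%:R)%R, k%:R[%classic) (n := n).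
- by move=> _; exact: bounded_itv.
- by move=> _; exact: measurable_itv.
by move=> /(_ t) + _; rewrite fin_numElt => /andP[].
Qed.

Lemma sum_over_indic_measurable n (A : set (n.-tuple (measurableTypeR R))) :
  measurable A -> measurable_fun setT (sum_over (EFin \o \1_A)).
Proof.
apply: (measurable_random_sum_indic measurable_open_boxes open_boxes_setI
  cube_open_box cube_nd cube_cover (@sum_over_cube_lty n)).
move=> _ [a [b ->]]; apply: (box_sum_measurable measurable_count_process _ _).2.
  by move=> i; exact: bounded_itv.
by move=> i; exact: measurable_itv.
Qed.

Local Notation nu n := (intensity P (@sum_over_indic_measurable n)).

Lemma sum_over_intensity n (g : n.-tuple (measurableTypeR R) -> \bar R) :
  measurable_fun setT g -> (forall t, 0 <= g t)%E ->
  measurable_fun setT (sum_over g) /\ (\int[P]_t sum_over g t = \int[nu n]_t g t)%E.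
Proof. exact: measurable_random_sum. Qed.

Lemma Re_correlation n (eta : 'rV[R]_n -> R[i]) :
  complex.Re (correlation eta w) =
  \int[P]_t rsum (@distinct_labels R n (w t))
    (fun j => complex.Re (eta (row_of_tuple (points j)))).
Proof.
rewrite /correlation /cintegral/=; apply: eq_Rintegral => t _.
rewrite /distinct_sum/=; congr rsum; apply/funext => j; congr (complex.Re (eta _)).
by apply/rowP => i; rewrite !mxE tnth_points.
Qed.

Lemma Im_correlation n (eta : 'rV[R]_n -> R[i]) :
  complex.Im (correlation eta w) =
  \int[P]_t rsum (@distinct_labels R n (w t))
    (fun j => complex.Im (eta (row_of_tuple (points j)))).
Proof.
rewrite /correlation /cintegral/=; apply: eq_Rintegral => t _.
rewrite /distinct_sum/=; congr rsum; apply/funext => j; congr (complex.Im (eta _)).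
by apply/rowP => i; rewrite !mxE tnth_points.
Qed.

Variable lambda : R.
Hypothesis lambda_gt0 : 0 < lambda.
Hypothesis w_poisson : is_poisson lambda w.

Lemma poisson_box n (a b : 'I_n -> R) : (0 < n)%N -> (forall i, a i < b i) ->
  (\int[P]_t sum_over (EFin \o \1_(box (fun i => `]a i, b i[%classic))) t =
   (lambda ^+ n)%:E * lebesgue_tuple R n (box (fun i => `]a i, b i[%classic)))%E.
Proof.
move=> n0 ab; set Q := box _.
pose f k (t : n.-tuple (measurableTypeR R)) := (box_trap k a b (row_of_tuple t))%:E.
have mf k : measurable_fun setT (f k) by apply/measurable_EFinP; exact: measurable_box_trap.
have f0 k t : (0 <= f k t)%E by rewrite lee_fin box_trap_ge0.
have fnd t : {homo f^~ t : k l / (k <= l)%N >-> (k <= l)%E}.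
  by move=> k l kl; rewrite lee_fin; exact: box_trap_nd.
have fcvg t : f ^~ t @ \oo --> (\1_Q t)%:E.
  by apply: cvg_EFin; [exact: nearW|exact: cvg_box_trap].
have mQ : measurable Q by apply: measurable_box => i; exact: measurable_itv.
have SQ t : sum_over (EFin \o \1_Q) t \is a fin_num.
  apply: (box_sum_measurable measurable_count_process _ _).1.
    by move=> i; exact: bounded_itv.
  by move=> i; exact: measurable_itv.
have Sf k t : sum_over (f k) t \is a fin_num.
  rewrite ge0_fin_numE ?random_sum_ge0//; apply: le_lt_trans (_ : sum_over (EFin \o \1_Q) t < +oo)%E.
    by apply: le_random_sum => y; rewrite lee_fin; exact: box_trap_le.
  by rewrite -ge0_fin_numE ?random_sum_ge0// => y; rewrite lee_fin.
have X_cvg : (fun k => \int[P]_t sum_over (f k) t)%E @ \oo --> (\int[P]_t sum_over (EFin \o \1_Q) t)%E.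
  apply: ge0_cvg_integral.
  - move=> k; exact: (sum_over_intensity (mf k) (f0 k)).1.
  - by move=> k t; exact: random_sum_ge0.
  - by move=> t k l kl; apply: le_random_sum => y; exact: fnd.
  - by move=> t; apply: esum_cvg => // l _; exact: fnd.
have y_cvg : (fun k => \int[lebesgue_tuple R n]_t f k t)%E @ \oo --> lebesgue_tuple R n Q.
  rewrite -[Q in X in _ --> X]setIT -integral_indic//.
  exact: ge0_cvg_integral.
have yle k : (\int[lebesgue_tuple R n]_t f k t <= lebesgue_tuple R n Q)%E.
  rewrite -[Q in leRHS]setIT -integral_indic//; apply: ge0_le_integral => //.
  - by apply/measurable_EFinP; exact: measurable_indic.
  - by move=> t _; rewrite lee_fin; exact: box_trap_le.
have Q0 : (0 < lebesgue_tuple R n Q)%E.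
  by rewrite lebesgue_tuple_box// lte_fin prodr_gt0// => i _; rewrite subr_gt0.
have Qoo : (lebesgue_tuple R n Q < +oo)%E by rewrite lebesgue_tuple_box// ltry.
(* Both sides of [is_poisson] pass through [fine], which sends an infinite expectation to 0. A
   positive right-hand side excludes that. For [k = 0] the function [f k] is 0, but its integral is
   positive from some [k] on, which is enough for the limit. *)
have key k : (0 < \int[lebesgue_tuple R n]_t f k t)%E ->
    (\int[P]_t sum_over (f k) t = (lambda ^+ n)%:E * \int[lebesgue_tuple R n]_t f k t)%E.
  move=> y0.
  have yfin : (\int[lebesgue_tuple R n]_t f k t)%E \is a fin_num.
    by rewrite ge0_fin_numE ?(ltW y0)//; exact: le_lt_trans Qoo.
  have cc : @continuous_compactly_supported R n (fun x => (box_trap k a b x)%:C%C).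
    split => /=; [exact: continuous_box_trap|exact: cst_continuous|].
    have -> : [set x | (box_trap k a b x)%:C%C != 0] = [set x | box_trap k a b x != 0].
      by apply/funext => x /=; rewrite (inj_eq (@complexI R)).
    exact: box_trap_compact.
  have /(congr1 (@complex.Re R)) := w_poisson n0 cc.
  have -> : complex.Re (correlation (fun x => (box_trap k a b x)%:C%C) w) =
      fine (\int[P]_t sum_over (f k) t)%E.
    rewrite Re_correlation /Rintegral; congr fine; apply: eq_integral => t _.
    rewrite rsum_ge0E ?fineK//; last by move=> j _; exact: box_trap_ge0.
    exact: Sf.
  have -> : complex.Re (lebesgue_integral_rV
        (fun x => (box_trap k a b x)%:C%C * (lambda ^+ n)%:C%C)) =
      fine ((lambda ^+ n)%:E * \int[lebesgue_tuple R n]_t f k t)%E.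
    rewrite /= /Rintegral -ge0_integralZl//; last by rewrite lee_fin exprn_ge0// ltW.
    congr fine; apply: eq_integral => t _.
    by rewrite -EFinM mulr0 subr0 mulrC.
  move: y0 yfin; case: (\int[lebesgue_tuple R n]_t f k t)%E => // y; rewrite lte_fin => y0 _.
  rewrite -EFinM /=.
  have : (0 <= \int[P]_t sum_over (f k) t)%E.
    by apply: integral_ge0 => t _; exact: random_sum_ge0.
  have ly0 : 0 < lambda ^+ n * y by rewrite mulr_gt0// exprn_gt0.
  case: (\int[P]_t sum_over (f k) t)%E => [x _ /= ->|_ /= h|]//.
  by move: ly0; rewrite -h ltxx.
have [N _ HN] : \forall k \near \oo, (0 < \int[lebesgue_tuple R n]_t f k t)%E.
  by apply: (y_cvg [set y | (0 < y)%E]); apply: open_nbhs_nbhs; split => //; exact: open_ereal_gt_ereal.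
have ly_cvg : (fun k => (lambda ^+ n)%:E * \int[lebesgue_tuple R n]_t f k t)%E @ \oo -->
    ((lambda ^+ n)%:E * lebesgue_tuple R n Q)%E.
  exact: cvgeZl.
apply: (cvg_unique _ X_cvg) => //.
apply: cvg_trans ly_cvg; apply: near_eq_cvg.
near=> k; rewrite key//; apply: HN => /=; near: k; exact: nbhs_infty_ge.
Unshelve. all: by end_near. Qed.

Lemma poisson_intensity n (A : set (n.-tuple (measurableTypeR R))) : (0 < n)%N ->
  measurable A -> nu n A = ((lambda ^+ n)%:E * lebesgue_tuple R n A)%E.
Proof.
move=> n0 mA.
have l0 : 0 <= lambda ^+ n by rewrite exprn_ge0// ltW.
have boxE (a b : 'I_n -> R) :
    nu n (box (fun i => `]a i, b i[%classic)) =
    mscale (NngNum l0) (lebesgue_tuple R n) (box (fun i => `]a i, b i[%classic)).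
  have [ab|/existsNP[i /negP]] := pselect (forall i, a i < b i).
    exact: poisson_box.
  rewrite -leNgt => ba.
  rewrite (_ : box _ = set0) ?measure0//; apply/seteqP; split => // t /(_ i) /=.
  by rewrite in_itv/= => /andP[h1 h2]; move: ba; rewrite leNgt (lt_trans h1 h2).
rewrite (measure_unique open_boxes (@cube R n) measurable_open_boxes open_boxes_setI
  cube_open_box cube_cover _ (mscale (NngNum l0) (lebesgue_tuple R n)))//.
- by move=> _ [a [b ->]]; exact: boxE.
- move=> k; apply: (@le_lt_trans _ _ (mscale (NngNum l0) (lebesgue_tuple R n) (cube k))).
    by rewrite -(boxE (fun=> - k%:R) (fun=> k%:R)).
  rewrite /mscale/= lte_mul_pinfty// ?lee_fin//.
  (* The cube of index 0 is empty, since [n] is positive and its sides are empty intervals;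
     [lebesgue_tuple_box] speaks only of nonempty sides. *)
  case: k => [|k].
    rewrite (_ : cube _ = set0) ?measure0//; apply/seteqP; split => // t /(_ (Ordinal n0)) /=.
    by rewrite in_itv/= oppr0 => /andP[h1 h2]; move: (lt_trans h1 h2); rewrite ltxx.
  rewrite lebesgue_tuple_box ?ltry// => _.
  by rewrite (@lt_trans _ _ 0)// ?oppr_lt0 ltr0n.
Qed.

Lemma sum_over_poisson n (g : n.-tuple (measurableTypeR R) -> \bar R) : (0 < n)%N ->
  measurable_fun setT g -> (forall t, 0 <= g t)%E ->
  (\int[P]_t sum_over g t = (lambda ^+ n)%:E * \int[lebesgue_tuple R n]_t g t)%E.
Proof.
move=> n0 mg g0.
have l0 : 0 <= lambda ^+ n by rewrite exprn_ge0// ltW.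
rewrite (sum_over_intensity mg g0).2.
rewrite (eq_measure_integral (mscale (NngNum l0) (lebesgue_tuple R n))); last first.
  by move=> A mA _; exact: poisson_intensity.
by rewrite ge0_integral_mscale.
Qed.

End point_process_sums.

(** [rsum] applies [fine] at every sample point, while the expectation being finite makes the sums
    finite only almost surely. *)
Lemma integrable_fine d (T : measurableType d) (R : realType)
    (mu : {measure set T -> \bar R}) (f : T -> \bar R) :
  mu.-integrable setT f ->
  mu.-integrable setT (EFin \o (fine \o f)) /\
  (\int[mu]_t (fine (f t))%:E = \int[mu]_t f t)%E.
Proof.
move=> intf; have mf := measurable_int _ intf.
have mff : measurable_fun setT (EFin \o (fine \o f)).
  by apply/measurable_EFinP; exact: measurableT_comp.
have aeE : ae_eq mu setT (EFin \o (fine \o f)) f.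
  have := integrable_ae measurableT intf.
  by apply: filterS => t h _ /=; rewrite fineK//; exact: h.
have E : (\int[mu]_t (fine (f t))%:E = \int[mu]_t f t)%E by exact: ae_eq_integral.
split => //; apply/integrableP; split => //.
have /integrableP[_] := intf; apply: le_lt_trans; apply: ge0_le_integral => //.
- exact: measurableT_comp.
- exact: measurableT_comp.
- by move=> t _ /=; case: (f t) => //=; rewrite leey.
Qed.

Section poisson_correlation.
Context {R : realType} d (T : measurableType d) (P : probability T R).
Variables (w : point_process P) (lambda : R).
Hypothesis lambda_gt0 : 0 < lambda.
Hypothesis w_poisson : is_poisson lambda w.

Lemma poisson_rsum n (g : n.-tuple (measurableTypeR R) -> R) : (0 < n)%N ->
  (lebesgue_tuple R n).-integrable setT (EFin \o g) ->
  \int[P]_t rsum (@distinct_labels R n (w t)) (fun j => g (points j)) =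
  lambda ^+ n * \int[lebesgue_tuple R n]_t g t.
Proof.
move=> n0 intg; have mg := measurable_int _ intg.
have l0 : 0 <= lambda ^+ n by rewrite exprn_ge0// ltW.
have part (h : n.-tuple (measurableTypeR R) -> \bar R) :
    (lebesgue_tuple R n).-integrable setT h -> (forall t, 0 <= h t)%E ->
    P.-integrable setT (EFin \o (fine \o sum_over w h)) /\
    \int[P]_t fine (sum_over w h t) = lambda ^+ n * fine (\int[lebesgue_tuple R n]_t h t)%E.
  move=> inth h0; have mh := measurable_int _ inth.
  have fh := integrable_fin_num measurableT inth.
  have E := sum_over_poisson lambda_gt0 w_poisson n0 mh h0.
  have ints : P.-integrable setT (sum_over w h).
    apply/integrableP; split; first exact: (sum_over_intensity w mh h0).1.
    under eq_integral do rewrite gee0_abs ?random_sum_ge0//.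
    by rewrite E -(fineK fh) -EFinM ltry.
  have [? Ef] := integrable_fine ints; split => //.
  by rewrite /Rintegral Ef E -[in LHS](fineK fh).
have [ip Ep] := part _ (integrable_funepos measurableT intg) (funepos_ge0 _).
have [im Em] := part _ (integrable_funeneg measurableT intg) (funeneg_ge0 _).
transitivity (\int[P]_t (fine (sum_over w (EFin \o g)^\+%E t) - fine (sum_over w (EFin \o g)^\-%E t))).
  apply: eq_Rintegral => t _; rewrite /rsum; congr (fine _ - fine _); apply: eq_esum => j _.
    by rewrite !funeposE.
  by rewrite !funenegE.
rewrite RintegralB// Ep Em -mulrBr; congr (_ * _).
have fp := integrable_fin_num measurableT (integrable_funepos measurableT intg).
have fm := integrable_fin_num measurableT (integrable_funeneg measurableT intg).
by rewrite -(fineB fp fm); congr fine; apply/esym; exact: integralE.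
Qed.

End poisson_correlation.

(** * Images of configurations *)

Lemma set_bij_distinct_tuples (L : choiceType) n (A B : set L) (b : L -> L) :
  set_bij A B b ->
  set_bij (distinct_tuples n A) (distinct_tuples n B) (fun j => [tuple of map b j]).
Proof.
move=> [AB injb surjb]; split.
- move=> j [uj Aj]; split=> [/=|i]; last by rewrite tnth_map; exact: AB.
  rewrite map_inj_in_uniq// => x y /tnthP[i ->] /tnthP[k ->].
  by apply: injb; exact: mem_set.
- move=> j j' /[!inE] -[_ Aj] [_ Aj'] /(congr1 (fun t => tnth t)) jj'.
  apply: eq_from_tnth => i; apply: injb; rewrite ?inE//.
  by have := congr1 (fun f => f i) jj'; rewrite !tnth_map.
- move=> j [uj Bj].
  have h i : {x | A x /\ b x = tnth j i}.
    by apply: cid; have [x Ax bx] := surjb _ (Bj i); exists x.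
  pose k := [tuple projT1 (h i) | i < n].
  have kj : [tuple of map b k] = j.
    by apply: eq_from_tnth => i; rewrite tnth_map tnth_mktuple; case: (projT2 (h i)).
  exists k => //; split => [|i].
    by apply: (@map_uniq _ _ b); move: (congr1 val kj) => /= ->.
  by rewrite tnth_mktuple; case: (projT2 (h i)).
Qed.

Section image_configuration.
Context {R : realType} (f : R -> R).
Hypothesis proper_f : forall V, bounded_set V -> bounded_set (f @^-1` V).
Implicit Type u : configuration R.

Definition fiber u x : set (R * nat) := labels u `&` fst @^-1` (f @^-1` [set x]).

Lemma finite_fiber u x : finite_set (fiber u x).
Proof.
apply: finite_labels; apply: proper_f.
by exists `|x|; split => // M xM y ->; exact: ltW.
Qed.

Lemma image_locally_finite u (V : set R) : bounded_set V ->
  finite_set (V `&` [set x | #|` fset_set (fiber u x)| <> 0%N]).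
Proof.
move=> bV.
apply: (@sub_finite_set _ _ ((f \o fst) @` (labels u `&` fst @^-1` (f @^-1` V)))); last first.
  by apply: finite_image; apply: finite_labels; exact: proper_f.
move=> x [Vx /= /eqP]; rewrite cardfs_eq0 => /fset0Pn[l].
rewrite in_fset_set; last exact: finite_fiber.
by rewrite inE => -[ul flx]; exists l => //; split => //=; rewrite flx.
Qed.

Definition image_configuration u : configuration R :=
  Configuration (@image_locally_finite u).

(** Enumerating each fiber sends the [k]-th copy of [x] in the image to the [k]-th label of [u] that
    [f] moves to [x]. Points that merge under [f] thus keep distinct labels, and sums over distinct
    labels carry over. *)
Lemma image_bij u : exists2 b : R * nat -> R * nat,
  set_bij (labels (image_configuration u)) (labels u) b &
  forall l, labels (image_configuration u) l -> f (b l).1 = l.1.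
Proof.
have h x : {e : nat -> R * nat | set_bij `I_#|` fset_set (fiber u x)| (fiber u x) e}.
  apply: cid; apply/card_set_bijP; rewrite card_eq_sym.
  have /finite_setP[m hm] := finite_fiber u x.
  by rewrite (card_fset_set hm).
pose b (l : R * nat) := projT1 (h l.1) l.2.
have bP l : labels (image_configuration u) l -> fiber u l.1 (b l).
  by case: l => x k kx; rewrite /b/=; case: (h x) => e [+ _ _] /=; apply.
exists b; last by move=> l /bP[].
split.
- by move=> l /bP[].
- move=> [x k] [y m] /[!inE] hx hy bb.
  have xy : x = y by have [_ /= <-] := bP _ hx; have [_ /= <-] := bP _ hy; rewrite bb.
  subst y; congr (_, _); move: bb; rewrite /b/=; case: (h x) => e [_ inj _] /=.
  by apply: inj; rewrite inE.
- move=> l ul.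
  have fl : fiber u (f l.1) l by [].
  have := projT2 (h (f l.1)) => -[_ _ surj]; have [k km ke] := surj _ fl.
  by exists (f l.1, k).
Qed.

Lemma esum_image_configuration u n (a : n.-tuple (measurableTypeR R) -> \bar R) :
  \esum_(j in @distinct_labels R n (image_configuration u)) a (points j) =
  \esum_(j in @distinct_labels R n u) a [tuple of map f (points j)].
Proof.
have [b bb fb] := image_bij u.
have bbn := set_bij_distinct_tuples n bb.
rewrite (reindex_esum _ _ _ _ bbn); apply: eq_esum => j [_ Lj].
congr a; apply: eq_from_tnth => i; rewrite !tnth_map.
by rewrite fb//; exact: Lj.
Qed.

Lemma rsum_image_configuration u n (g : n.-tuple (measurableTypeR R) -> R) :
  rsum (@distinct_labels R n (image_configuration u)) (fun j => g (points j)) =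
  rsum (@distinct_labels R n u) (fun j => g [tuple of map f (points j)]).
Proof.
rewrite /rsum; congr (fine _ - fine _).
  transitivity (\esum_(j in @distinct_labels R n (image_configuration u)) (EFin \o g)^\+%E (points j)).
    by apply: eq_esum => j _; rewrite !funeposE.
  by rewrite esum_image_configuration; apply: eq_esum => j _; rewrite !funeposE.
transitivity (\esum_(j in @distinct_labels R n (image_configuration u)) (EFin \o g)^\-%E (points j)).
  by apply: eq_esum => j _; rewrite !funenegE.
by rewrite esum_image_configuration; apply: eq_esum => j _; rewrite !funenegE.
Qed.

Lemma count_image_configuration u V :
  count_points V (image_configuration u) = count_points (f @^-1` V) u.
Proof.
have [b bb fb] := image_bij u.
rewrite !count_pointsE (reindex_esum _ _ _ _ bb); apply: eq_esum => l ul.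
by rewrite !indicE; congr (_%:R%:E); congr nat_of_bool; apply/idP/idP; rewrite !inE/= fb.
Qed.

Hypothesis measurable_f : measurable_fun [set: measurableTypeR R] (f : _ -> measurableTypeR R).

Lemma image_process d (T : measurableType d) (P : probability T R) (w : point_process P) :
  exists v : point_process P, forall t, v t = image_configuration (w t).
Proof.
have mv : measurable_fun [set: T]
    ((fun t => image_configuration (w t)) : T -> g_sigma_algebraType (@count_events R)).
  have mE : @measurable _ (g_sigma_algebraType (@count_events R)) = <<s @count_events R >> by [].
  apply: (@measurability _ _ T (g_sigma_algebraType (@count_events R)) setT _ _ mE) => _ [_ [V [m [mV bV ->]]] <-].
  rewrite setTI (_ : _ @^-1` _ = [set t | count_points (f @^-1` V) (w t) = m%:R%:E]).
    apply: measurable_count_process; last exact: proper_f.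
    by rewrite -[X in measurable X]setTI; exact: measurable_f.
  by apply/seteqP; split => t /=; rewrite count_image_configuration.
pose mixin := isMeasurableFun.Build _ _ _ _ _ mv.
pose v : point_process P :=
  HB.pack ((fun t => image_configuration (w t)) : T -> g_sigma_algebraType (@count_events R)) mixin.
by exists v.
Qed.

End image_configuration.

Lemma measurable_expe d (T : measurableType d) (R : realType) (f : T -> \bar R) n :
  measurable_fun setT f -> measurable_fun setT (fun t => f t ^+ n)%E.
Proof.
move=> mf; elim: n => [|n IH]; first exact: measurable_cst.
by under eq_fun do rewrite expeS; exact: emeasurable_funM.
Qed.

Lemma lee_expe (R : realType) (x y : \bar R) n : (0 <= x)%E -> (x <= y)%E ->
  (x ^+ n <= y ^+ n)%E.
Proof.
move=> x0 xy; elim: n => [|n IH]; first by rewrite !expe0.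
by rewrite !expeS lee_pmul// expe_ge0.
Qed.

(** Correlations give factorial moments, while [ulm] asks for ordinary ones. Either [m <= 2n], or
    each of the [n] factors of the falling factorial exceeds [m / 2]. *)
Lemma expn_le_ffact (m n : nat) : (m ^ n <= n.*2 ^ n + 2 ^ n * m ^_ n)%N.
Proof.
have sub_ffact k : (k <= n)%N -> ((m - n) ^ k <= m ^_ k)%N.
  elim: k => [|k IH] kn; first by rewrite ffactn0.
  by rewrite ffactnSr expnSr leq_mul ?IH ?leq_sub2l// ltnW.
have le_exp a b : (a <= b -> a ^ n <= b ^ n)%N.
  by case: (n) => // k ab; rewrite leq_exp2r.
have [h|h] := leqP m n.*2; first by rewrite (leq_trans (le_exp _ _ h)) ?leq_addr.
rewrite (leq_trans _ (leq_addl _ _))//.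
apply: leq_trans (_ : (2 * (m - n)) ^ n <= _)%N; first by apply: le_exp; lia.
by rewrite expnMn leq_mul2l sub_ffact ?orbT.
Qed.

(** * Uniform local moments *)

Section moments.
Context {R : realType} d (T : measurableType d) (P : probability T R).
Variables (w : point_process P) (lambda : R).
Hypothesis lambda_gt0 : 0 < lambda.
Hypothesis w_poisson : is_poisson lambda w.

Lemma sum_over_cube_ffact (V : set R) t n m :
  bounded_set V -> count_points V (w t) = m%:R%:E ->
  sum_over w (EFin \o \1_(box (fun _ : 'I_n => V))) t = (m ^_ n)%:R%:E.
Proof.
move=> bV Vm; elim: n => [|n IH].
  by rewrite /sum_over /random_sum distinct_labelsE distinct_tuples0 esum_set1/= indic_box big_ord0.
have h : (sum_over w (EFin \o \1_(box (fun _ : 'I_n.+1 => V))) t +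
    \sum_(i < n) sum_over w (EFin \o \1_(box (fun k => if k == i then V `&` V else V))) t =
    count_points V (w t) * sum_over w (EFin \o \1_(box (fun _ : 'I_n => V))) t)%E.
  exact: (@box_sumS _ _ _ w n (fun=> V) t (fun=> bV)).
move: h; rewrite Vm IH => h.
have h' : (\sum_(i < n) sum_over w (EFin \o \1_(box (fun k => if k == i then V `&` V else V))) t =
    (n * m ^_ n)%:R%:E)%E.
  under eq_bigr => i _.
    rewrite (_ : (fun k => if k == i then V `&` V else V) = fun=> V); last first.
      by apply/funext => k; rewrite setIid; case: ifP.
    rewrite IH; over.
  by rewrite sumEFin sumr_const card_ord mulnC mulrnA.
move: h; rewrite h' -EFinM => /(congr1 (fun x => x - (n * m ^_ n)%:R%:E)%E).
rewrite addeK// => ->; rewrite -EFinB; congr _%:E.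
(* The recursion multiplies by the truncated difference [m - n], which is the real one only if
   [n <= m]; otherwise both falling factorials are 0. *)
have [nm|mn] := leqP n m.
  by rewrite ffactnSr !natrM natrB//; ring.
by rewrite !ffact_small ?muln0 ?mulr0 ?subr0//; exact: ltnW.
Qed.

Lemma poisson_moments n (a b : R) : (0 < n)%N -> a < b ->
  (\int[P]_t (count_points `]a, b[ (w t) ^+ n) <=
   ((n.*2 ^ n)%:R + 2 ^+ n * (lambda * (b - a)) ^+ n)%:E)%E.
Proof.
move=> n0 ab; have bV := @bounded_itv R a b.
have mV : measurable (`]a, b[%classic : set (measurableTypeR R)) by exact: measurable_itv.
have mbox : measurable (box (fun _ : 'I_n => `]a, b[%classic) : set (n.-tuple (measurableTypeR R))).
  exact: measurable_box.
have mS := sum_over_indic_measurable w mbox.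
have S0 t : (0 <= sum_over w (EFin \o \1_(box (fun _ : 'I_n => `]a, b[%classic))) t)%E.
  by apply: random_sum_ge0 => y; rewrite lee_fin.
have mc : measurable_fun setT (fun t => count_points `]a, b[ (w t) : \bar R).
  exact: (measurable_count_points (measurable_count_process w)).
apply: (@le_trans _ _ (\int[P]_t ((n.*2 ^ n)%:R%:E + (2 ^+ n)%:E *
    sum_over w (EFin \o \1_(box (fun _ : 'I_n => `]a, b[%classic))) t))%E).
  apply: ge0_le_integral => //.
  - move=> t _; apply: expe_ge0; apply: esum_ge0 => x _; by rewrite lee_fin.
  - exact: measurable_expe.
  - apply: emeasurable_funD => //; exact: measurable_funeM.
  - move=> t _; have [m tm] := count_points_nat (w t) bV.
    rewrite tm (sum_over_cube_ffact _ bV tm) -EFin_expe -EFinM -EFinD lee_fin.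
    by rewrite -!natrX -natrM -natrD ler_nat expn_le_ffact.
rewrite ge0_integralD//; last 2 first.
- by move=> t _; rewrite mule_ge0 ?lee_fin ?exprn_ge0.
- exact: measurable_funeM.
rewrite ge0_integralZl_EFin ?exprn_ge0//.
rewrite integral_cst// [X in (_ * X + _)%E](_ : _ = 1%E) ?mule1; last exact: probability_setT.
rewrite (sum_over_poisson lambda_gt0 w_poisson n0)//; last first.
- by move=> t; rewrite lee_fin.
- by apply/measurable_EFinP; exact: measurable_indic.
have boxE : lebesgue_tuple R n (box (fun _ : 'I_n => `]a, b[%classic)) = (\prod_(i < n) (b - a))%:E.
  exact: (lebesgue_tuple_box (a := fun=> a) (b := fun=> b)).
have intE : (\int[lebesgue_tuple R n]_t (\1_(box (fun _ : 'I_n => `]a, b[%classic)) t)%:E =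
    (\prod_(i < n) (b - a))%:E)%E by rewrite integral_indic// setIT; exact: boxE.
rewrite [X in (_ * (_ * X))%E]intE.
by rewrite prodr_const card_ord -!EFinM -EFinD exprMn.
Qed.

Lemma image_process_ulm (f : R -> R) (c : R)
    (proper_f : forall V, bounded_set V -> bounded_set (f @^-1` V))
    (v : point_process P) : (forall x, `|f x - x| <= c) ->
  measurable_fun [set: measurableTypeR R] (f : _ -> measurableTypeR R) ->
  (forall t, v t = image_configuration proper_f (w t)) -> ulm v.
Proof.
(* Points of [v] in [[L, L + 1]] come from points of [w] in the open interval from [L - c - 1] to
   [L + c + 2], of length [2 c + 3]. *)
move=> fc mf vE n n0; exists ((n.*2 ^ n)%:R + 2 ^+ n * (lambda * (2 * c + 3)) ^+ n) => L.
have c0 : 0 <= c by exact: le_trans (fc 0).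
have ab : L - c - 1 < L + c + 2 by lra.
have bI : bounded_set `[L, L + 1]%classic.
  by apply: bounded_setS (@bounded_itv _ (L - 1) (L + 2)) => x /=; rewrite !in_itv/=; lra.
have := poisson_moments n0 ab; rewrite (_ : L + c + 2 - (L - c - 1) = 2 * c + 3); last by lra.
apply: le_trans; apply: ge0_le_integral => //.
- by move=> t _; apply: expe_ge0; apply: esum_ge0 => x _; rewrite lee_fin.
- apply: measurable_expe; apply: (measurable_count_points (measurable_count_process v)); [exact: measurable_itv|exact: bI].
- apply: measurable_expe; apply: (measurable_count_points (measurable_count_process w)); [exact: measurable_itv|exact: bounded_itv].
- move=> t _; rewrite vE count_image_configuration !count_pointsE.
  apply: lee_expe; first by apply: esum_ge0 => l _; rewrite lee_fin.
  apply: le_esum => l _; rewrite lee_fin !indicE ler_nat.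
  case: (boolP (l.1 \in f @^-1` _)) => // /set_mem /=; rewrite in_itv/= => h.
  rewrite mem_set//= in_itv/=; have := fc l.1; rewrite ler_norml; lra.
Qed.

End moments.

(** * Rounding to the lattice *)

Section rounding.
Context {R : realType} (a : R).
Hypothesis a_gt0 : 0 < a.
Implicit Types x y : R.

Definition cell_index x : int := Num.floor (x / a + 1 / 2).

Definition round x : R := a * (cell_index x)%:~R.

Lemma cell_index_le x y : x <= y -> (cell_index x <= cell_index y)%O.
Proof. by move=> xy; apply: le_floor; rewrite lerD2r ler_pM2r ?invr_gt0. Qed.

Lemma cell_indexP x : a * ((cell_index x)%:~R - 1 / 2) <= x < a * ((cell_index x)%:~R + 1 / 2).
Proof.
have h1 := floor_le (x / a + 1 / 2); have h2 := floorD1_gt (x / a + 1 / 2).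
have xE : x = a * (x / a) by rewrite mulrC divfK// gt_eqF.
rewrite [X in _ <= X < _]xE ler_pM2l// ltr_pM2l//.
by move: h1 h2; rewrite -/(cell_index x) intrD; lra.
Qed.

Lemma round_dist x : `|x - round x| <= a / 2.
Proof.
have := cell_indexP x; rewrite /round mulrBr mulrDr => /andP[h1 h2].
by rewrite ler_norml; lra.
Qed.

Lemma cell_index_mul (k : int) : cell_index (a * k%:~R) = k.
Proof.
rewrite /cell_index mulrAC divff ?gt_eqF// mul1r; apply: floor_def.
by rewrite intrD; lra.
Qed.

Lemma roundK x : round (round x) = round x.
Proof. by rewrite /round cell_index_mul. Qed.

Lemma round_le x y : x <= y -> round x <= round y.
Proof. by move=> xy; rewrite ler_pM2l// ler_int cell_index_le. Qed.

Lemma measurable_round : measurable_fun [set: measurableTypeR R] (round : _ -> measurableTypeR R).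
Proof. by apply: nondecreasing_measurable => // x y; exact: round_le. Qed.

Lemma round_proper (V : set R) : bounded_set V -> bounded_set (round @^-1` V).
Proof.
move=> [M [Mr hM]]; exists (M + 1 + a / 2); split; first by rewrite num_real.
move=> N MN x Vx; have := hM (M + 1) _ _ Vx; rewrite ltrDl ltr01 => /(_ isT) h.
have := round_dist x; rewrite -[X in _ <= X -> _]/(a / 2) => h2.
have : `|x| <= `|x - round x| + `|round x| by rewrite -[X in `|X| <= _](subrK (round x)) ler_normD.
by move: h => /=; lra.
Qed.

Lemma measurable_cell k : measurable ([set x | cell_index x = k] : set (measurableTypeR R)).
Proof.
rewrite (_ : [set x | _] = round @^-1` [set a * k%:~R]).
  rewrite -[X in measurable X]setTI; apply: (measurable_round measurableT).
  exact: measurable_set1.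
apply/seteqP; split => x /=; rewrite /round; first by move=> ->.
by move=> /(mulfI (lt0r_neq0 a_gt0)) /intr_inj.
Qed.

Definition round_tuple n (t : n.-tuple R) : n.-tuple R := [tuple of map round t].

(** The rounding takes countably many values, so every preimage is a countable union of products of
    cells, whatever [F] is. *)
Lemma measurable_comp_round n (F : n.-tuple R -> R) : measurable_fun setT
  (fun t : n.-tuple (measurableTypeR R) => F (round_tuple t) : measurableTypeR R).
Proof.
move=> _ Y mY; rewrite setTI.
pose G (z : n.-tuple int) := F [tuple of map (fun k => a * k%:~R) z].
pose B (z : n.-tuple int) : set (n.-tuple (measurableTypeR R)) :=
  if `[< Y (G z) >] then box (fun i => [set x | cell_index x = tnth z i]) else set0.
have -> : (fun t : n.-tuple (measurableTypeR R) => F (round_tuple t)) @^-1` Y = \bigcup_z B z.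
  apply/seteqP; split => [t /= Yt|t [z _]].
    have tE : G [tuple of map cell_index t] = F (round_tuple t).
      by congr F; apply: eq_from_tnth => i; rewrite !tnth_map.
    exists [tuple of map cell_index t] => //; rewrite /B tE asboolT// => i /=.
    by rewrite tnth_map.
  rewrite /B; case: asboolP => // Yz tz /=.
  suff -> : round_tuple t = [tuple of map (fun k => a * k%:~R) z] by [].
  by apply: eq_from_tnth => i; rewrite !tnth_map /round; have /= -> := tz i.
apply: countable_bigcupT_measurable; first exact: countableP.
move=> z; rewrite /B; case: asboolP => // _.
by apply: measurable_box => i; exact: measurable_cell.
Qed.

End rounding.

(** The function is the limit of its compositions with roundings to finer and finer lattices, each
    measurable by countability. No comparison between the topology of row vectors and the product
    sigma-algebra of tuples is involved. *)
Lemma measurable_continuous_row (R : realType) n (f : 'rV[R]_n -> R) : continuous f ->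
  measurable_fun setT (fun t : n.-tuple (measurableTypeR R) => f (row_of_tuple t) : measurableTypeR R).
Proof.
move=> cf.
pose h k := (k.+1%:R : R)^-1.
have h0 k : 0 < h k by rewrite invr_gt0.
apply: (measurable_fun_cvg (h := fun k t => f (row_of_tuple (round_tuple (h k) t)))).
  by move=> k; exact: (measurable_comp_round (h0 k) (fun t => f (row_of_tuple t))).
move=> t _.
have : (fun k => row_of_tuple (round_tuple (h k) t)) @ \oo --> row_of_tuple t.
  apply/cvgrPdist_le => e e0; near=> k.
  rewrite /Num.norm/= mx_normrE; apply: (bigmax_le _ (ltW e0)) => -[i j] _.
  rewrite !mxE tnth_map; apply: le_trans (round_dist (h0 k) _) _.
  have : h k <= e by apply: ltW; near: k; exact: (near_infty_natSinv_lt (PosNum e0)).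
  by have := h0 k; lra.
by move=> /(cvg_comp _ _); apply; exact: cf.
Unshelve. all: by end_near. Qed.

(** * An integrable weight and its rounded version *)

Section decay_weight.
Context {R : realType}.
Implicit Types x y : R.
Local Notation mu := (@lebesgue_measure R).

Definition rho x : R := (oneDsqr x)^-1.

Lemma oneDsqr_gt0 x : 0 < oneDsqr x.
Proof. exact: lt_le_trans (oneDsqr_ge1 x). Qed.

Lemma rho_gt0 x : 0 < rho x.
Proof. by rewrite invr_gt0 oneDsqr_gt0. Qed.

Lemma rho_ge0 x : 0 <= rho x. Proof. exact: ltW (rho_gt0 x). Qed.

Lemma rho_le1 x : rho x <= 1. Proof. exact: oneDsqrV_le1. Qed.

Lemma measurable_rho : measurable_fun [set: measurableTypeR R] (rho : _ -> measurableTypeR R).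
Proof. by apply: continuous_measurable_fun; exact: continuous_oneDsqrV. Qed.

Lemma integral_rho_lty : (\int[mu]_x (rho x)%:E < +oo)%E.
Proof.
rewrite ge0_symfun_integralT//=.
- rewrite (_ : [set x | (0 <= x)%R] = `[0, +oo[%classic); last first.
    by apply/seteqP; split => x/=; rewrite in_itv/= andbT.
  by rewrite integral0y_oneDsqr -EFinM ltry.
- by move=> x; exact: rho_ge0.
- exact: continuous_oneDsqrV.
- by move=> x /=; rewrite /rho /oneDsqr sqrrN.
Qed.

Lemma rho_comparable (c : R) x y : `|x - y| <= c -> rho x <= (2 + 2 * c ^+ 2) * rho y.
Proof.
move=> xyc; rewrite /rho ler_pdivlMr ?oneDsqr_gt0// mulrC ler_pdivrMr ?oneDsqr_gt0//.
have h : (x - y) ^+ 2 <= c ^+ 2 by rewrite -real_normK ?num_real// ler_sqr ?nnegrE ?(le_trans _ xyc).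
rewrite /oneDsqr.
have : y ^+ 2 <= 2 * x ^+ 2 + 2 * (x - y) ^+ 2.
  rewrite -subr_ge0 (_ : _ - _ = (2 * x - y) ^+ 2); last by ring.
  exact: sqr_ge0.
have := sqr_ge0 x; have := sqr_ge0 c.
nra.
Qed.

Variable a : R.
Hypothesis a_gt0 : 0 < a.
Local Notation rnd := (round a).

(** Constant on cells, hence with the same integral with and without the kernel. *)
Definition rhor x : R := rho (rnd x).

Lemma rhor_ge0 x : 0 <= rhor x. Proof. exact: rho_ge0. Qed.

Lemma rhor_round x : rhor (rnd x) = rhor x.
Proof. by rewrite /rhor roundK. Qed.

Lemma measurable_rhor : measurable_fun [set: measurableTypeR R] (rhor : _ -> measurableTypeR R).
Proof. exact: (measurableT_comp measurable_rho (measurable_round a_gt0)). Qed.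

(** The factor of [rho_comparable] at distance [a / 2], the largest distance to the lattice. *)
Definition kappa : R := 2 + 2 * (a / 2) ^+ 2.

Lemma kappa_ge0 : 0 <= kappa.
Proof. by rewrite addr_ge0// mulr_ge0// sqr_ge0. Qed.

Lemma rho_le_rhor x y : rnd x <= y <= x \/ x <= y <= rnd x -> rho y <= kappa * rhor x.
Proof.
move=> h; apply: rho_comparable; apply: le_trans (round_dist a_gt0 x).
case: h => /andP[h1 h2].
  by rewrite ger0_norm ?subr_ge0//; apply: le_trans (ler_norm _); rewrite lerD2r.
rewrite ler0_norm ?subr_le0// distrC; apply: le_trans (ler_norm _).
by rewrite opprB lerD2l lerN2.
Qed.

Lemma integral_rhor_lty : (\int[mu]_x (rhor x)%:E < +oo)%E.
Proof.
apply: (@le_lt_trans _ _ (\int[mu]_x (kappa%:E * (rho x)%:E))%E).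
  apply: ge0_le_integral => //.
  - by move=> x _; rewrite lee_fin rhor_ge0.
  - by apply/measurable_EFinP; exact: measurable_rhor.
  - apply: measurable_funeM; apply/measurable_EFinP; exact: measurable_rho.
  - move=> x _; rewrite -EFinM lee_fin; apply: rho_comparable.
    by rewrite distrC round_dist.
rewrite ge0_integralZl_EFin// ?kappa_ge0//.
- by rewrite lte_mul_pinfty ?lee_fin ?kappa_ge0// integral_rho_lty.
- by move=> x _; rewrite lee_fin rho_ge0.
- by apply/measurable_EFinP; exact: measurable_rho.
Qed.

End decay_weight.

(** * The concentrating kernel *)

Section expi.
Context {R : realType}.
Implicit Types x y : R.

Lemma expi0 : expi 0 = 1 :> R[i].
Proof. by rewrite /expi cos0 sin0. Qed.

Lemma expiD x y : expi (x + y) = expi x * expi y.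
Proof. by rewrite /expi cosD sinD; apply/eqP; rewrite eq_complex /= eqxx/= addrC [_ * cos y]mulrC. Qed.

Lemma expi_natmul n x : expi (n%:R * x) = expi x ^+ n.
Proof.
elim: n => [|n IH]; first by rewrite mul0r expi0.
by rewrite exprS -IH -expiD -[in LHS]natr1 mulrDl mul1r addrC.
Qed.

Lemma expi_sum (I : Type) (r : seq I) (F : I -> R) :
  expi (\sum_(i <- r) F i) = \prod_(i <- r) expi (F i).
Proof. by elim/big_rec2: _ => [|i y z _ <-]; rewrite ?expi0// expiD. Qed.

Lemma expi2pi : expi (2 * pi) = 1 :> R[i].
Proof. by rewrite /expi mulr_natl cos2pi sin2pi. Qed.

Lemma expi_period (m k : nat) x : expi (x + (m%:R - k%:R) * (2 * pi)) = expi x.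
Proof.
have h n : expi (n%:R * (2 * pi)) = 1 :> R[i] by rewrite expi_natmul expi2pi expr1n.
have : expi (x + (m%:R - k%:R) * (2 * pi)) * expi (k%:R * (2 * pi)) = expi x * expi (m%:R * (2 * pi)).
  by rewrite -!expiD; congr expi; ring.
by rewrite !h !mulr1.
Qed.

Lemma sin_period (m k : nat) x : sin (x + (m%:R - k%:R) * (2 * pi)) = sin x.
Proof. by have [] := expi_period m k x. Qed.

End expi.

Lemma FTC_derive (R : realType) (f F : R -> R) (a b : R) : a < b ->
  (forall x : R, is_derive x 1 F (f x)) -> continuous f ->
  (\int[lebesgue_measure]_(x in `[a, b]) (f x)%:E = (F b - F a)%:E)%E.
Proof.
move=> ab dF cf.
have cF x : {for x, continuous F}.
  by apply: differentiable_continuous; apply/derivable1_diffP; exact: ex_derive.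
rewrite (@continuous_FTC2 _ f F _ _ ab) ?EFinB//.
- exact: continuous_subspaceT.
- split.
  + by move=> x _; exact: ex_derive.
  + by apply: cvg_at_right_filter; exact: cF.
  + by apply: cvg_at_left_filter; exact: cF.
- by move=> x _; rewrite derive1E; exact: derive_val.
Qed.

Section kernel.
Context {R : realType} (a : R).
Hypothesis a_gt0 : 0 < a.
Implicit Types (x : R) (N j : nat).
Local Notation mu := (@lebesgue_measure R).

Definition kern N x : R := 4 ^+ N / 'C(N.*2, N)%:R * cos (pi * x / a) ^+ N.*2.

(** The coefficient of frequency [(N - j) / a] in the kernel, from the binomial expansion of
    [(e^(iy) + e^(-iy))^(2N)], scaled so that the constant term [j = N] is 1. *)
Definition kcoef N j : R := 'C(N.*2, j)%:R / 'C(N.*2, N)%:R.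

Lemma bin_mid_gt0 N : 0 < 'C(N.*2, N)%:R :> R.
Proof. by rewrite ltr0n bin_gt0 -addnn leq_addr. Qed.

Lemma kcoef_mid N : kcoef N N = 1.
Proof. by rewrite /kcoef divff// gt_eqF// bin_mid_gt0. Qed.

Lemma kern_ge0 N x : 0 <= kern N x.
Proof.
apply: mulr_ge0; first by rewrite divr_ge0// exprn_ge0.
by rewrite -mul2n exprM exprn_ge0// sqr_ge0.
Qed.

Lemma kern_expi N x : (kern N x)%:C%C =
  \sum_(j < N.*2.+1) (kcoef N j)%:C%C * expi ((N%:R - j%:R) * (2 * pi / a * x)).
Proof.
have cosE : (2 * cos (pi * x / a))%:C%C = expi (pi * x / a) + expi (- (pi * x / a)).
  by apply/eqP; rewrite eq_complex /= cosN sinN subrr eqxx andbT mulr_natl mulr2n.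
have -> : kern N x = 'C(N.*2, N)%:R^-1 * (2 * cos (pi * x / a)) ^+ N.*2.
  rewrite /kern exprMn (_ : 2 ^+ N.*2 = 4 ^+ N) ?mulrA ?[_^-1 * _]mulrC//.
  by rewrite -mul2n exprM -natrX.
rewrite rmorphM rmorphXn/= cosE exprDn big_distrr/=; apply: eq_bigr => j _.
have -> : expi (pi * x / a) ^+ (N.*2 - j) * expi (- (pi * x / a)) ^+ j =
    expi ((N%:R - j%:R) * (2 * pi / a * x)) :> R[i].
  rewrite -!expi_natmul -expiD; congr expi.
  rewrite natrB; last by rewrite -ltnS.
  have -> : N.*2%:R = 2 * N%:R :> R by rewrite -mul2n natrM.
  by field; exact: lt0r_neq0.
by rewrite /kcoef rmorphM/= rmorph_nat mulrnAr -[LHS]mulr_natl mulrA.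
Qed.

Lemma kern_cos N x : kern N x =
  \sum_(j < N.*2.+1) kcoef N j * cos ((N%:R - j%:R) * (2 * pi / a * x)).
Proof.
have /(congr1 (@complex.Re R)) := kern_expi N x; rewrite /= raddf_sum/= => ->.
by apply: eq_bigr => j _; rewrite mul0r subr0.
Qed.

Lemma continuous_kern N : continuous (kern N).
Proof.
move=> x; apply: cvgM; first exact: cvg_cst.
have cc : {for x, continuous (fun x => cos (pi * x / a))}.
  apply: (@continuous_comp _ _ _ (fun x => pi * x / a)); last exact: continuous_cos.
  by apply: cvgM; [apply: cvgM; [exact: cvg_cst|exact: cvg_id]|exact: cvg_cst].
apply: (@continuous_comp _ _ _ (fun x => cos (pi * x / a)) (fun y => y ^+ _)) => //.
exact: exprn_continuous.
Qed.

(** With [sin^2 = 1 - cos^2], the factor [cos^2] raises the order of the kernel by one, and the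
    ratio of the two normalizing constants is [C(2N+2, N+1) / (4 C(2N, N)) = (2N+1) / (2N+2)]. This
    identity gives the rate of concentration. *)
Lemma sin2_kern N x : sin (pi * x / a) ^+ 2 * kern N x =
  kern N x - (N.*2.+1)%:R / (N.*2.+2)%:R * kern N.+1 x.
Proof.
rewrite sin2cos2 mulrBl mul1r; congr (_ - _); rewrite /kern.
have h0 := bin_mid_gt0 N; have h1 := bin_mid_gt0 N.+1.
have E : 2 * (N.*2.+1)%:R * 'C(N.*2, N)%:R = (N.+1)%:R * 'C(N.+1.*2, N.+1)%:R :> R.
  rewrite -!natrM; congr _%:R.
  have e1 := mul_bin_diag N.*2.+2 N; have e2 := mul_bin_down N.*2.+1 N.
  by rewrite doubleS; move: e1 e2 => /=; lia.
have E2 : 'C(N.+1.*2, N.+1)%:R = 2 * (N.*2.+1)%:R * 'C(N.*2, N)%:R / N.+1%:R :> R.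
  by rewrite E mulrAC divff ?mul1r.
rewrite E2 doubleS !exprS (_ : N.*2.+2%:R = 2 * N.+1%:R); last first.
  by rewrite -natrM mul2n doubleS.
by field; rewrite (gt_eqF h0) !nat1r !pnatr_eq0.
Qed.

End kernel.

Section kernel_integrals.
Context {R : realType} (a : R).
Hypothesis a_gt0 : 0 < a.
Implicit Types (x : R) (N : nat).
Local Notation mu := (@lebesgue_measure R).
Local Notation rnd := (round a).

Lemma continuous_cosM (c : R) : continuous (fun x => cos (c * x)).
Proof.
move=> x; apply: (@continuous_comp _ _ _ (fun x => c * x)); last exact: continuous_cos.
by apply: cvgM; [exact: cvg_cst|exact: cvg_id].
Qed.

Lemma continuous_cosMM (c e : R) : continuous (fun x => cos (c * (e * x))).
Proof.
rewrite (_ : (fun x => _) = (fun x => cos (c * e * x))); first exact: continuous_cosM.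
by apply/funext => x; rewrite mulrA.
Qed.

Lemma is_derive_sinM (c x : R) : is_derive x 1 (fun y => sin (c * y)) (c * cos (c * x)).
Proof.
have dc : is_derive x (1 : R) (fun y : R => c * y) c.
  have := is_deriveZ c (@is_derive_id R R x 1).
  by rewrite /GRing.scale/= mulr1.
rewrite mulrC; exact: (@is_derive1_comp R (@sin R) (fun y => c * y)).
Qed.

Lemma integral_cos_period (u : R) (m k : nat) : m <> k ->
  (\int[mu]_(x in `[u, (u + a)%R]) (cos ((m%:R - k%:R) * (2 * pi / a * x)))%:E = 0)%E.
Proof.
move=> mk; pose c : R := (m%:R - k%:R) * (2 * pi / a).
have c0 : c != 0.
  rewrite mulf_neq0//; last by rewrite !mulf_neq0// ?invr_eq0 gt_eqF// pi_gt0.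
  by rewrite subr_eq0 eqr_nat; apply/eqP.
have uua : u < u + a by rewrite ltrDl.
under eq_integral do rewrite mulrA -/c.
have dF (x : R) : is_derive x (1 : R) (fun x => c^-1 * sin (c * x)) (cos (c * x)).
  have := is_deriveZ c^-1 (is_derive_sinM c x).
  by rewrite /GRing.scale/= mulrA mulVf// mul1r.
rewrite (FTC_derive uua dF); last exact: continuous_cosM.
rewrite (_ : c * (u + a) = c * u + (m%:R - k%:R) * (2 * pi)).
  by rewrite sin_period subrr.
by rewrite /c; field; exact: lt0r_neq0.
Qed.

Lemma integral_kern_period (u : R) N :
  (\int[mu]_(x in `[u, (u + a)%R[) (kern a N x)%:E = a%:E)%E.
Proof.
have mkern (A : set R) : measurable_fun A (kern a N).
  apply: measurable_funTS; apply: continuous_measurable_fun; exact: continuous_kern.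
rewrite integral_itv_bndo_bndc; last exact/measurable_EFinP.
under eq_integral do rewrite kern_cos// -sumEFin.
rewrite integral_sum//; last first.
  move=> j; apply: continuous_compact_integrable; first exact: segment_compact.
  apply: continuous_subspaceT => x; apply: cvgM; first exact: cvg_cst.
  exact: continuous_cosMM.
have mid : (N < N.*2.+1)%N by rewrite ltnS -addnn leq_addr.
have uua : u <= u + a by rewrite lerDl ltW.
have term (j : 'I_N.*2.+1) : (\int[mu]_(x in `[u, (u + a)%R])
    (kcoef N j * cos ((N%:R - j%:R) * (2 * pi / a * x)))%:E =
    (kcoef N j)%:E * \int[mu]_(x in `[u, (u + a)%R]) (cos ((N%:R - j%:R) * (2 * pi / a * x)))%:E)%E.
  rewrite -integralZl//; apply: continuous_compact_integrable; first exact: segment_compact.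
  by apply: continuous_subspaceT; exact: continuous_cosMM.
rewrite (bigD1 (Ordinal mid))//= big1 ?adde0; last first.
  move=> j jN; rewrite term integral_cos_period ?mule0// => Nj.
  by move/eqP : jN; apply; apply: val_inj.
rewrite (term (Ordinal mid)) kcoef_mid mul1e.
under eq_integral do rewrite subrr mul0r cos0.
rewrite integral_cst// mul1e.
apply: (etrans (lebesgue_measure_itv `[u, (u + a)%R])).
by rewrite /= lte_fin ltrDl a_gt0 -EFinD addrAC subrr add0r.
Qed.

Definition cell (k : int) : set R := [set x | cell_index a x = k].

Lemma cellE k : cell k = `[a * (k%:~R - 1 / 2), (a * (k%:~R - 1 / 2) + a)%R[%classic.
Proof.
apply/seteqP; split => x /=; rewrite in_itv/=.
  by move=> <-; have := cell_indexP a_gt0 x; rewrite !mulrDr; lra.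
move=> h; rewrite /cell_index; apply: floor_def.
have xE : x = a * (x / a) by rewrite mulrC divfK// gt_eqF.
move: h; rewrite {1 2}xE -[X in _ * _ + X](mulr1 a) -mulrDr ler_pM2l// ltr_pM2l// intrD.
by lra.
Qed.

Lemma measurable_comp_round1 (d : measure_display) (Y : measurableType d) (q : R -> Y) :
  measurable_fun [set: measurableTypeR R] (fun x => q (rnd x) : Y).
Proof.
move=> _ B mB; rewrite setTI.
have -> : (fun x => q (rnd x)) @^-1` B =
    \bigcup_(k : int) (if `[< B (q (a * k%:~R)) >] then cell k else set0).
  apply/seteqP; split => [x /= Bx|x [k _]].
    by exists (cell_index a x) => //; rewrite asboolT.
  by case: asboolP => // Bk /= xk; rewrite /round xk.
apply: countable_bigcupT_measurable; first exact: countableP.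
by move=> k; case: ifP => // _; exact: (measurable_cell a_gt0).
Qed.

Lemma integral_comp_round_kern (q : R -> \bar R) N : (forall x, 0 <= q x)%E ->
  (\int[mu]_x (q (rnd x) * (kern a N x)%:E) = \int[mu]_x q (rnd x))%E.
Proof.
move=> q0.
(* The cells are indexed by naturals through the coding of the integers; a natural that codes no
   integer gets the empty set. *)
pose Fn (n : nat) : set (measurableTypeR R) := if pickle_inv n is Some k then cell k else set0.
have mFn n : measurable (Fn n).
  by rewrite /Fn; case: pickle_inv => // k; exact: (measurable_cell a_gt0).
have tFn : trivIset setT Fn.
  apply/trivIsetP => i j _ _ ij; rewrite /Fn.
  case Ei : (pickle_inv i) => [k|]; last by rewrite set0I.
  case Ej : (pickle_inv j) => [l|]; last by rewrite setI0.
  apply/seteqP; split => // x [/= xk xl]; move/eqP : ij; apply.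
  have := @pickle_invK int i; have := @pickle_invK int j; rewrite Ei Ej /= => <- <-.
  by rewrite -xk -xl.
have UFn : \bigcup_n Fn n = setT.
  rewrite -subTset => x _; exists (choice.pickle (cell_index a x)); first exact: I.
  by rewrite /Fn pickleK_inv.
have mq := @measurable_comp_round1 _ _ q.
have mk : measurable_fun setT (fun x : measurableTypeR R => (kern a N x)%:E).
  by apply/measurable_EFinP; apply: continuous_measurable_fun; exact: continuous_kern.
have mqk : measurable_fun setT (fun x : measurableTypeR R => q (rnd x) * (kern a N x)%:E)%E.
  exact: emeasurable_funM.
rewrite -UFn !ge0_integral_bigcup//; last 3 first.
- exact: measurable_funTS.
- exact: measurable_funTS.
- by move=> x _; rewrite mule_ge0// lee_fin kern_ge0.
congr (limn _); apply/funext => m; apply: eq_bigr => i _.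
rewrite /Fn; case: (pickle_inv i) => [k|]; last by rewrite !integral_set0.
have qE x : x \in cell k -> q (rnd x) = q (a * k%:~R) by rewrite inE /round => ->.
have mck : measurable (cell k : set (measurableTypeR R)) by exact: (measurable_cell a_gt0).
transitivity (\int[mu]_(x in cell k) (q (a * k%:~R)%R * (kern a N x)%:E))%E.
  by apply: eq_integral => x xk; rewrite qE.
transitivity (\int[mu]_(x in cell k) (cst (q (a * k%:~R)%R) x))%E; last first.
  by apply: eq_integral => x xk; rewrite qE.
rewrite ge0_integralZl//; last 2 first.
- exact: measurable_funTS.
- by move=> x _; rewrite lee_fin kern_ge0.
rewrite integral_cst// cellE integral_kern_period.
congr (_ * _)%E; apply/esym/(etrans (lebesgue_measure_itv _)).
by rewrite /= lte_fin ltrDl a_gt0 -EFinD addrAC subrr add0r.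
Qed.

Lemma round_tuple_tcons n x (t : n.-tuple (measurableTypeR R)) :
  round_tuple a (tcons (x : measurableTypeR R, t)) = tcons (rnd x : measurableTypeR R, round_tuple a t).
Proof. exact: val_inj. Qed.

Lemma integral_round_tuple_kern n N (F : n.-tuple (measurableTypeR R) -> R) :
  (forall t, 0 <= F t) ->
  (\int[lebesgue_tuple R n]_t (F (round_tuple a t) * \prod_(i < n) kern a N (tnth t i))%:E =
   \int[lebesgue_tuple R n]_t (F (round_tuple a t))%:E)%E.
Proof.
have mkern : measurable_fun [set: measurableTypeR R] (kern a N : _ -> measurableTypeR R).
  by apply: continuous_measurable_fun; exact: continuous_kern.
elim: n F => [|n IH] F F0.
  by apply: eq_integral => t _; rewrite big_ord0 mulr1.
have mF m (F' : m.-tuple (measurableTypeR R) -> R) :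
    measurable_fun setT (fun t : m.-tuple (measurableTypeR R) => (F' (round_tuple a t))%:E).
  by apply/measurable_EFinP; exact: (measurable_comp_round a_gt0).
have mFK m (F' : m.-tuple (measurableTypeR R) -> R) :
    measurable_fun setT (fun t : m.-tuple (measurableTypeR R) =>
      (F' (round_tuple a t) * \prod_(i < m) kern a N (tnth t i))%:E).
  apply/measurable_EFinP; apply: measurable_funM; first exact: (measurable_comp_round a_gt0).
  exact: (measurable_prod_tnth (f := fun=> kern a N)).
have K0 m (t : m.-tuple R) : 0 <= \prod_(i < m) kern a N (tnth t i).
  by apply: prodr_ge0 => i _; exact: kern_ge0.
rewrite !ge0_integral_lebesgue_tupleS//; last 2 first.
- by move=> t; rewrite lee_fin.
- by move=> t; rewrite lee_fin mulr_ge0.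
(* Once the tail is integrated by induction, what remains is a function of the rounded head against
   one kernel, which is the one-dimensional case. *)
pose Q x := (\int[lebesgue_tuple R n]_t (F (tcons (x : measurableTypeR R, round_tuple a t)))%:E)%E.
transitivity (\int[mu]_x (Q (rnd x) * (kern a N x)%:E))%E.
  apply: eq_integral => x _; rewrite muleC /Q.
  rewrite -(IH (fun t => F (tcons (rnd x : measurableTypeR R, t))))// -ge0_integralZl//; last 3 first.
  - exact: (mFK n (fun t => F (tcons (rnd x : measurableTypeR R, t)))).
  - by move=> t _; rewrite lee_fin mulr_ge0.
  - by rewrite lee_fin kern_ge0.
  apply: eq_integral => t _; rewrite round_tuple_tcons -EFinM big_ord_recl mulrCA; congr (_ * (_ * _))%:E.
  by apply: eq_bigr => i _; rewrite tnthS.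
rewrite integral_comp_round_kern; last first.
  by move=> x; apply: integral_ge0 => t _; rewrite lee_fin.
by apply: eq_integral => x _; apply: eq_integral => t _; rewrite round_tuple_tcons.
Qed.

End kernel_integrals.

(** * Pointwise effect of rounding on a Schwartz function *)

Section schwartz_bounds.
Context {R : realType} (n : nat).
Implicit Types (x y : 'rV[R]_n) (i j : 'I_n).

Lemma coord_le_norm x i : `|x 0 i| <= `|x|.
Proof. by rewrite [leRHS]mx_normrE; apply: (le_bigmax _ _ (0, i)). Qed.

Lemma prod_cst (c : R) : \prod_(i < n) c = c ^+ n.
Proof. by rewrite prodr_const card_ord. Qed.

(** The product of the [1 + x_i^2] is at most [2^n (1 + |x|^(2n))], so the decay estimates of orders
    0 and [2n] suffice. *)
Lemma decay_bound (g : 'rV[R]_n -> R) :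
  (forall k : nat, exists C, forall x, `|x| ^+ k * `|g x| <= C) ->
  exists2 C, 0 <= C & forall x, `|g x| <= C * \prod_i rho (x 0 i).
Proof.
move=> hg; have [C0 h0] := hg 0%N; have [C1 h1] := hg n.*2.
have C00 : 0 <= C0 by apply: le_trans (h0 0); rewrite mulr_ge0.
have C10 : 0 <= C1 by apply: le_trans (h1 0); rewrite mulr_ge0.
exists (2 ^+ n * (C0 + C1)); first by rewrite mulr_ge0// ?exprn_ge0// addr_ge0.
move=> x.
have prodE : \prod_i rho (x 0 i) = (\prod_i oneDsqr (x 0 i))^-1 by rewrite prodfV.
have p0 : 0 < \prod_i oneDsqr (x 0 i) by apply: prodr_gt0 => i _; exact: oneDsqr_gt0.
rewrite prodE ler_pdivlMr//.
have hp : \prod_i oneDsqr (x 0 i) <= 2 ^+ n * (1 + `|x| ^+ n.*2).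
  apply: (@le_trans _ _ ((1 + `|x| ^+ 2) ^+ n)).
    rewrite -prod_cst; apply: ler_prod => i _.
    rewrite ltW ?oneDsqr_gt0//= /oneDsqr lerD2l -[x 0 i ^+ 2]real_normK ?num_real//.
    by rewrite ler_sqr ?nnegrE// coord_le_norm.
  have [m1|/ltW m1] := leP `|x| 1.
    apply: (@le_trans _ _ (2 ^+ n)).
      by rewrite lerXn2r ?nnegrE ?addr_ge0 ?sqr_ge0//; have := exprn_ile1 2 (normr_ge0 x) m1; lra.
    by rewrite ler_peMr ?exprn_ge0// lerDl exprn_ge0.
  apply: (@le_trans _ _ ((2 * `|x| ^+ 2) ^+ n)).
    rewrite lerXn2r ?nnegrE ?mulr_ge0 ?addr_ge0 ?sqr_ge0//.
    by have := exprn_ege1 2 m1; lra.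
  by rewrite exprMn -exprM mul2n ler_wpM2l ?exprn_ge0// lerDr.
apply: le_trans (ler_wpM2l (normr_ge0 _) hp) _.
rewrite mulrCA ler_wpM2l ?exprn_ge0// mulrDr mulr1.
by have := h0 x; have := h1 x; rewrite expr0 mul1r mulrC; lra.
Qed.

Variable a : R.
Hypothesis a_gt0 : 0 < a.
Local Notation rnd := (round a).
Local Notation rhor := (rhor a).

Lemma MVT_between (g dg : R -> R) (u v : R) :
  (forall s : R, is_derive s 1 g (dg s)) ->
  exists2 s, u <= s <= v \/ v <= s <= u & `|g v - g u| = `|dg s| * `|v - u|.
Proof.
move=> dg'.
have cg s : {for s, continuous g}.
  by apply: differentiable_continuous; apply/derivable1_diffP; exact: ex_derive.
have main (p q : R) : p <= q -> exists2 s, p <= s <= q & g q - g p = dg s * (q - p).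
  move=> pq; have [s spq sE] := @MVT_segment R g dg p q pq (fun s _ => dg' s)
    (continuous_subspaceT cg).
  by exists s => //; move: spq; rewrite in_itv.
have [uv|/ltW vu] := leP u v.
  by have [s h E] := main u v uv; exists s; [left|rewrite E normrM].
have [s h E] := main v u vu; exists s; first by right.
by rewrite distrC E normrM [X in _ * X]distrC.
Qed.

Lemma is_derive_line (f : 'rV[R]_n -> R) x i (s : R) :
  (forall y, derivable f y (delta_mx 0 i)) ->
  is_derive s (1 : R) (fun s : R => f (x + s *: delta_mx 0 i))
    ('D_(delta_mx 0 i) f (x + s *: delta_mx 0 i)).
Proof.
move=> df; have dfs := df (x + s *: delta_mx 0 i).
have E : (fun h : R => h^-1 *: (((fun s : R => f (x + s *: delta_mx 0 i)) \o shift s) (h *: (1 : R)) -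
      f (x + s *: delta_mx 0 i))) =
    (fun h : R => h^-1 *: ((f \o shift (x + s *: delta_mx 0 i)) (h *: delta_mx 0 i) -
      f (x + s *: delta_mx 0 i))).
  apply/funext => h /=; congr (_ *: (f _ - _)).
  by rewrite [h *: 1]mulr1 scalerDl addrCA.
apply: DeriveDef; first by rewrite /derivable E.
by rewrite /derive E.
Qed.

(** Mean value theorem along axis [i]. The intermediate point lies between [x] and its rounding in
    that coordinate, so each factor [rho] there is at most [kappa a] times [rhor] at [x]. *)
Lemma round_coord_diff (f : 'rV[R]_n -> R) i (C : R) : 0 <= C ->
  (forall y, derivable f y (delta_mx 0 i)) ->
  (forall x, `|'D_(delta_mx 0 i) f x| <= C * \prod_j rho (x 0 j)) ->
  forall x, `|f (x + (rnd (x 0 i) - x 0 i) *: delta_mx 0 i) - f x| <=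
    C * kappa a ^+ n * `|x 0 i - rnd (x 0 i)| * \prod_j rhor (x 0 j).
Proof.
move=> C0 df Df x; set e := delta_mx 0 i.
have [s hs] := MVT_between 0 (rnd (x 0 i) - x 0 i) (fun s => is_derive_line x s df).
rewrite scale0r addr0 subr0 => ->; rewrite [X in _ * X]distrC.
rewrite [X in _ <= X](_ : _ = C * (kappa a ^+ n * \prod_j rhor (x 0 j)) * `|x 0 i - rnd (x 0 i)|); last by ring.
rewrite ler_wpM2r//; apply: le_trans (Df _) _; rewrite ler_wpM2l//.
rewrite -prod_cst -big_split/=; apply: ler_prod => j _.
rewrite rho_ge0/=; apply: rho_le_rhor => //.
rewrite !mxE eqxx /=; have [->|ij] := eqVneq j i.
  rewrite mulr1; case: hs => /andP[h1 h2]; [right|left]; apply/andP; split; lra.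
by rewrite mulr0 addr0 !lexx !andbT/=; have [h|/ltW h] := leP (rnd (x 0 j)) (x 0 j); [left|right].
Qed.

Definition mix k (t : n.-tuple R) : n.-tuple R :=
  [tuple if (i < k)%N then rnd (tnth t i) else tnth t i | i < n].

(** The coordinates are rounded one at a time along [mix]. The weight is the same at every stage,
    because [rhor] does not change when its argument is rounded. *)
Lemma round_tuple_diff (f : 'rV[R]_n -> R) (C : R) : 0 <= C ->
  (forall i y, derivable f y (delta_mx 0 i)) ->
  (forall i x, `|'D_(delta_mx 0 i) f x| <= C * \prod_j rho (x 0 j)) ->
  forall t : n.-tuple R, `|f (row_of_tuple t) - f (row_of_tuple (round_tuple a t))| <=
    \sum_i C * kappa a ^+ n * `|tnth t i - rnd (tnth t i)| * \prod_j rhor (tnth t j).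
Proof.
move=> C0 df Df t; set Pr := \prod_j rhor (tnth t j).
have main k : (k <= n)%N -> `|f (row_of_tuple t) - f (row_of_tuple (mix k t))| <=
    \sum_(i < n | (i < k)%N) C * kappa a ^+ n * `|tnth t i - rnd (tnth t i)| * Pr.
  elim: k => [|k IH] kn.
    have -> : mix 0%N t = t by apply: eq_from_tnth => i; rewrite tnth_mktuple.
    by rewrite subrr normr0 big_pred0.
  pose i := Ordinal kn.
  rewrite (bigD1 i)//= (eq_bigl (fun j : 'I_n => (j < k)%N)); last first.
    by move=> j; rewrite ltnS andbC ltn_neqAle.
  rewrite (le_trans (ler_distD (f (row_of_tuple (mix k t))) _ _))// addrC lerD//.
    by rewrite IH// ltnW.
  have := round_coord_diff C0 (df i) (Df i) (row_of_tuple (mix k t)).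
  have -> : row_of_tuple (mix k t) + (rnd (row_of_tuple (mix k t) 0 i) - row_of_tuple (mix k t) 0 i) *: delta_mx 0 i =
      row_of_tuple (mix k.+1 t).
    apply/rowP => j; rewrite !mxE !tnth_mktuple eqxx /= ltnn.
    have [->|ji] := eqVneq j i; first by rewrite /= ltnn leqnn mulr1 addrC subrK.
    by rewrite mulr0 addr0 [in RHS]ltnS [in RHS]leq_eqVlt (_ : (j == k :> nat) = (j == i))// (negPf ji).
  rewrite distrC; move/le_trans; apply.
  rewrite !mxE tnth_mktuple /= ltnn ler_wpM2l ?mulr_ge0 ?exprn_ge0 ?kappa_ge0//.
  rewrite le_eqVlt; apply/orP; left; apply/eqP; apply: eq_bigr => j _.
  by rewrite !mxE tnth_mktuple; case: ifP => // _; rewrite rhor_round.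
have := main n (leqnn n).
have -> : mix n t = round_tuple a t.
  by apply: eq_from_tnth => i; rewrite tnth_mktuple tnth_map ltn_ord.
by rewrite (eq_bigl xpredT)// => i; rewrite ltn_ord.
Qed.

End schwartz_bounds.

(** * Band-limited functions and the kernel *)

Lemma Rintegral_sum d (T : measurableType d) (R : realType)
    (mu : {measure set T -> \bar R}) (I : Type) (s : seq I) (h : I -> T -> R) :
  (forall i, mu.-integrable setT (EFin \o h i)) ->
  \int[mu]_t (\sum_(i <- s) h i t) = \sum_(i <- s) \int[mu]_t h i t.
Proof.
move=> ih; elim: s => [|i s IH].
  by rewrite big_nil; under eq_Rintegral do rewrite big_nil; rewrite /Rintegral integral0.
rewrite big_cons -IH -RintegralD//; last first.
  have := @integrable_sum _ _ _ mu _ measurableT _ s xpredT (fun i => EFin \o h i) (fun i _ => ih i).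
  by apply: eq_integrable => // t _; rewrite /= sumEFin.
by apply: eq_Rintegral => t _; rewrite big_cons.
Qed.

Section integrability.
Context {R : realType} (n : nat).
Local Notation RT := (n.-tuple (measurableTypeR R)).
Local Notation L := (lebesgue_tuple R n).

Lemma integrable_weight (q : R -> R) (g : RT -> R) (C : R) :
  measurable_fun [set: measurableTypeR R] (q : _ -> measurableTypeR R) ->
  (forall x, 0 <= q x) -> (\int[lebesgue_measure]_x (q x)%:E < +oo)%E ->
  measurable_fun setT (g : RT -> measurableTypeR R) ->
  (forall t, `|g t| <= C * \prod_i q (tnth t i)) ->
  L.-integrable setT (EFin \o g).
Proof.
move=> mq q0 qoo mg gC.
have mprod : measurable_fun setT (fun t : RT => \prod_i q (tnth t i) : measurableTypeR R).
  exact: (measurable_prod_tnth (f := fun=> q)).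
have ip : L.-integrable setT (fun t => (C * \prod_i q (tnth t i))%:E).
  have : L.-integrable setT (EFin \o (fun t => \prod_i q (tnth t i))).
    apply/integrableP; split; first exact/measurable_EFinP.
    under eq_integral do rewrite gee0_abs ?lee_fin ?prodr_ge0//.
    rewrite (integral_lebesgue_tuple_prod (f := fun=> q))//.
    have qfin : (\int[lebesgue_measure]_x (q x)%:E)%E \is a fin_num.
      by rewrite ge0_fin_numE//; apply: integral_ge0 => x _; rewrite lee_fin.
    by rewrite -(fineK qfin) prodEFin ltry.
  by move=> /(integrableZl measurableT C); apply: eq_integrable.
apply: (le_integrable measurableT _ _ ip); first exact/measurable_EFinP.
by move=> t _; rewrite /= lee_fin (le_trans (gC t))// ler_norm.
Qed.

Lemma integrable_decay (f : 'rV[R]_n -> R) (C : R) : continuous f ->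
  (forall x, `|f x| <= C * \prod_i rho (x 0 i)) ->
  L.-integrable setT (EFin \o (fun t => f (row_of_tuple t))).
Proof.
move=> cf fC; apply: (integrable_weight (q := rho) (C := C)).
- exact: measurable_rho.
- exact: rho_ge0.
- exact: integral_rho_lty.
- exact: measurable_continuous_row.
- move=> t; apply: le_trans (fC _) _; rewrite le_eqVlt; apply/orP; left; apply/eqP.
  by congr (_ * _); apply: eq_bigr => i _; rewrite mxE.
Qed.

Lemma integrableM_bounded (g h : RT -> R) (M : R) :
  L.-integrable setT (EFin \o g) -> measurable_fun setT (h : RT -> measurableTypeR R) ->
  (forall t, `|h t| <= M) -> L.-integrable setT (EFin \o (fun t => g t * h t)).
Proof.
move=> ig mh hM; have mg : measurable_fun setT g by apply/measurable_EFinP; exact: measurable_int ig.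
apply: (le_integrable measurableT (f := EFin \o (fun t => g t * h t)) (g := fun t => (M%:E * (g t)%:E)%E)).
- by apply/measurable_EFinP; exact: measurable_funM.
- move=> t _; rewrite /= lee_fin !normrM mulrC ler_wpM2r//.
  by apply: le_trans (hM t) _; exact: ler_norm.
- exact: integrableZl.
Qed.

Lemma continuous_dotr (xi : 'rV[R]_n) : continuous (fun x : 'rV[R]_n => dotr x xi).
Proof.
apply: continuous_big => [|i _ x]; first exact: add_continuous.
apply: (@continuous_comp _ _ _ (fun x : 'rV[R]_n => x 0 i) (fun y => y * xi 0 i)).
  exact: coord_continuous.
exact: mulrr_continuous.
Qed.

Lemma continuous_mul_dotr (c : R) (xi : 'rV[R]_n) :
  continuous (fun x : 'rV[R]_n => c * dotr x xi).
Proof.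
move=> x; apply: (@continuous_comp _ _ _ (fun x => dotr x xi) (fun y => c * y)).
  exact: continuous_dotr.
exact: mulrl_continuous.
Qed.

Lemma dotrZ (c : R) (x xi : 'rV[R]_n) : dotr x (c *: xi) = c * dotr x xi.
Proof. by rewrite /dotr mulr_sumr; apply: eq_bigr => i _; rewrite mxE mulrCA. Qed.

Lemma measurable_cos_dotr (c : R) (xi : 'rV[R]_n) :
  measurable_fun setT (fun t : RT => cos (c * dotr (row_of_tuple t) xi) : measurableTypeR R).
Proof.
apply: (measurable_continuous_row (f := fun x => cos (c * dotr x xi))) => x.
apply: (@continuous_comp _ _ _ (fun x => c * dotr x xi)); last exact: continuous_cos.
exact: continuous_mul_dotr.
Qed.

Lemma measurable_sin_dotr (c : R) (xi : 'rV[R]_n) :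
  measurable_fun setT (fun t : RT => sin (c * dotr (row_of_tuple t) xi) : measurableTypeR R).
Proof.
apply: (measurable_continuous_row (f := fun x => sin (c * dotr x xi))) => x.
apply: (@continuous_comp _ _ _ (fun x => c * dotr x xi)); last exact: continuous_sin.
exact: continuous_mul_dotr.
Qed.

Lemma cos_abs_le1 (x : R) : `|cos x| <= 1.
Proof. by rewrite ler_norml cos_geN1 cos_le1. Qed.

Lemma sin_abs_le1 (x : R) : `|sin x| <= 1.
Proof. by rewrite ler_norml sin_geN1 sin_le1. Qed.

End integrability.

Section band_limited.
Context {R : realType} (n : nat) (eta : 'rV[R]_n -> R[i]).
Local Notation RT := (n.-tuple (measurableTypeR R)).
Local Notation L := (lebesgue_tuple R n).
Let f1 (t : RT) := complex.Re (eta (row_of_tuple t)).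
Let f2 (t : RT) := complex.Im (eta (row_of_tuple t)).
Hypothesis int_f1 : L.-integrable setT (EFin \o f1).
Hypothesis int_f2 : L.-integrable setT (EFin \o f2).

Let co xi (t : RT) := cos (2 * pi * dotr (row_of_tuple t) xi).
Let si xi (t : RT) := sin (2 * pi * dotr (row_of_tuple t) xi).

Let int_co f xi : L.-integrable setT (EFin \o f) -> L.-integrable setT (EFin \o (fun t => f t * co xi t)).
Proof.
move=> intf; apply: (integrableM_bounded (M := 1)) => //; first exact: measurable_cos_dotr.
by move=> t; exact: cos_abs_le1.
Qed.

Let int_si f xi : L.-integrable setT (EFin \o f) -> L.-integrable setT (EFin \o (fun t => f t * si xi t)).
Proof.
move=> intf; apply: (integrableM_bounded (M := 1)) => //; first exact: measurable_sin_dotr.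
by move=> t; exact: sin_abs_le1.
Qed.

Lemma fourierE xi : fourier eta xi =
  Complex (\int[L]_t (f1 t * co xi t) + \int[L]_t (f2 t * si xi t))
          (\int[L]_t (f2 t * co xi t) - \int[L]_t (f1 t * si xi t)).
Proof.
rewrite -RintegralD ?int_co ?int_si// -RintegralB ?int_co ?int_si//.
rewrite /fourier /lebesgue_integral_rV /cintegral; congr Complex; apply: eq_Rintegral => t _.
  by rewrite /f1 /f2; case: (eta _) => u v /=; rewrite cosN sinN mulrN opprK.
by rewrite /f1 /f2; case: (eta _) => u v /=; rewrite cosN sinN mulrN addrC.
Qed.

(** The kernel product expands in cosines only, and the sum of the transforms at [xi] and [- xi]
    isolates the cosine integrals of both components. *)
Lemma fourier_eq0 xi : fourier eta xi = 0 -> fourier eta (- xi) = 0 ->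
  \int[L]_t (f1 t * co xi t) = 0 /\ \int[L]_t (f2 t * co xi t) = 0.
Proof.
have dN t : dotr (row_of_tuple t) (- xi) = - dotr (row_of_tuple t) xi.
  by rewrite /dotr -sumrN; apply: eq_bigr => i _; rewrite !mxE mulrN.
have coN f : \int[L]_t (f t * co (- xi) t) = \int[L]_t (f t * co xi t).
  by apply: eq_Rintegral => t _; rewrite /co dN mulrN cosN.
have siN f : L.-integrable setT (EFin \o f) ->
    \int[L]_t (f t * si (- xi) t) = - \int[L]_t (f t * si xi t).
  move=> intf; rewrite -mulN1r -RintegralZl ?int_si//.
  by apply: eq_Rintegral => t _; rewrite /si dN mulrN sinN mulN1r mulrN.
rewrite !fourierE !coN !siN// => -[h1 h2] [h3 h4]; lra.
Qed.

Variables (a B : R).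
Hypotheses (a_gt0 : 0 < a) (B_le : B <= 1 / a) (eta_band : band_limited B eta).

Lemma band_limited_cos (xi : 'rV[R]_n) i : 1 / a <= `|xi 0 i| ->
  \int[L]_t (f1 t * co xi t) = 0 /\ \int[L]_t (f2 t * co xi t) = 0.
Proof.
move=> xia.
(* Dilations by factors above 1, so that the dilated frequency is strictly outside the closed band
   even if [xi] is on its edge. Dominated convergence returns to [xi]. *)
pose c k : R := 1 + k.+1%:R^-1.
have c1 k : 1 < c k by rewrite ltrDl invr_gt0.
have Fz k (s : R) : `|s| = c k -> fourier eta (s *: xi) = 0.
  move=> sE; apply/eqP; apply: contrapT => /negP /eta_band /(_ i).
  rewrite mxE normrM sE; apply/negP; rewrite -ltNge.
  have a1 : 0 < 1 / a by rewrite divr_gt0.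
  apply: (le_lt_trans B_le); apply: (le_lt_trans xia).
  by rewrite ltr_pMl// (lt_le_trans a1).
have h k : \int[L]_t (f1 t * co (c k *: xi) t) = 0 /\ \int[L]_t (f2 t * co (c k *: xi) t) = 0.
  apply: fourier_eq0; first by apply: (Fz k); rewrite gtr0_norm// (lt_trans ltr01).
  by rewrite -scaleNr; apply: (Fz k); rewrite normrN gtr0_norm// (lt_trans ltr01).
have c_cvg : c @ \oo --> (1 : R).
  rewrite -[X in _ --> X]addr0; apply: cvgD; first exact: cvg_cst.
  exact: cvg_harmonic.
have lim f : L.-integrable setT (EFin \o f) ->
    (forall k, \int[L]_t (f t * co (c k *: xi) t) = 0) -> \int[L]_t (f t * co xi t) = 0.
  move=> intf fk.
  have cvg0 : (fun k => \int[L]_t (f t * co (c k *: xi) t)%:E)%E @ \oo --> (\int[L]_t (f t * co xi t)%:E)%E.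
    apply: (dominated_cvg measurableT (g := fun t => `|(f t)%:E|%E)).
    - by move=> k; have /measurable_int := int_co (c k *: xi) intf.
    - move=> t _; apply: cvg_EFin; first exact: nearW.
      apply: cvgM; first exact: cvg_cst.
      rewrite /co; under eq_fun do rewrite dotrZ mulrCA.
      have h2 : (fun k => c k * (2 * pi * dotr (row_of_tuple t) xi)) @ \oo -->
          2 * pi * dotr (row_of_tuple t) xi.
        rewrite -[X in _ --> X]mul1r; apply: cvgM; [exact: c_cvg|exact: cvg_cst].
      by apply: continuous_cvg h2; exact: continuous_cos.
    - by [].
    - exact: integrable_abse.
    - by move=> k t _; rewrite /= lee_fin normrM ler_piMr// cos_abs_le1.
  have fin k : (\int[L]_t (f t * co (c k *: xi) t)%:E)%E = 0%E.
    by rewrite -(fineK (integrable_fin_num measurableT (int_co (c k *: xi) intf))); congr _%:E; exact: fk.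
  have -> : (\int[L]_t (f t * co xi t) = fine (\int[L]_t (f t * co xi t)%:E)%E) by [].
  rewrite -(cvg_lim _ cvg0)//; under eq_fun do rewrite fin.
  by rewrite lim_cst.
by split; apply: lim => // k; have [] := h k.
Qed.

Lemma prod_kern_cos N (t : RT) : \prod_i kern a N (tnth t i) =
  \sum_(J : {ffun 'I_n -> 'I_N.*2.+1}) (\prod_i kcoef N (J i)) *
    co (\row_i ((N%:R - (J i)%:R) / a)) t.
Proof.
suff /(congr1 (@complex.Re R)) : (\prod_i kern a N (tnth t i))%:C%C =
  \sum_(J : {ffun 'I_n -> 'I_N.*2.+1}) (\prod_i kcoef N (J i))%:C%C *
    expi (2 * pi * dotr (row_of_tuple t) (\row_i ((N%:R - (J i)%:R) / a))).
  rewrite raddf_sum/= => ->; apply: eq_bigr => J _.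
  by rewrite mul0r subr0.
rewrite rmorph_prod/=; under eq_bigr do rewrite kern_expi//.
rewrite bigA_distr_bigA; apply: eq_bigr => J _.
rewrite big_split/= rmorph_prod; congr (_ * _).
rewrite -expi_sum; congr expi; rewrite /dotr mulr_sumr; apply: eq_bigr => i _.
by rewrite !mxE; field; exact: lt0r_neq0.
Qed.

Lemma band_limited_kern N :
  \int[L]_t (f1 t * \prod_i kern a N (tnth t i)) = \int[L]_t f1 t /\
  \int[L]_t (f2 t * \prod_i kern a N (tnth t i)) = \int[L]_t f2 t.
Proof.
pose xi (J : {ffun 'I_n -> 'I_N.*2.+1}) : 'rV[R]_n := \row_i ((N%:R - (J i)%:R) / a).
have midP : (N < N.*2.+1)%N by rewrite ltnS -addnn leq_addr.
pose mid : {ffun 'I_n -> 'I_N.*2.+1} := [ffun=> Ordinal midP].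
have main f : L.-integrable setT (EFin \o f) ->
    (forall J, J != mid -> \int[L]_t (f t * co (xi J) t) = 0) ->
    \int[L]_t (f t * \prod_i kern a N (tnth t i)) = \int[L]_t f t.
  move=> intf fJ.
  transitivity (\int[L]_t (\sum_(J : {ffun 'I_n -> 'I_N.*2.+1}) (\prod_i kcoef N (J i)) * (f t * co (xi J) t))).
    apply: eq_Rintegral => t _; rewrite prod_kern_cos mulr_sumr; apply: eq_bigr => J _.
    by rewrite mulrCA.
  rewrite Rintegral_sum; last first.
    move=> J; have := integrableZl measurableT (\prod_i kcoef N (J i)) (int_co (xi J) intf).
    by apply: eq_integrable.
  rewrite (bigD1 mid)//= [X in _ + X]big1 ?addr0; last first.
    by move=> J Jm; rewrite (RintegralZl _ measurableT (int_co (xi J) intf)) fJ// mulr0.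
  apply: eq_Rintegral => t _.
  rewrite big1 ?mul1r; last by move=> i _; rewrite ffunE kcoef_mid.
  rewrite /co (_ : xi mid = 0); last by apply/rowP => i; rewrite !mxE ffunE subrr mul0r.
  by rewrite /dotr big1 ?mulr0 ?cos0 ?mulr1// => i _; rewrite !mxE mulr0.
(* Off the constant term some coordinate of the frequency is a nonzero multiple of [1 / a], hence on
   the edge of the band or beyond. *)
have zero J : J != mid -> \int[L]_t (f1 t * co (xi J) t) = 0 /\ \int[L]_t (f2 t * co (xi J) t) = 0.
  move=> Jm; have [i Ji] : exists i, J i <> Ordinal midP.
    apply/existsNP => h; move/eqP: Jm; apply; apply/ffunP => i; rewrite ffunE; exact: h.
  apply: (@band_limited_cos _ i); rewrite mxE normrM (@ger0_norm _ a^-1) ?invr_ge0 ?(ltW a_gt0)//.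
  rewrite ler_pM2r ?invr_gt0//.
  have : (J i : nat) <> N by move=> JN; apply: Ji; apply: val_inj.
  have [h|h|//] := ltngtP (J i) N.
    by move=> _; rewrite -natrB ?(ltnW h)// normr_nat ler1n subn_gt0.
  by move=> _; rewrite distrC -natrB ?(ltnW h)// normr_nat ler1n subn_gt0.
by split; apply: main => // J /zero[].
Qed.

End band_limited.

(** * Rounding preserves the integral *)

Section sine_bound.
Context {R : realType}.
Implicit Types u v x : R.

Lemma sqr_cos_quarter v : 0 <= v <= pi / 4 -> 1 / 2 <= cos v ^+ 2 :> R.
Proof.
move=> /andP[v0 v4]; have p0 := pi_gt0 R.
have c4 : cos (pi / 4) ^+ 2 = 1 / 2 :> R.
  have : cos (pi / 4 + pi / 4) = 0 :> R by rewrite (_ : _ + _ = pi / 2) ?cos_pihalf//; field.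
  by rewrite cosD -!expr2 sin2cos2; lra.
have c40 : 0 <= cos (pi / 4) :> R by apply: cos_ge0_pihalf; apply/andP; split; lra.
rewrite -c4 ler_sqr ?nnegrE//; last first.
  by apply: cos_ge0_pihalf; apply/andP; split; lra.
by rewrite leNgt ltr_cos ?in_itv/= -?leNgt//; apply/andP; split; lra.
Qed.

(** For [u = 2v >= 0], one has [sin u = 2 sin v cos v] with [v] in [[0, pi/4]], where [cos^2] is at
    least 1/2. The mean value theorem then gives [sin^2 v >= v^2 / 2], and so [sin^2 u >= v^2]. *)
Lemma sqr_le_sin2 u : `|u| <= pi / 2 -> u ^+ 2 <= 4 * sin u ^+ 2.
Proof.
have p0 := pi_gt0 R.
wlog u0 : u / 0 <= u => [hw|].
  have [u0|u0] := leP 0 u; first exact: hw.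
  by move=> uh; have := hw (- u); rewrite normrN sinN !sqrrN; apply => //; rewrite oppr_ge0 ltW.
rewrite ger0_norm// => up; pose v := u / 2.
have uE : u = v + v by rewrite /v; field.
have v0 : 0 <= v by rewrite divr_ge0.
have v4 : v <= pi / 4 by rewrite /v; lra.
have [s hs E] := MVT_between 0 v (fun s : R => is_derive_sin s).
have {}hs : 0 <= s <= v by case: hs => // /andP[h1 h2]; apply/andP; split; lra.
have sv : v ^+ 2 / 2 <= sin v ^+ 2.
  move: E; rewrite sin0 !subr0 => /(congr1 (fun z => z ^+ 2)).
  rewrite exprMn !real_normK ?num_real// => ->.
  rewrite mulrC ler_wpM2r ?sqr_ge0//.
  have := @sqr_cos_quarter s; case/andP: hs => h1 h2; rewrite h1 (le_trans h2 v4) => /(_ isT).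
  by rewrite mul1r.
have cv : 1 / 2 <= cos v ^+ 2 by apply: sqr_cos_quarter; rewrite v0.
have sE : sin v * cos v + cos v * sin v = 2 * (sin v * cos v) by ring.
rewrite uE sinD sE !exprMn.
have v20 := sqr_ge0 v.
have -> : (v + v) ^+ 2 = 4 * v ^+ 2 by ring.
have h : v ^+ 2 / 2 * (1 / 2) <= sin v ^+ 2 * cos v ^+ 2.
  by apply: ler_pM => //; rewrite divr_ge0.
lra.
Qed.

Variable a : R.
Hypothesis a_gt0 : 0 < a.

Lemma round_dist_sin x : (x - round a x) ^+ 2 <= 4 * (a / pi) ^+ 2 * sin (pi * x / a) ^+ 2.
Proof.
have p0 := pi_gt0 R.
pose u := pi * (x - round a x) / a.
have ua : `|u| <= pi / 2.
  rewrite !normrM (ger0_norm (ltW p0)) (@ger0_norm _ a^-1) ?invr_ge0 ?(ltW a_gt0)//.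
  rewrite ler_pdivrMr// mulrAC -mulrA ler_wpM2l ?(ltW p0)//.
  by have := round_dist a_gt0 x; lra.
have := sqr_le_sin2 ua.
have -> : sin u ^+ 2 = sin (pi * x / a) ^+ 2.
  (* The two angles differ by an integer multiple of [pi]; doubling turns this into full periods. *)
  have dbl y : sin y ^+ 2 = (1 - cos (y + y)) / 2 :> R.
    by rewrite cosD -!expr2 sin2cos2; field.
  rewrite !dbl; congr ((1 - _) / 2).
  have [m [k mk]] : exists m k : nat, (cell_index a x)%:~R = m%:R - k%:R :> R.
    case: (cell_index a x) => m; first by exists m, 0%N; rewrite subr0.
    by exists 0%N, m.+1; rewrite NegzE mulrNz sub0r.
  have -> : pi * x / a + pi * x / a = u + u + (m%:R - k%:R) * (2 * pi).
    rewrite -mk /u /round; field; exact: lt0r_neq0.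
  by have [-> _] := expi_period m k (u + u).
move=> h.
have -> : (x - round a x) ^+ 2 = (a / pi) ^+ 2 * u ^+ 2.
  have key (p y : R) : 0 < p -> y ^+ 2 = (a / p) ^+ 2 * (p * y / a) ^+ 2.
    by move=> p00; field; rewrite !lt0r_neq0.
  exact: key.
by have := ler_wpM2l (sqr_ge0 (a / pi)) h; rewrite [leRHS]mulrCA [leRHS]mulrA.
Qed.

End sine_bound.

(** * Mean distance to the lattice under the kernel *)

Section weighted_kernel.
Context {R : realType} (a : R).
Hypothesis a_gt0 : 0 < a.
Local Notation mu := (@lebesgue_measure R).
Local Notation rnd := (round a).
Local Notation rhor := (rhor a).

Let A : R := fine (\int[mu]_x (rhor x)%:E)%E.

Lemma weight_mass : (\int[mu]_x (rhor x)%:E)%E = A%:E.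
Proof.
rewrite fineK// ge0_fin_numE ?integral_rhor_lty//.
by apply: integral_ge0 => x _; rewrite lee_fin rhor_ge0.
Qed.

Lemma weight_mass_ge0 : 0 <= A.
Proof. by apply: fine_ge0; apply: integral_ge0 => x _; rewrite lee_fin rhor_ge0. Qed.

Lemma measurable_kern N : measurable_fun [set: measurableTypeR R] (kern a N : _ -> measurableTypeR R).
Proof. by apply: continuous_measurable_fun; exact: continuous_kern. Qed.

Lemma measurable_rhor_kern N :
  measurable_fun [set: measurableTypeR R] (fun x => rhor x * kern a N x : measurableTypeR R).
Proof. by apply: measurable_funM; [exact: measurable_rhor|exact: measurable_kern]. Qed.

Lemma integral_rhor_kern N : (\int[mu]_x (rhor x * kern a N x)%:E = A%:E)%E.
Proof.
rewrite -weight_mass -[RHS](integral_comp_round_kern a_gt0 (q := fun x => (rho x)%:E) N)//.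
by move=> x; rewrite lee_fin rho_ge0.
Qed.

Lemma integral_rhor_sin_kern N :
  (\int[mu]_x (rhor x * (sin (pi * x / a) ^+ 2 * kern a N x))%:E = (A / N.*2.+2%:R)%:E)%E.
Proof.
have intk M : mu.-integrable setT (EFin \o (fun x => rhor x * kern a M x)).
  apply/integrableP; split; first by apply/measurable_EFinP; exact: measurable_rhor_kern.
  rewrite (_ : \int[mu]_x _ = A%:E)%E ?ltry// -(integral_rhor_kern M).
  by apply: eq_integral => x _; rewrite /= ger0_norm// mulr_ge0 ?rhor_ge0 ?kern_ge0.
pose c : R := N.*2.+1%:R / N.*2.+2%:R.
transitivity (\int[mu]_x ((rhor x * kern a N x)%:E - c%:E * (rhor x * kern a N.+1 x)%:E))%E.
  by apply: eq_integral => x _; rewrite -EFinM -EFinB sin2_kern// mulrBr [rhor x * (_ * kern a N.+1 x)]mulrCA.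
have intc : mu.-integrable setT (fun x => c%:E * (rhor x * kern a N.+1 x)%:E)%E.
  exact: (integrableZl measurableT c (intk N.+1)).
transitivity (\int[mu]_x (rhor x * kern a N x)%:E - \int[mu]_x (c%:E * (rhor x * kern a N.+1 x)%:E))%E.
  exact: (integralB measurableT (intk N) intc).
have -> : (\int[mu]_x (c%:E * (rhor x * kern a N.+1 x)%:E) = c%:E * A%:E)%E.
  by rewrite -(integral_rhor_kern N.+1); exact: (integralZl measurableT (intk N.+1)).
rewrite integral_rhor_kern -EFinM -EFinB; congr _%:E.
rewrite /c -[X in X - _]mul1r -mulrBl mulrC; congr (_ * _).
have h : N.*2.+2%:R != 0 :> R by rewrite pnatr_eq0.
by rewrite -[X in X - _](divff h) -mulrBl -natrB// subSnn mul1r.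
Qed.

(** The distance [y] to the lattice satisfies [4 eps y <= 4 eps^2 + y^2], and [y^2] is at most
    [4 (a/pi)^2 sin^2(pi x/a)] by [round_dist_sin]. The sine term is then integrated exactly, and
    [eps] stays free. *)
Lemma integral_rhor_dist_kern N (eps : R) : 0 < eps ->
  (\int[mu]_x (rhor x * `|x - rnd x| * kern a N x)%:E <=
   (A * (eps + (a / pi) ^+ 2 / (eps * N.*2.+2%:R)))%:E)%E.
Proof.
move=> e0.
have ms : measurable_fun [set: measurableTypeR R]
    (fun x => rhor x * (sin (pi * x / a) ^+ 2 * kern a N x) : measurableTypeR R).
  apply: measurable_funM; first exact: measurable_rhor.
  apply: measurable_funM; last exact: measurable_kern.
  apply: measurable_funX; apply: continuous_measurable_fun => x.
  apply: (@continuous_comp _ _ _ (fun x => pi * x / a)); last exact: continuous_sin.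
  by apply: cvgM; [apply: cvgM; [exact: cvg_cst|exact: cvg_id]|exact: cvg_cst].
have md : measurable_fun [set: measurableTypeR R]
    (fun x => rhor x * `|x - rnd x| * kern a N x : measurableTypeR R).
  apply: measurable_funM; last exact: measurable_kern.
  apply: measurable_funM; first exact: measurable_rhor.
  apply: measurableT_comp => //; apply: measurable_funB => //.
  exact: measurable_round.
pose c : R := (a / pi) ^+ 2 / eps.
have c0 : 0 <= c by rewrite divr_ge0 ?sqr_ge0// ltW.
apply: (@le_trans _ _ (\int[mu]_x (eps%:E * (rhor x * kern a N x)%:E +
    c%:E * (rhor x * (sin (pi * x / a) ^+ 2 * kern a N x))%:E))%E).
  apply: ge0_le_integral => //.
  - by move=> x _; rewrite lee_fin mulr_ge0 ?kern_ge0// mulr_ge0 ?rhor_ge0.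
  - exact/measurable_EFinP.
  - apply: emeasurable_funD; apply: measurable_funeM; apply/measurable_EFinP => //.
    exact: measurable_rhor_kern.
  - move=> x _; rewrite -!EFinM -EFinD lee_fin.
    have h : `|x - rnd x| <= eps + c * sin (pi * x / a) ^+ 2.
      have := round_dist_sin a_gt0 x; rewrite -real_normK ?num_real//.
      set y := `|x - rnd x|; set s := sin _ ^+ 2 => hs.
      have : 4 * eps * y <= 4 * eps * (eps + c * s).
        have -> : 4 * eps * (eps + c * s) = 4 * eps ^+ 2 + 4 * (a / pi) ^+ 2 * s.
          by rewrite /c; set q := (a / pi) ^+ 2; field; exact: lt0r_neq0.
        have := sqr_ge0 (2 * eps - y); have -> : (2 * eps - y) ^+ 2 = 4 * eps ^+ 2 - 4 * eps * y + y ^+ 2 by ring.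
        by lra.
      by rewrite ler_pM2l// mulr_gt0.
    rewrite [X in _ <= X](_ : _ = rhor x * (eps + c * sin (pi * x / a) ^+ 2) * kern a N x); last by ring.
    by rewrite ler_wpM2r ?kern_ge0// ler_wpM2l ?rhor_ge0.
rewrite ge0_integralD//; last 4 first.
- by move=> x _; rewrite mule_ge0 ?lee_fin ?(ltW e0)// mulr_ge0 ?rhor_ge0 ?kern_ge0.
- by apply: measurable_funeM; apply/measurable_EFinP; exact: measurable_rhor_kern.
- by move=> x _; rewrite mule_ge0 ?lee_fin// mulr_ge0 ?rhor_ge0// mulr_ge0 ?sqr_ge0 ?kern_ge0.
- by apply: measurable_funeM; apply/measurable_EFinP.
rewrite !ge0_integralZl_EFin//; last 5 first.
- by move=> x _; rewrite lee_fin mulr_ge0 ?rhor_ge0// mulr_ge0 ?sqr_ge0 ?kern_ge0.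
- exact/measurable_EFinP.
- by move=> x _; rewrite lee_fin mulr_ge0 ?rhor_ge0 ?kern_ge0.
- by apply/measurable_EFinP; exact: measurable_rhor_kern.
- exact: ltW.
rewrite integral_rhor_kern integral_rhor_sin_kern -!EFinM -EFinD lee_fin le_eqVlt; apply/orP; left.
apply/eqP; rewrite /c; move: ((a / pi) ^+ 2) => q.
have : N.*2.+2%:R != 0 :> R by rewrite pnatr_eq0.
move: (N.*2.+2%:R : R) => M M0.
by field; rewrite M0 lt0r_neq0.
Qed.

End weighted_kernel.

Section rounding.
Context {R : realType} (n : nat) (a : R).
Hypothesis a_gt0 : 0 < a.
Local Notation mu := (@lebesgue_measure R).
Local Notation rnd := (round a).
Local Notation rhor := (rhor a).
Local Notation RT := (n.-tuple (measurableTypeR R)).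
Local Notation L := (lebesgue_tuple R n).
Let A : R := fine (\int[mu]_x (rhor x)%:E)%E.

Let K N (t : RT) : R := \prod_i kern a N (tnth t i).

Let K_ge0 N t : 0 <= K N t.
Proof. by apply: prodr_ge0 => i _; exact: kern_ge0. Qed.

Let mK N : measurable_fun setT (K N : RT -> measurableTypeR R).
Proof. by apply: (measurable_prod_tnth (f := fun=> kern a N)) => i; exact: measurable_kern. Qed.

Lemma kern_bounded N : exists M, forall x, `|kern a N x| <= M.
Proof.
by exists (4 ^+ N / 'C(N.*2, N)%:R) => x; rewrite ger0_norm ?kern_ge0// /kern ler_piMr//.
Qed.

Let K_bounded N : exists M, forall t, `|K N t| <= M.
Proof.
have [M hM] := kern_bounded N; exists (M ^+ n) => t.
by rewrite normr_prod -prod_cst; apply: ler_prod => i _; rewrite normr_ge0 hM.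
Qed.

(** Factors for a product form of the error integrand, in which only coordinate [i] carries a
    distance; the integral over tuples then factors. *)
Let h N (i j : 'I_n) (x : R) : R :=
  if j == i then rhor x * `|x - rnd x| * kern a N x else rhor x * kern a N x.

Let h_ge0 N i j x : 0 <= h N i j x.
Proof.
by rewrite /h; case: ifP => _; rewrite mulr_ge0 ?kern_ge0// ?mulr_ge0// rhor_ge0.
Qed.

Let mh N i j : measurable_fun [set: measurableTypeR R] (h N i j : _ -> measurableTypeR R).
Proof.
rewrite /h; case: (j == i); last exact: measurable_rhor_kern.
apply: measurable_funM; last exact: measurable_kern.
apply: measurable_funM; first exact: measurable_rhor.
by apply: measurableT_comp => //; apply: measurable_funB => //; exact: measurable_round.
Qed.

Let prod_h N i (t : RT) :
  `|tnth t i - rnd (tnth t i)| * (\prod_j rhor (tnth t j)) * K N t = \prod_j h N i j (tnth t j).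
Proof.
rewrite -mulrA /K -big_split /= [in LHS](bigD1 i)//= [in RHS](bigD1 i)//= {1}/h eqxx.
rewrite mulrA; congr (_ * _); first by rewrite mulrCA mulrA.
by apply: eq_bigr => j /negPf ji; rewrite /h ji.
Qed.

Let delta N (eps : R) : R := eps + (a / pi) ^+ 2 / (eps * N.*2.+2%:R).

Lemma integral_dist_prod_kern N i (eps : R) : 0 < eps ->
  (\int[L]_t (`|tnth t i - rnd (tnth t i)| * (\prod_j rhor (tnth t j)) * K N t)%:E <=
   (A ^+ n * delta N eps)%:E)%E.
Proof.
move=> e0; under eq_integral do rewrite prod_h.
rewrite (integral_lebesgue_tuple_prod (f := h N i))//.
rewrite [X in (X <= _)%E](bigD1 i)//=.
rewrite (eq_bigr (fun=> A%:E)); last first.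
  by move=> j ji; rewrite /h (negPf ji) integral_rhor_kern.
rewrite prodEFin prodr_const.
have -> : #|[pred j | j != i]| = n.-1.
  by have := cardC1 i; rewrite card_ord => <-; apply: eq_card => j; rewrite !inE.
apply: (@le_trans _ _ ((A * delta N eps)%:E * (A ^+ n.-1)%:E)%E).
  rewrite lee_wpmul2r ?lee_fin ?exprn_ge0 ?weight_mass_ge0//.
  rewrite (_ : (fun x => _) = (fun x => (rhor x * `|x - rnd x| * kern a N x)%:E)); last first.
    by apply/funext => x; rewrite /h eqxx.
  exact: integral_rhor_dist_kern.
rewrite -EFinM lee_fin mulrAC -exprS prednK//; exact: leq_ltn_trans (ltn_ord i).
Qed.

Lemma integrable_round (f : 'rV[R]_n -> R) (C : R) :
  (forall x, `|f x| <= C * \prod_i rho (x 0 i)) ->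
  L.-integrable setT (EFin \o (fun t => f (row_of_tuple (round_tuple a t)))).
Proof.
move=> fC; apply: (integrable_weight (q := rhor) (C := C)).
- exact: measurable_rhor.
- by move=> x; exact: rhor_ge0.
- exact: integral_rhor_lty.
- exact: (measurable_comp_round a_gt0 (fun t => f (row_of_tuple t) : measurableTypeR R)).
- move=> t; apply: le_trans (fC _) _; rewrite (eq_bigr (fun i => rhor (tnth t i)))//.
  by move=> i _; rewrite /row_of_tuple mxE tnth_map.
Qed.

Lemma Rintegral_round_kern (f : RT -> R) N :
  L.-integrable setT (EFin \o (fun t => f (round_tuple a t))) ->
  \int[L]_t (f (round_tuple a t) * K N t) = \int[L]_t f (round_tuple a t).
Proof.
move=> intf; rewrite /Rintegral; congr fine.
rewrite integralE [RHS]integralE; congr (_ - _)%E.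
  transitivity (\int[L]_t (Num.max (f (round_tuple a t)) 0 * K N t)%:E)%E.
    apply: eq_integral => t _; rewrite funeposE -EFin_max; congr _%:E.
    by rewrite maxr_pMl// mul0r.
  rewrite (integral_round_tuple_kern a_gt0 N (F := fun t => Num.max (f t) 0)); last first.
    by move=> t; rewrite le_max lexx orbT.
  by apply: eq_integral => t _; rewrite funeposE -EFin_max.
transitivity (\int[L]_t (Num.max (- f (round_tuple a t)) 0 * K N t)%:E)%E.
  apply: eq_integral => t _; rewrite funenegE -EFinN -EFin_max; congr _%:E.
  by rewrite -mulNr maxr_pMl// mul0r.
rewrite (integral_round_tuple_kern a_gt0 N (F := fun t => Num.max (- f t) 0)); last first.
  by move=> t; rewrite le_max lexx orbT.
by apply: eq_integral => t _; rewrite funenegE -EFinN -EFin_max.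
Qed.

Lemma Rintegral_round (f : 'rV[R]_n -> R) : smooth f -> rapidly_decreasing f ->
  (forall N, \int[L]_t (f (row_of_tuple t) * K N t) = \int[L]_t f (row_of_tuple t)) ->
  \int[L]_t f (row_of_tuple (round_tuple a t)) = \int[L]_t f (row_of_tuple t).
Proof.
move=> sf df fK.
have [C C0 hC] := decay_bound (df [::]).
have cf : continuous f by have [] := sf [::].
have intf := integrable_decay cf hC.
have intfr := integrable_round hC.
have intK g N : L.-integrable setT (EFin \o g) -> L.-integrable setT (EFin \o (fun t => g t * K N t)).
  by move=> ig; have [M hM] := K_bounded N; apply: (integrableM_bounded (M := M)).
have [D D0 hD] : exists2 D, 0 <= D & forall i x, `|'D_(delta_mx 0 i) f x| <= D * \prod_j rho (x 0 j).
  have /choice[Di hDi] : forall i : 'I_n, exists Di : R, 0 <= Di /\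
      forall x, `|'D_(delta_mx 0 i) f x| <= Di * \prod_j rho (x 0 j).
    by move=> i; have [Di Di0 hDi] := decay_bound (df [:: i]); exists Di.
  exists (\sum_i Di i); first by apply: sumr_ge0 => i _; have [] := hDi i.
  move=> i x; have [_ /(_ x) /le_trans] := hDi i; apply.
  rewrite ler_wpM2r ?prodr_ge0// => [j _|]; first exact: rho_ge0.
  by rewrite (bigD1 i)//= lerDl sumr_ge0// => j _; have [] := hDi j.
have dF i y : derivable f y (delta_mx 0 i) by have [_] := sf [::]; apply.
pose E : R := D * kappa a ^+ n.
have E0 : 0 <= E by rewrite mulr_ge0 ?exprn_ge0 ?kappa_ge0.
pose g t := f (row_of_tuple t); pose gr t := f (row_of_tuple (round_tuple a t)).
(* The kernel is inserted in both integrals without changing them, and the difference is then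
   estimated under the integral sign by [round_tuple_diff]. *)
have bound N eps : 0 < eps -> `|\int[L]_t g t - \int[L]_t gr t| <= n%:R * E * A ^+ n * delta N eps.
  move=> e0; rewrite -(fK N) -(Rintegral_round_kern (f := g) N)// -RintegralB//; [|exact: intK..].
  rewrite -lee_fin.
  have intd : L.-integrable setT (EFin \o (fun t => g t * K N t - gr t * K N t)).
    have := integrableB measurableT (intK _ N intf) (intK _ N intfr).
    by apply: eq_integrable => // t _; rewrite /= EFinB.
  apply: le_trans (_ : (\int[L]_t (`|g t * K N t - gr t * K N t|)%:E <= _)%E).
    rewrite /Rintegral -abse_EFin fineK; last exact: integrable_fin_num.
    exact: le_abse_integral (measurable_int _ intd).
  apply: (@le_trans _ _ (\int[L]_t (\sum_(i < n) E%:E * (`|tnth t i - rnd (tnth t i)| * (\prod_j rhor (tnth t j)) * K N t)%:E))%E).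
    apply: ge0_le_integral => //.
    - by move: (measurable_int _ intd) => /measurable_EFinP md; apply/measurable_EFinP; exact: measurableT_comp.
    - apply: emeasurable_sum => i; apply: measurable_funeM; apply/measurable_EFinP.
      rewrite (_ : (fun t => _) = (fun t => \prod_j h N i j (tnth t j))); last by apply/funext => t; rewrite prod_h.
      exact: measurable_prod_tnth.
    - move=> t _; rewrite -mulrBl normrM (ger0_norm (K_ge0 N t)).
      rewrite (eq_bigr (fun i => (E * (`|tnth t i - rnd (tnth t i)| * (\prod_j rhor (tnth t j)) * K N t))%:E))//.
      rewrite sumEFin lee_fin (eq_bigr (fun i => E * `|tnth t i - rnd (tnth t i)| * (\prod_j rhor (tnth t j)) * K N t)); last by move=> i _; rewrite !mulrA.
      by rewrite -mulr_suml ler_wpM2r//; exact: round_tuple_diff.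
  rewrite ge0_integral_sum//; last 2 first.
  - move=> i; apply: measurable_funeM; apply/measurable_EFinP.
    rewrite (_ : (fun t => _) = (fun t => \prod_j h N i j (tnth t j))); last by apply/funext => t; rewrite prod_h.
    exact: measurable_prod_tnth.
  - by move=> i t _; rewrite prod_h mule_ge0 ?lee_fin// prodr_ge0.
  apply: (@le_trans _ _ (\sum_(i < n) (E * (A ^+ n * delta N eps))%:E)%E).
    apply: lee_sum => i _; rewrite ge0_integralZl_EFin//; last 2 first.
    - by move=> t _; rewrite prod_h lee_fin prodr_ge0.
    - apply/measurable_EFinP.
      rewrite (_ : (fun t => _) = (fun t => \prod_j h N i j (tnth t j))); last by apply/funext => t; rewrite prod_h.
      exact: measurable_prod_tnth.
    by rewrite [leRHS]EFinM; apply: lee_wpmul2l; [rewrite lee_fin|exact: integral_dist_prod_kern].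
  by rewrite sumEFin sumr_const card_ord lee_fin -[leLHS]mulr_natl !mulrA.
apply/esym/eqP; rewrite -subr_eq0 -normr_eq0 eq_le normr_ge0 andbT.
apply/ler_addgt0Pr => e e0.
(* The constant of [bound], plus 1 to make it positive. For [N] at least [(a/pi)^2 / eps^2] one has
   [delta N eps <= 2 eps], so [eps = e / (2 Q)] bounds the difference by [e]. *)
pose Q : R := n%:R * E * A ^+ n + 1.
have m0 : 0 <= n%:R * E * A ^+ n by rewrite mulr_ge0 ?exprn_ge0 ?weight_mass_ge0// mulr_ge0.
have Q0 : 0 < Q by rewrite ltr_wpDl.
pose eps := e / (2 * Q); have eps0 : 0 < eps by rewrite divr_gt0// mulr_gt0.
have [N hN] : exists N : nat, (a / pi) ^+ 2 / eps ^+ 2 <= N%:R.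
  exists (Num.bound ((a / pi) ^+ 2 / eps ^+ 2)); apply/ltW/archi_boundP.
  by rewrite divr_ge0 ?sqr_ge0.
rewrite add0r; apply: le_trans (bound N eps eps0) _.
have hd : delta N eps <= 2 * eps.
  rewrite /delta [2 * eps]mulr_natl mulr2n lerD2l ler_pdivrMr; last exact: mulr_gt0 eps0 (ltr0Sn _ _).
  move: hN; rewrite ler_pdivrMr ?exprn_gt0// => /le_trans; apply.
  rewrite (_ : eps * (eps * _) = eps ^+ 2 * N.*2.+2%:R); last by rewrite mulrA.
  rewrite mulrC ler_wpM2l ?sqr_ge0// ler_nat; lia.
apply: (@le_trans _ _ (Q * (2 * eps))).
  apply: ler_pM => //.
  - by rewrite addr_ge0 ?(ltW eps0)// divr_ge0 ?sqr_ge0// mulr_ge0// ltW.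
  - by rewrite lerDl.
by rewrite /eps le_eqVlt; apply/orP; left; apply/eqP; field; exact: lt0r_neq0.
Qed.

End rounding.

Section lattice_process.
Context {R : realType} d (T : measurableType d) (P : probability T R)
  (lambda : R) (w : point_process P) (a B : R).
Hypotheses (lambda_gt0 : 0 < lambda) (w_poisson : is_poisson lambda w).
Hypotheses (a_gt0 : 0 < a) (B_le : B <= 1 / a).

Lemma rounded_supported (v : point_process P) :
  (forall t, v t = image_configuration (round_proper a_gt0) (w t)) ->
  supported_on_lattice a v.
Proof.
move=> vE t x; rewrite vE /= => /eqP; rewrite cardfs_eq0 => /fset0Pn[l].
rewrite in_fset_set; last exact: (finite_fiber (round_proper a_gt0)).
by rewrite inE => -[_ /= <-]; exists (cell_index a l.1).
Qed.

Lemma rounded_mimics (v : point_process P) :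
  (forall t, v t = image_configuration (round_proper a_gt0) (w t)) -> mimics B v w.
Proof.
move=> vE n n0 eta [sre sim dre dim] etaB.
have int f : smooth f -> rapidly_decreasing f ->
    (lebesgue_tuple R n).-integrable setT (EFin \o (fun t => f (row_of_tuple t))) /\
    (lebesgue_tuple R n).-integrable setT (EFin \o (fun t => f (row_of_tuple (round_tuple a t)))).
  move=> sf df; have [C C0 hC] := decay_bound (df [::]).
  have cf : continuous f by have [] := sf [::].
  by split; [exact: integrable_decay hC|exact: (integrable_round a_gt0) hC].
have main f : smooth f -> rapidly_decreasing f ->
    (forall N, \int[lebesgue_tuple R n]_t (f (row_of_tuple t) * \prod_i kern a N (tnth t i)) =
       \int[lebesgue_tuple R n]_t f (row_of_tuple t)) ->
    \int[P]_t rsum (@distinct_labels R n (w t)) (fun j => f (row_of_tuple (points j))) =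
    \int[P]_t rsum (@distinct_labels R n (v t)) (fun j => f (row_of_tuple (points j))).
  move=> sf df fK; have [i1 i2] := int f sf df.
  rewrite (poisson_rsum lambda_gt0 w_poisson n0 (g := fun t => f (row_of_tuple t)) i1).
  rewrite -(Rintegral_round a_gt0 sf df fK).
  rewrite -(poisson_rsum lambda_gt0 w_poisson n0 (g := fun t => f (row_of_tuple (round_tuple a t))) i2).
  apply: eq_Rintegral => t _; rewrite vE.
  by rewrite (rsum_image_configuration (round_proper a_gt0) _ (fun t => f (row_of_tuple t))).
have [ire _] := int _ sre dre; have [iim _] := int _ sim dim.
have hK N := band_limited_kern ire iim a_gt0 B_le etaB N.
apply/eqP; rewrite eq_complex; apply/andP; split; apply/eqP.
  rewrite !Re_correlation; apply: (main (fun x => complex.Re (eta x))) => // N.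
  by have [] := hK N.
rewrite !Im_correlation; apply: (main (fun x => complex.Im (eta x))) => // N.
by have [] := hK N.
Qed.

Lemma lattice_process : exists v : point_process P,
  [/\ ulm v, supported_on_lattice a v & mimics B v w].
Proof.
have [v vE] := image_process (round_proper a_gt0) (measurable_round a_gt0) w.
exists v; split; [|exact: rounded_supported|exact: rounded_mimics].
have dist x : `|round a x - x| <= a / 2 by rewrite distrC; exact: round_dist.
exact: (image_process_ulm lambda_gt0 w_poisson dist (measurable_round a_gt0) vE).
Qed.

End lattice_process.

(** * Smooth bumps *)

Section flat_functions.
Context {R : realType}.
Implicit Types (p q : {poly R}) (s t : R).

Lemma is_derive_continuous (f df : R -> R) :
  (forall x : R, is_derive x (1 : R) f (df x)) -> continuous f.
Proof.
move=> h x; apply: differentiable_continuous; apply/derivable1_diffP.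
exact: ex_derive.
Qed.

Lemma is_deriveD1 (f g : R -> R) (x df dg : R) :
  is_derive x (1 : R) f df -> is_derive x (1 : R) g dg ->
  is_derive x (1 : R) (fun t => f t + g t) (df + dg).
Proof. by move=> ? ?; exact: is_deriveD. Qed.

Lemma is_deriveM1 (f g : R -> R) (x df dg : R) :
  is_derive x (1 : R) f df -> is_derive x (1 : R) g dg ->
  is_derive x (1 : R) (fun t => f t * g t) (df * g x + f x * dg).
Proof.
move=> hf hg; apply: is_derive_eq (is_deriveM hf hg) _.
by rewrite /GRing.scale /= addrC mulrC.
Qed.

(** The polynomial in [1/s] makes the family stable under differentiation, which acts on it through
    [dflat]. *)
Definition flat p s : R := if 0 < s then p.[s^-1] * expR (- s^-1) else 0.

Lemma exprn_expRN k (u : R) : 0 <= u -> u ^+ k * expR (- u) <= k`!%:R.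
Proof.
move=> u0; rewrite expRN ler_pdivrMr ?expR_gt0//.
case: k => [|k]; first by rewrite expr0 mul1r -expR0 ler_expR.
have := expR_ge1Dxn k u0; have f0 : 0 < k.+1`!%:R :> R by rewrite ltr0n fact_gt0.
by move=> h; rewrite -ler_pdivrMl// mulrC; apply: le_trans h; rewrite lerDr ler01.
Qed.

Lemma flat_bounded p : exists2 C, 0 <= C & forall s, `|flat p s| <= C.
Proof.
exists (\sum_(i < size p) `|p`_i| * i`!%:R).
  by apply: sumr_ge0 => i _; rewrite mulr_ge0.
move=> s; rewrite /flat; case: ifP => s0; last first.
  by rewrite normr0 sumr_ge0// => i _; rewrite mulr_ge0.
rewrite normrM [X in _ * X]ger0_norm ?expR_ge0// horner_coef.
apply: (@le_trans _ _ (\sum_(i < size p) `|p`_i| * (s^-1 ^+ i * expR (- s^-1)))).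
  under [leRHS]eq_bigr do rewrite mulrA; rewrite -mulr_suml ler_wpM2r ?expR_ge0//.
  apply: le_trans (ler_norm_sum _ _ _) _; apply: ler_sum => i _.
  by rewrite normrM [X in _ * X]ger0_norm// exprn_ge0// invr_ge0 ltW.
by apply: ler_sum => i _; rewrite ler_wpM2l// exprn_expRN// invr_ge0 ltW.
Qed.

(** A factor [s^(-2)] is absorbed in the polynomial. The quadratic bound gives derivative 0 at the
    origin. *)
Lemma flat_sqr p : exists2 C, 0 <= C & forall s, `|flat p s| <= C * s ^+ 2.
Proof.
have [C C0 hC] := flat_bounded (p * 'X^2); exists C => // s.
have -> : flat p s = flat (p * 'X^2) s * s ^+ 2.
  rewrite /flat; case: ifP => s0; last by rewrite mul0r.
  by rewrite hornerM hornerXn; field; exact: lt0r_neq0.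
by rewrite normrM [X in _ * X]ger0_norm ?sqr_ge0// ler_wpM2r ?sqr_ge0.
Qed.

Definition dflat p : {poly R} := (p - p^`()) * 'X^2.

Lemma is_derive_flat p s : is_derive s (1 : R) (flat p) (flat (dflat p) s).
Proof.
have [s0|s0|->] := ltgtP s 0.
- apply: (@near_eq_is_derive _ _ _ (cst 0)); last first.
    by rewrite /flat ltNge (ltW s0); exact: is_derive_cst.
  near=> t; rewrite /flat ltNge; have /ltW -> // : t < 0.
  by near: t; exact: lt_nbhsl.
- apply: (@near_eq_is_derive _ _ _ (fun t => p.[t^-1] * expR (- t^-1))).
    near=> t; rewrite /flat; have -> // : 0 < t.
    by near: t; exact: lt_nbhsr.
  have sn0 : s != 0 by exact: lt0r_neq0.
  have dV : is_derive s (1 : R) (fun t : R => t^-1) (- s ^- 2).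
    apply: is_derive_eq (@is_deriveV R id s 1 1 sn0 (is_derive_id _ _)) _.
    by rewrite /GRing.scale/= mulr1.
  have dp : is_derive s (1 : R) (fun t : R => p.[t^-1]) (- s ^- 2 * p^`().[s^-1]).
    have dh : is_derive s^-1 (1 : R) (horner p) (p^`().[s^-1]).
      by apply: DeriveDef; [exact: derivable_horner|rewrite derivE derive1E].
    rewrite mulrC; exact: (@is_derive1_comp R (horner p) (fun t => t^-1)).
  have de : is_derive s (1 : R) (fun t : R => expR (- t^-1)) (s ^- 2 * expR (- s^-1)).
    have dN : is_derive s (1 : R) (fun t : R => - t^-1) (s ^- 2).
      by apply: is_derive_eq (is_deriveN dV) _; rewrite opprK.
    rewrite mulrC; exact: (@is_derive1_comp R (@expR R) (fun t => - t^-1)).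
  apply: is_derive_eq (is_deriveM1 dp de) _.
  rewrite /flat s0 /dflat hornerM hornerXn hornerD hornerN exprVn; ring.
- rewrite {2}/flat ltxx; have [C C0 hC] := flat_sqr p.
  have cv : (fun h : R => h^-1 *: ((flat p \o shift 0) (h *: (1 : R)) - flat p 0)) @ 0^' --> (0 : R).
    apply/cvgr0Pnorm_le => e e0.
    have k0 : 0 < e / (C + 1) by rewrite divr_gt0// ltr_wpDl.
    near=> h; rewrite /= addr0 {2}/flat ltxx subr0 [h *: 1]mulr1 normrM normfV.
    have h0 : h != 0 by near: h; exact: nbhs_dnbhs_neq.
    have hk : `|h| <= e / (C + 1).
      by near: h; exact: dnbhs0_le.
    rewrite mulrC ler_pdivrMr ?normr_gt0//; apply: le_trans (hC _) _.
    rewrite -real_normK ?num_real// expr2 mulrA ler_wpM2r//.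
    move: hk; rewrite ler_pdivlMr ?ltr_wpDl// => hk.
    by have := normr_ge0 h; lra.
  apply: DeriveDef; first by apply/cvg_ex; exists 0; exact: cv.
  exact: (cvg_lim (@norm_hausdorff _ _) cv).
Unshelve. all: by end_near.
Qed.

End flat_functions.

Section test_class.
Context {R : realType} (delta : R).

(* Division by [xi^2 - t^2] makes it possible to invert [xi^2 + d^2/dx^2] on
   cosine transforms. *)
Inductive smooth_bump : (R -> R) -> Prop :=
| bump_flat p q : smooth_bump (fun t => flat p (delta + t) * flat q (delta - t))
| bumpD f g : smooth_bump f -> smooth_bump g -> smooth_bump (fun t => f t + g t)
| bumpX f : smooth_bump f -> smooth_bump (fun t => t * f t)
| bump_div xi f : delta < `|xi| -> smooth_bump f -> smooth_bump (fun t => (xi ^+ 2 - t ^+ 2)^-1 * f t).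

Lemma bump_support g t : smooth_bump g -> delta <= `|t| -> g t = 0.
Proof.
move=> bg dt; elim: bg => [p q|f g' _ -> _ ->|f _ ->|xi f _ _ ->]; rewrite ?addr0 ?mulr0//.
move: dt; rewrite ler_normr => /orP[h|h].
  by rewrite [flat q _]/flat ltNge subr_le0 h mulr0.
by rewrite [flat p _]/flat ltNge (_ : delta + t <= 0) ?mul0r//=; lra.
Qed.

Lemma bump_derive g : smooth_bump g ->
  exists2 dg, smooth_bump dg & forall t : R, is_derive t (1 : R) g (dg t).
Proof.
elim=> [p q|f h _ [df bf hf] _ [dh bh hh]|f bf [df bdf hf]|xi f dxi bf [df bdf hf]].
(* The class has no scalar multiples, so the sign from the chain rule goes into the polynomial. *)
- exists (fun t => flat (dflat p) (delta + t) * flat q (delta - t) +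
                   flat p (delta + t) * flat (- dflat q) (delta - t)).
    by apply: bumpD; exact: bump_flat.
  move=> t.
  have d1 : is_derive t (1 : R) (fun t => delta + t) 1.
    by apply: is_derive_eq (is_deriveD1 (is_derive_cst delta t 1) (is_derive_id t 1)) _; rewrite add0r.
  have d2 : is_derive t (1 : R) (fun t => delta - t) (- 1).
    apply: is_derive_eq (is_deriveD1 (is_derive_cst delta t 1) (is_deriveN (is_derive_id t 1))) _.
    by rewrite add0r.
  apply: is_deriveM1.
    have := @is_derive1_comp R (flat p) (fun t => delta + t) t _ _ (is_derive_flat _ _) d1.
    by rewrite mulr1.
  have := @is_derive1_comp R (flat q) (fun t => delta - t) t _ _ (is_derive_flat _ _) d2.
  by rewrite /flat; case: ifP => _; rewrite ?mul0r// hornerN mulrN1 mulNr.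
- by exists (fun t => df t + dh t); [exact: bumpD|move=> t; exact: is_deriveD1].
- exists (fun t => f t + t * df t); first by apply: bumpD => //; exact: bumpX.
  by move=> t; apply: is_derive_eq (is_deriveM1 (is_derive_id t 1) (hf t)) _; rewrite mul1r.
- pose r t := (xi ^+ 2 - t ^+ 2)^-1.
  (* This is [2 t r^2 f + r f'], with the factor 2 written as a sum to remain in the class. *)
  exists (fun t => (t * (r t * (r t * f t)) + t * (r t * (r t * f t))) + r t * df t).
    apply: bumpD; last exact: bump_div.
    by apply: bumpD; apply: bumpX; apply: bump_div => //; exact: bump_div.
  (* Where the denominator may vanish, [|t| >= |xi| > delta], and the function is 0 on a
     neighborhood of [t]. *)
  move=> t; have [tx|xt] := ltP `|t| `|xi|.
    have rn0 : xi ^+ 2 - t ^+ 2 != 0.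
      rewrite gt_eqF// subr_gt0 -[t ^+ 2]real_normK ?num_real// -[xi ^+ 2]real_normK ?num_real//.
      by rewrite ltr_sqr ?nnegrE.
    have d2 : is_derive t (1 : R) (fun t => xi ^+ 2 - t ^+ 2) (- (t + t)).
      have dN : is_derive t (1 : R) (fun t : R => - (t * t)) (- (t + t)).
        apply: is_derive_eq (is_deriveN (is_deriveM1 (is_derive_id t 1) (is_derive_id t 1))) _.
        by rewrite mul1r mulr1.
      by apply: is_derive_eq (is_deriveD1 (is_derive_cst (xi ^+ 2) t 1) dN) _; rewrite add0r.
    have dr := @is_deriveV R _ t _ 1 rn0 d2.
    apply: is_derive_eq (is_deriveM1 dr (hf t)) _.
    by rewrite /GRing.scale/= /r; field.
  have dt : delta < `|t| by exact: lt_le_trans xt.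
  have -> : t * (r t * (r t * f t)) + t * (r t * (r t * f t)) + r t * df t = 0.
    by rewrite (bump_support bf (ltW dt)) (bump_support bdf (ltW dt)) !mulr0 !addr0.
  apply: (@near_eq_is_derive _ _ _ (cst (0 : R))).
  near=> u; rewrite (bump_support bf) ?mulr0//.
  near: u; apply: (cvgr_ge `|t|) => //; exact: norm_continuous.
Unshelve. all: by end_near.
Qed.

Lemma bump_continuous g : smooth_bump g -> continuous g.
Proof. by move=> /bump_derive[dg _ h]; exact: is_derive_continuous h. Qed.

End test_class.

(** * Band-limited Schwartz functions on the line *)

Section tame.
Context {R : realType}.
Local Notation mu := (@lebesgue_measure R).
Implicit Types (f g F : R -> R).

Definition tame f := continuous f /\ exists C, forall x, `|f x| <= C * rho x.

Lemma measurable_continuous f : continuous f ->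
  measurable_fun [set: measurableTypeR R] (f : _ -> measurableTypeR R).
Proof. exact: continuous_measurable_fun. Qed.

Lemma integrable_rho_le f C :
  measurable_fun [set: measurableTypeR R] (f : _ -> measurableTypeR R) ->
  (forall x, `|f x| <= C * rho x) -> mu.-integrable setT (EFin \o f).
Proof.
move=> mf hC.
have ir : mu.-integrable setT (EFin \o @rho R).
  apply/integrableP; split; first by apply/measurable_EFinP; exact: measurable_rho.
  under eq_integral do rewrite /= ger0_norm ?rho_ge0//.
  exact: integral_rho_lty.
apply: (le_integrable measurableT _ _ (integrableZl measurableT C ir)).
  exact/measurable_EFinP.
by move=> x _; rewrite /= lee_fin (le_trans (hC x))// ler_norm.
Qed.

Lemma integrable_tame f : tame f -> mu.-integrable setT (EFin \o f).
Proof. by move=> [cf [C hC]]; apply: integrable_rho_le hC; exact: measurable_continuous. Qed.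

Lemma tameM f (h : R -> R) M : tame f -> continuous h -> (forall x, `|h x| <= M) ->
  tame (fun x => f x * h x).
Proof.
move=> [cf [C hC]] ch hM; split; first by move=> x; apply: cvgM; [exact: cf|exact: ch].
exists (C * M) => x; rewrite normrM mulrAC; apply: ler_pM => //.
Qed.

Lemma tameD f g : tame f -> tame g -> tame (fun x => f x + g x).
Proof.
move=> [cf [C hC]] [cg [D hD]]; split; first by move=> x; apply: cvgD; [exact: cf|exact: cg].
by exists (C + D) => x; rewrite (le_trans (ler_normD _ _))// mulrDl lerD.
Qed.

(** As [x F(x)] is bounded, [F] tends to 0 at both ends, and so do the integrals over growing
    symmetric intervals. *)
Lemma Rintegral_derivative0 F f C : (forall x : R, is_derive x (1 : R) F (f x)) ->
  tame f -> (forall x, `|x * F x| <= C) -> \int[mu]_x f x = 0.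
Proof.
move=> dF tf hF; have [cf [D hD]] := tf; have intf := integrable_tame tf.
pose A (n : nat) : set R := `[- n.+1%:R, n.+1%:R]%classic.
have mf : measurable_fun [set: measurableTypeR R] (EFin \o f) by exact: measurable_int intf.
have mA n : measurable (A n : set (measurableTypeR R)) by exact: measurable_itv.
have h1 : (\int[mu]_x ((EFin \o f) \_ (A n)) x @[n --> \oo] --> \int[mu]_x (EFin \o f) x)%E.
  apply: (@dominated_cvg _ (measurableTypeR R) R mu setT measurableT (fun n => (EFin \o f) \_ (A n))
    (EFin \o f) (fun x => `|(f x)%:E|%E)) => //.
  - move=> n; have mfA : measurable_fun (A n) (EFin \o f) by apply: measurable_funS mf.
    exact: ((measurable_restrictT _ (mA n)).1 mfA).
  - move=> x _; apply: cvg_near_cst; near=> n; rewrite patchE ifT//.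
    have xn : `|x| <= n.+1%:R.
      by apply: (@le_trans _ _ n%:R); [near: n; exact: nbhs_infty_ger|rewrite ler_nat].
    by rewrite inE /A /= in_itv/=; move: xn; rewrite ler_norml.
  - exact: integrable_abse.
  - by move=> n x _; rewrite patchE; case: ifP => // _; rewrite /= normr0 lee_fin.
have h2 n : (\int[mu]_x ((EFin \o f) \_ (A n)) x = (F n.+1%:R - F (- n.+1%:R))%:E)%E.
  rewrite -integral_mkcond (FTC_derive _ dF cf)//.
  by apply: (@lt_trans _ _ 0); rewrite ?oppr_lt0.
have h3 : (fun n : nat => F n.+1%:R - F (- n.+1%:R)) @ \oo --> (0 : R).
  apply/cvgr0Pnorm_le => e e0; near=> n.
  have n0 : 0 < n.+1%:R :> R by [].
  have hn : 2 * C / e <= n.+1%:R.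
    by apply: (@le_trans _ _ n%:R); [near: n; exact: nbhs_infty_ger|rewrite ler_nat].
  apply: le_trans (ler_normB _ _) _.
  have := hF n.+1%:R; have := hF (- n.+1%:R).
  rewrite !normrM normrN (ger0_norm (ltW n0)) => k1 k2.
  rewrite -(ler_pM2l n0) mulrDr.
  by move: hn; rewrite ler_pdivrMr//; lra.
have : (\int[mu]_x ((EFin \o f) \_ (A n)) x @[n --> \oo] --> (0 : R)%:E)%E.
  by under eq_cvg do rewrite h2; apply: cvg_EFin; [exact: nearW|exact: h3].
move=> /(cvg_unique _ h1) => /(_ (@ereal_hausdorff _)) h.
by rewrite /Rintegral h.
Unshelve. all: by end_near.
Qed.

End tame.

(** * Cosine transforms with a phase *)

Section transform.
Context {R : realType} (delta : R).
Hypothesis delta_gt0 : 0 < delta.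
Local Notation mu := (@lebesgue_measure R).
Local Notation smooth_bump := (smooth_bump delta).
Implicit Types (f g : R -> R) (x t th : R).

Lemma cosDpi2 (y : R) : cos (y + pi / 2) = - sin y.
Proof. by rewrite cosD cos_pihalf sin_pihalf mulr0 mulr1 sub0r. Qed.

Lemma tame_bump g : smooth_bump g -> tame g.
Proof.
move=> bg; have cg := bump_continuous bg; split => //.
have [c _ hc] : exists2 c, c \in `[- delta, delta]%R & forall t, t \in `[- delta, delta]%R -> `|g t| <= `|g c|.
  apply: (@EVT_max R (fun t => `|g t|)).
    by apply: (@le_trans _ _ 0); rewrite ?oppr_le0 ltW.
  apply: continuous_subspaceT => x.
  by apply: (@continuous_comp _ _ _ g); [exact: cg|exact: norm_continuous].
exists (`|g c| * (1 + delta ^+ 2)) => x; rewrite /rho.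
have [xd|dx] := leP `|x| delta; last first.
  rewrite (bump_support bg (ltW dx)) normr0 divr_ge0 ?(ltW (oneDsqr_gt0 _))// mulr_ge0//.
  by rewrite addr_ge0// sqr_ge0.
rewrite ler_pdivlMr ?oneDsqr_gt0//; apply: ler_pM => //.
  by apply: hc; rewrite in_itv/= -ler_norml.
by rewrite /oneDsqr lerD2l -[x ^+ 2]real_normK ?num_real// ler_sqr ?nnegrE// ltW.
Qed.

Lemma continuous_phase (c th : R) : continuous (fun t => c * t + th).
Proof.
by move=> t; apply: cvgD; [apply: cvgM; [exact: cvg_cst|exact: cvg_id]|exact: cvg_cst].
Qed.

Lemma continuous_cos_phase (c th : R) : continuous (fun t => cos (c * t + th)).
Proof.
move=> t; apply: (@continuous_comp _ _ _ (fun t => c * t + th)); last exact: continuous_cos.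
exact: continuous_phase.
Qed.

Lemma is_derive_phase (c th t : R) : is_derive t (1 : R) (fun t => c * t + th) c.
Proof.
apply: is_derive_eq (is_deriveD1 (is_deriveM1 (is_derive_cst c t 1) (is_derive_id t 1)) (is_derive_cst th t 1)) _.
by rewrite mul0r add0r mulr1 addr0.
Qed.

Lemma is_derive_cos_phase (c th t : R) :
  is_derive t (1 : R) (fun t => cos (c * t + th)) (c * cos (c * t + th + pi / 2)).
Proof.
rewrite cosDpi2 mulrC; apply: (@is_derive1_comp R (@cos R) (fun t => c * t + th)).
exact: is_derive_phase.
Qed.

Lemma is_derive_sin_phase (c th t : R) :
  is_derive t (1 : R) (fun t => sin (c * t + th)) (c * cos (c * t + th)).
Proof.
rewrite mulrC; apply: (@is_derive1_comp R (@sin R) (fun t => c * t + th)).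
exact: is_derive_phase.
Qed.

(** The phase unites cosine and sine transforms: differentiating in [x], or multiplying by [x],
    shifts [th] by [pi/2] and replaces [g] by [t g] or by its derivative. *)
Definition transform th g x : R := \int[mu]_t (g t * cos (x * t + th)).

Lemma tame_transform th g x : tame g -> tame (fun t => g t * cos (x * t + th)).
Proof.
move=> tg; apply: (tameM (M := 1)) => //; first exact: continuous_cos_phase.
by move=> t; exact: cos_abs_le1.
Qed.

Lemma transform_bounded th g : tame g -> exists C, forall x, `|transform th g x| <= C.
Proof.
move=> tg; exists (\int[mu]_t `|g t|) => x.
have ig := integrable_tame tg; have i1 := integrable_tame (tame_transform th x tg).
apply: (le_trans (le_normr_Rintegral measurableT i1)).
apply: le_Rintegral => //.
- exact: (integrable_norm i1).
- exact: (integrable_norm ig).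
by move=> t _; rewrite normrM ler_piMr// cos_abs_le1.
Qed.

Lemma is_derive_transform th g x : tame g -> tame (fun t => t * g t) ->
  is_derive x (1 : R) (transform th g) (transform (th + pi / 2) (fun t => t * g t) x).
Proof.
move=> tg txg.
have df t y : is_derive y (1 : R) (fun y => g t * cos (y * t + th)) (t * g t * cos (y * t + (th + pi / 2))).
  rewrite (_ : (fun y => _) = (fun y => g t * cos (t * y + th))); last first.
    by apply/funext => z; rewrite [z * t]mulrC.
  apply: is_derive_eq (is_deriveM1 (is_derive_cst (g t) y 1) (is_derive_cos_phase t th y)) _.
  by rewrite mul0r add0r [y * t]mulrC addrA mulrCA mulrA.
have xI : `]x - 1, x + 1[%classic x by rewrite /= in_itv/=; apply/andP; split; lra.
have d1 y t : partial1of2 (fun y t => g t * cos (y * t + th)) y t = t * g t * cos (y * t + (th + pi / 2)).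
  by rewrite partial1of2E; exact: (@derive_val _ _ _ _ _ _ _ (df t y)).
have intf y : `]x - 1, x + 1[%classic y -> mu.-integrable setT (EFin \o (fun t => g t * cos (y * t + th))).
  by move=> _; exact: integrable_tame (tame_transform th y tg).
have derf y t : `]x - 1, x + 1[%classic y -> setT t -> derivable (fun y : R => g t * cos (y * t + th)) y (1 : R).
  by move=> _ _; exact: (@ex_derive _ _ _ _ _ _ _ (df t y)).
have intG : mu.-integrable setT (EFin \o (fun t => `|t * g t|)).
  exact: (integrable_norm (integrable_tame txg)).
have Gub y t : `]x - 1, x + 1[%classic y -> setT t ->
    `|partial1of2 (fun y t => g t * cos (y * t + th)) y t| <= `|t * g t|.
  by move=> _ _; rewrite d1 normrM ler_piMr// cos_abs_le1.
apply: DeriveDef.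
  exact: (derivable_under_integral measurableT xI intf derf (fun t => normr_ge0 _) intG Gub).
rewrite -derive1E (differentiation_under_integral measurableT xI intf derf (fun t => normr_ge0 _) intG Gub).
by rewrite /transform; apply: eq_Rintegral => t _; rewrite d1.
Qed.

Lemma transformX th g dg x : tame g -> tame (fun t => t * g t) -> tame dg ->
  (forall t : R, is_derive t (1 : R) g (dg t)) ->
  x * transform th g x = transform (th + pi / 2) dg x.
Proof.
move=> tg [_ [C hC]] tdg Dg.
pose F t := g t * sin (x * t + th).
pose F1 t := dg t * cos (x * t + (th + pi / 2)).
pose F2 t := g t * cos (x * t + th).
have dF t : is_derive t (1 : R) F (x * F2 t - F1 t).
  apply: is_derive_eq (is_deriveM1 (Dg t) (is_derive_sin_phase x th t)) _.
  by rewrite /F1 /F2 (addrA (x * t)) cosDpi2 mulrN opprK [LHS]addrC mulrCA.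
have t1 : tame F1 by exact: tame_transform.
have t2 : tame F2 by exact: tame_transform.
have t3 : tame (fun t => F2 t * x) by apply: (tameM (M := `|x|)) => // y; exact: cvg_cst.
have t4 : tame (fun t => F1 t * -1) by apply: (tameM (M := 1)) => // y; [exact: cvg_cst|rewrite normrN1].
have tF : tame (fun t => x * F2 t - F1 t).
  rewrite (_ : (fun t => _) = (fun t => F2 t * x + F1 t * -1)); last first.
    by apply/funext => t; rewrite mulrN1 mulrC.
  exact: tameD.
have F0 : forall t, `|t * F t| <= C * 1.
  move=> t; rewrite mulrA normrM ler_pM ?sin_abs_le1//; apply: le_trans (hC t) _.
  have C0 : 0 <= C by move: (le_trans (normr_ge0 _) (hC 0)); rewrite pmulr_lge0// rho_gt0.
  by rewrite ler_piMr// rho_le1.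
have := Rintegral_derivative0 dF tF F0.
rewrite RintegralB//; last 2 first.
- by have := integrable_tame t3; apply: eq_integrable => // t _; rewrite /= mulrC.
- exact: integrable_tame.
rewrite RintegralZl//; last exact: integrable_tame.
by move/eqP; rewrite subr_eq0 => /eqP.
Qed.

End transform.

(** * The algebra generated by the transforms of bumps *)

Section waves.
Context {R : realType} (delta : R).
Hypothesis delta_gt0 : 0 < delta.
Local Notation mu := (@lebesgue_measure R).
Local Notation smooth_bump := (smooth_bump delta).
Implicit Types (f g h : R -> R) (x t th c xi : R).

(** All members are bounded, and the class is stable under differentiation and multiplication by
    [x]; so all members are Schwartz. Products and modulations are included for the squared
    transform and its frequency shifts. *)
Inductive wave : (R -> R) -> Prop :=
| wave_transform th g : smooth_bump g -> wave (transform th g)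
| waveD f h : wave f -> wave h -> wave (fun x => f x + h x)
| waveM f h : wave f -> wave h -> wave (fun x => f x * h x)
| waveZ c f : wave f -> wave (fun x => c * f x)
| wave_cos c th f : wave f -> wave (fun x => f x * cos (c * x + th)).

Lemma wave_bounded f : wave f -> exists C, forall x, `|f x| <= C.
Proof.
elim=> [th g bg|f1 h _ [C hC] _ [D hD]|f1 h _ [C hC] _ [D hD]|c f1 _ [C hC]|c th f1 _ [C hC]].
- exact: transform_bounded (tame_bump delta_gt0 bg).
- by exists (C + D) => x; rewrite (le_trans (ler_normD _ _))// lerD.
- by exists (C * D) => x; rewrite normrM ler_pM.
- by exists (`|c| * C) => x; rewrite normrM ler_pM.
- by exists (C * 1) => x; rewrite normrM ler_pM// cos_abs_le1.
Qed.

Lemma wave_derive f : wave f ->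
  exists2 df, wave df & forall x : R, is_derive x (1 : R) f (df x).
Proof.
elim=> [th g bg|f1 h _ [C w1 hC] _ [D w2 hD]|f1 h w1 [C w2 hC] w3 [D w4 hD]|c f1 _ [C w1 hC]|c th f1 w1 [C w2 hC]].
- have bXg := bumpX bg.
  exists (transform (th + pi / 2) (fun t => t * g t)); first exact: wave_transform.
  by move=> x; apply: is_derive_transform; exact: (tame_bump delta_gt0).
- by exists (fun x => C x + D x); [exact: waveD|move=> x; exact: is_deriveD1].
- exists (fun x => C x * h x + f1 x * D x); first by apply: waveD; exact: waveM.
  by move=> x; exact: is_deriveM1.
- exists (fun x => c * C x); first exact: waveZ.
  by move=> x; apply: is_derive_eq (is_deriveM1 (is_derive_cst c x 1) (hC x)) _; rewrite mul0r add0r.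
- exists (fun x => C x * cos (c * x + th) + c * (f1 x * cos (c * x + (th + pi / 2)))).
    by apply: waveD; [exact: wave_cos|apply: waveZ; exact: wave_cos].
  move=> x; apply: is_derive_eq (is_deriveM1 (hC x) (is_derive_cos_phase c th x)) _.
  by congr (_ + _); rewrite addrA mulrCA.
Qed.

Lemma waveX f : wave f -> wave (fun x => x * f x).
Proof.
have eq_wave (u v : R -> R) : u =1 v -> wave u -> wave v by move=> /funext ->.
elim=> [th g bg|f1 h _ IH1 _ IH2|f1 h _ IH1 w2 _|c f1 _ IH|c th f1 _ IH].
- have [dg bdg hdg] := bump_derive bg.
  apply: (eq_wave (transform (th + pi / 2) dg)); last exact: wave_transform.
  move=> x; rewrite (transformX _ _ _ _ _ hdg)//; apply: (tame_bump delta_gt0) => //.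
  exact: bumpX.
- by apply: (eq_wave (fun x => x * f1 x + x * h x)); [move=> x; rewrite mulrDr|exact: waveD].
- by apply: (eq_wave (fun x => x * f1 x * h x)); [move=> x; rewrite mulrA|exact: waveM].
- by apply: (eq_wave (fun x => c * (x * f1 x))); [move=> x; rewrite mulrCA|exact: waveZ].
- by apply: (eq_wave (fun x => x * f1 x * cos (c * x + th))); [move=> x; rewrite mulrA|exact: wave_cos].
Qed.

Lemma wave_continuous f : wave f -> continuous f.
Proof. by move=> /wave_derive[df _]; exact: is_derive_continuous. Qed.

Lemma wave_tame f : wave f -> tame f.
Proof.
move=> wf; split; first exact: wave_continuous.
have [C hC] := wave_bounded wf; have [D hD] := wave_bounded (waveX (waveX wf)).
exists (C + D) => x; rewrite /rho ler_pdivlMr ?oneDsqr_gt0// mulrC /oneDsqr mulrDl mul1r lerD//.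
by have := hD x; rewrite mulrA -expr2 normrM [X in X * _]ger0_norm// sqr_ge0.
Qed.

Lemma Rintegral_transform_cos th0 g xi th : smooth_bump g -> delta < `|xi| ->
  \int[mu]_x (transform th0 g x * cos (xi * x + th)) = 0.
Proof.
(* If [P] is the transform of [G = g / (xi^2 - t^2)], the transform of [g] is
   [xi^2 P + P''], and the integrand is the derivative of
   [P' cos(xi x + th) + xi P sin(xi x + th)]. *)
move=> bg dxi; pose G t := (xi ^+ 2 - t ^+ 2)^-1 * g t.
have bG : smooth_bump G by exact: bump_div.
have bXG := bumpX bG; have bXXG := bumpX bXG.
have tb (u : R -> R) : smooth_bump u -> tame u by exact: tame_bump.
pose P := transform th0 G; pose P1 := transform (th0 + pi / 2) (fun t => t * G t).
pose P2 := transform (th0 + pi / 2 + pi / 2) (fun t => t * (t * G t)).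
have dP x : is_derive x (1 : R) P (P1 x) by apply: is_derive_transform; exact: tb.
have dP1 x : is_derive x (1 : R) P1 (P2 x) by apply: is_derive_transform; exact: tb.
have gE x : transform th0 g x = xi ^+ 2 * P x + P2 x.
  have i1 := integrable_tame (tame_transform th0 x (tb _ bG)).
  have i2 := integrable_tame (tame_transform (th0 + pi / 2 + pi / 2) x (tb _ bXXG)).
  have i3 : mu.-integrable setT (EFin \o (fun t => xi ^+ 2 * (G t * cos (x * t + th0)))).
    by have := integrableZl measurableT (xi ^+ 2) i1; apply: eq_integrable.
  rewrite /P /P2 /transform -RintegralZl// -RintegralD//.
  apply: eq_Rintegral => t _; rewrite !addrA !cosDpi2 sinD cos_pihalf sin_pihalf mulr0 mulr1 add0r.
  rewrite mulrN mulrA -mulrBl; congr (_ * _).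
  have [td|dt] := ltP `|t| delta; last first.
    by rewrite /G (bump_support bg dt) !mulr0 subr0.
  have rn0 : xi ^+ 2 - t ^+ 2 != 0.
    rewrite gt_eqF// subr_gt0 -[t ^+ 2]real_normK ?num_real// -[xi ^+ 2]real_normK ?num_real//.
    by rewrite ltr_sqr ?nnegrE// (lt_trans td).
  by rewrite /G; field.
pose c x := cos (xi * x + th); pose s x := cos (xi * x + (th - pi / 2)).
have ds x : is_derive x (1 : R) s (xi * c x).
  by apply: is_derive_eq (is_derive_cos_phase xi (th - pi / 2) x) _; rewrite -addrA subrK.
have dc x : is_derive x (1 : R) c (- (xi * s x)).
  apply: is_derive_eq (is_derive_cos_phase xi th x) _.
  by rewrite /s cosDpi2 addrA cosD cosN sinN cos_pihalf sin_pihalf mulr0 sub0r mulrN1 opprK mulrN.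
pose F x := P1 x * c x + xi * (P x * s x).
have dF x : is_derive x (1 : R) F (transform th0 g x * c x).
  apply: is_derive_eq (is_deriveD1 (is_deriveM1 (dP1 x) (dc x))
    (is_deriveM1 (is_derive_cst xi x 1) (is_deriveM1 (dP x) (ds x)))) _.
  rewrite gE /=; move: (P2 x) (c x) (s x) (P x) (P1 x) => *; ring.
have wF : wave F.
  apply: waveD; first by apply: wave_cos; exact: wave_transform.
  by apply: waveZ; apply: wave_cos; exact: wave_transform.
have [C hC] := wave_bounded (waveX wF).
apply: (Rintegral_derivative0 dF _ hC); apply: wave_tame.
by apply: wave_cos; exact: wave_transform.
Qed.

Lemma cos_mul_cos (u v : R) : cos u * cos v = 2^-1 * (cos (u + v) + cos (u - v)).
Proof. by rewrite !cosD cosN sinN mulrN opprK; field. Qed.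

(** One factor [phi] is expanded as an integral over [t] and the order of integration is exchanged.
    The product of cosines then has frequencies [xi + t] and [xi - t], both beyond [delta] when
    [|t| < delta], so the inner integral is 0 by [Rintegral_transform_cos]. *)
Lemma Rintegral_square_cos g xi th : smooth_bump g -> 2 * delta < `|xi| ->
  \int[mu]_x (transform 0 g x * transform 0 g x * cos (xi * x + th)) = 0.
Proof.
move=> bg dxi; set phi := transform 0 g.
have wphi : wave phi by exact: wave_transform.
have tg := tame_bump delta_gt0 bg.
pose k x := phi x * cos (xi * x + th).
have wk : wave k by exact: wave_cos.
have inner t : g t * \int[mu]_x (k x * cos (x * t + 0)) = 0.
  have [td|dt] := ltP `|t| delta; last by rewrite (bump_support bg dt) mul0r.
  rewrite (_ : \int[mu]_x _ = 0) ?mulr0//.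
  have E x : k x * cos (x * t + 0) =
      2^-1 * (phi x * cos ((xi + t) * x + th) + phi x * cos ((xi - t) * x + th)).
    rewrite /k -mulrA cos_mul_cos -mulrDr mulrCA; congr (_ * (_ * (cos _ + cos _))); ring.
  under eq_Rintegral do rewrite E.
  have i1 y := integrable_tame (wave_tame (wave_cos y th wphi)).
  rewrite RintegralZl//; last first.
    by have := integrableD measurableT (i1 (xi + t)) (i1 (xi - t)); apply: eq_integrable.
  rewrite RintegralD// !Rintegral_transform_cos ?addr0 ?mulr0//.
    by have := lerB_dist xi t; lra.
  by have := lerB_dist xi (- t); rewrite normrN opprK; lra.
pose f (p : measurableTypeR R * measurableTypeR R) : R := k p.1 * (g p.2 * cos (p.1 * p.2 + 0)).
have mk := measurable_continuous (wave_continuous wk).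
have mg := measurable_continuous tg.1.
have mf : measurable_fun setT f.
  apply: measurable_funM; first exact: (measurableT_comp mk measurable_fst).
  apply: measurable_funM; first exact: (measurableT_comp mg measurable_snd).
  have mc : measurable_fun [set: measurableTypeR R] ((@cos R) : _ -> measurableTypeR R).
    by apply: measurable_continuous; exact: continuous_cos.
  apply: (measurableT_comp mc); apply: measurable_funD => //.
  by apply: measurable_funM; [exact: measurable_fst|exact: measurable_snd].
have mfe : measurable_fun setT (EFin \o f) by exact/measurable_EFinP.
have ig := integrable_tame tg; have ik := integrable_tame (wave_tame wk).
have fk p : (`|(f p)%:E| <= (`|k p.1| * `|g p.2|)%:E)%E.
  by rewrite lee_fin !normrM mulrA ler_piMr// ?cos_abs_le1// mulr_ge0.
have mnf : measurable_fun setT (fun p : measurableTypeR R * measurableTypeR R => (`|k p.1| * `|g p.2|)%:E).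
  apply/measurable_EFinP; apply: measurable_funM; apply: measurableT_comp => //.
    exact: (measurableT_comp mk measurable_fst).
  exact: (measurableT_comp mg measurable_snd).
have intf : (mu \x mu)%E.-integrable setT (EFin \o f).
  suff ip : (mu \x mu)%E.-integrable setT (fun p => (`|k p.1| * `|g p.2|)%:E).
    apply: (le_integrable measurableT mfe _ ip) => p _.
    by apply: le_trans (fk p) _; rewrite /= lee_fin ler_norm.
  apply/integrable12ltyP => //=.
  rewrite (_ : (\int[mu]_x _)%E = (\int[mu]_x (`|k x|%:E * \int[mu]_y `|g y|%:E))%E); last first.
    apply: eq_integral => x _; rewrite -ge0_integralZl_EFin//.
    - by apply: eq_integral => y _; rewrite /= ger0_norm ?mulr_ge0.
    - by apply/measurable_EFinP; exact: measurableT_comp.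
  have gfin : (\int[mu]_y `|g y|%:E)%E \is a fin_num.
    by rewrite ge0_fin_numE; [case/integrableP: ig|exact: integral_ge0].
  rewrite -(fineK gfin) ge0_integralZr//; last 2 first.
  - by apply/measurable_EFinP; exact: measurableT_comp.
  - by rewrite fineK// integral_ge0.
  by rewrite fineK// lte_mul_pinfty//; [exact: integral_ge0|rewrite ge0_fin_numE ?integral_ge0//; case/integrableP: ik|case/integrableP: ig].
have := Fubini intf; rewrite /=.
have -> : (\int[mu]_y \int[mu]_x (EFin \o f) (x, y) = 0)%E.
  rewrite -(integral0 mu setT); apply: eq_integral => t _; rewrite /= /f/=.
  have ikt : mu.-integrable setT (EFin \o (fun x => k x * cos (x * t + 0))).
    have := integrable_tame (wave_tame (wave_cos t 0 wk)).
    by apply: eq_integrable => // x _; rewrite /= [t * x]mulrC.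
  under eq_integral do rewrite mulrCA EFinM.
  rewrite integralZl// -[X in (_ * X)%E]fineK; last exact: integrable_fin_num.
  by rewrite -EFinM -[fine _]/(\int[mu]_x _) inner.
move=> E; transitivity (fine (0 : \bar R)); last by [].
rewrite -E /Rintegral; congr fine.
apply: eq_integral => x _; rewrite /= /f /=.
under eq_integral do rewrite EFinM.
have itx := integrable_tame (tame_transform 0 x tg).
rewrite integralZl// -[X in (_ * X)%E]fineK; last exact: integrable_fin_num.
by rewrite -EFinM -[fine _]/(\int[mu]_x _) -/(transform 0 g x) -/phi /k mulrAC.
Qed.

End waves.

(** * Functions of one variable as functions of row vectors *)

Section one_dimension.
Context {R : realType}.
Local Notation mu := (@lebesgue_measure R).
Implicit Types (f g h : R -> R).

Definition onrow f (x : 'rV[R]_1) : R := f (x 0 0).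

Lemma is_derive_onrow f df (x : 'rV[R]_1) i :
  (forall t : R, is_derive t (1 : R) f (df t)) ->
  is_derive x (delta_mx 0 i) (onrow f) (onrow df x).
Proof.
move=> hf; have [dfx dfE] := hf (x 0 0).
have E : (fun h : R => h^-1 *: ((onrow f \o shift x) (h *: delta_mx 0 i) - onrow f x)) =
    (fun h : R => h^-1 *: ((f \o shift (x 0 0)) (h *: (1 : R)) - f (x 0 0))).
  by apply/funext => h; rewrite /= /onrow !mxE ord1 eqxx.
apply: DeriveDef; first by rewrite /derivable E.
by rewrite /derive E.
Qed.

Variable delta : R.
Hypothesis delta_gt0 : 0 < delta.
Local Notation wave := (wave delta).

Lemma partials_onrow f (s : seq 'I_1) : wave f ->
  exists2 h, wave h & partials s (onrow f) = onrow h.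
Proof.
move=> wf; elim: s => [|i s [h wh hE]]; first by exists f.
have [dh wdh Dh] := wave_derive delta_gt0 wh; exists dh => //.
apply/funext => x; rewrite /= hE.
exact: (@derive_val _ _ _ _ _ _ _ (is_derive_onrow x i Dh)).
Qed.

Lemma smooth_onrow f : wave f -> smooth (onrow f).
Proof.
move=> wf s; have [h wh ->] := partials_onrow s wf; split=> [x|i x].
  apply: (@continuous_comp _ _ _ (fun x : 'rV[R]_1 => x 0 0) h); first exact: coord_continuous.
  exact: (wave_continuous delta_gt0 wh).
have [dh _ Dh] := wave_derive delta_gt0 wh.
exact: (@ex_derive _ _ _ _ _ _ _ (is_derive_onrow x i Dh)).
Qed.

Lemma rapidly_decreasing_onrow f : wave f -> rapidly_decreasing (onrow f).
Proof.
move=> wf s k; have [h wh ->] := partials_onrow s wf.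
have wX : wave (fun x => x ^+ k * h x).
  elim: k => [|k IH].
    by rewrite (_ : (fun x => _) = h)//; apply/funext => x; rewrite expr0 mul1r.
  rewrite (_ : (fun x => _) = (fun x => x * (x ^+ k * h x))); last first.
    by apply/funext => x; rewrite exprS mulrA.
  exact: waveX.
have [C hC] := wave_bounded delta_gt0 wX; exists C => x.
have -> : `|x| = `|x 0 0|.
  apply/eqP; rewrite eq_le coord_le_norm andbT [leLHS]mx_normrE.
  by apply/bigmax_leP; split => // -[i j] _; rewrite !ord1.
by rewrite /onrow -normrX -normrM.
Qed.

Lemma schwartz_onrow f g : wave f -> wave g ->
  schwartz (fun x : 'rV[R]_1 => Complex (onrow f x) (onrow g x)).
Proof.
by move=> wf wg; split; [exact: smooth_onrow|exact: smooth_onrow|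
  exact: rapidly_decreasing_onrow|exact: rapidly_decreasing_onrow].
Qed.

Lemma ge0_integral_lebesgue_tuple1 (f : R -> \bar R) :
  measurable_fun [set: measurableTypeR R] (f : measurableTypeR R -> \bar R) ->
  (forall x, 0 <= f x)%E ->
  (\int[lebesgue_tuple R 1]_t f (tnth t ord0) = \int[mu]_x f x)%E.
Proof.
move=> mf f0.
have mt : measurable_fun setT (fun t : 1.-tuple (measurableTypeR R) => f (tnth t ord0)).
  by apply: (measurableT_comp mf); exact: (@measurable_tnth _ (measurableTypeR R)).
rewrite (ge0_integral_lebesgue_tupleS mt)//; apply: eq_integral => x _.
by rewrite integral_lebesgue_tuple0//; exact: (measurable_cst (f x)).
Qed.

Lemma Rintegral_onrow f : continuous f ->
  \int[lebesgue_tuple R 1]_t onrow f (row_of_tuple t) = \int[mu]_x f x.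
Proof.
move=> cf; have mf : measurable_fun [set: measurableTypeR R] (EFin \o f).
  by apply/measurable_EFinP; exact: measurable_continuous.
have mp : measurable_fun [set: measurableTypeR R] (EFin \o f)^\+%E by exact: measurable_funepos.
have mn : measurable_fun [set: measurableTypeR R] (EFin \o f)^\-%E by exact: measurable_funeneg.
rewrite /Rintegral; congr fine; rewrite integralE [RHS]integralE; congr (_ - _)%E.
  rewrite -(ge0_integral_lebesgue_tuple1 mp)//; apply: eq_integral => t _.
  by rewrite !funeposE /= /onrow mxE.
rewrite -(ge0_integral_lebesgue_tuple1 mn)//; apply: eq_integral => t _.
by rewrite !funenegE /= /onrow mxE.
Qed.

Lemma integral_gt0 f (D : set R) (e : R) : 0 < e -> `[- e, e] `<=` D ->
  measurable (D : set (measurableTypeR R)) ->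
  continuous f -> (forall x, 0 <= f x) -> 0 < f 0 ->
  (0 < \int[mu]_(x in D) (f x)%:E)%E.
Proof.
move=> e0 eD mD cf f0 f00.
have [r r0 hr] : exists2 r : R, 0 < r & forall x : R, `|x| <= r -> f 0 / 2 <= f x.
  have hz : f 0 > f 0 / 2 by rewrite ltr_pdivrMr ?ltr_pMr ?ltr1n.
  have := cvgr_gt _ (cf 0) _ hz.
  move=> [r /= r0 hr]; exists (r / 2); first by rewrite divr_gt0.
  move=> x xr; apply/ltW/hr; rewrite /ball /= sub0r normrN; lra.
pose q : R := Num.min (r : R) e; have q0 : 0 < q by rewrite lt_min r0.
have qe : `[- q, q] `<=` D.
  apply: subset_trans eD => x /=; rewrite !in_itv/= => /andP[h1 h2].
  have qle : q <= e by rewrite ge_min lexx orbT.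
  by apply/andP; split; lra.
have mq : measurable (`[- q, q]%classic : set (measurableTypeR R)) by exact: measurable_itv.
have mfe (A : set R) : measurable_fun (A : set (measurableTypeR R)) (EFin \o f).
  by apply: measurable_funTS; apply/measurable_EFinP; exact: measurable_continuous.
pose Q : set R := `[- q, q]%classic.
have h1 : (\int[mu]_(x in Q) (f x)%:E <= \int[mu]_(x in D) (f x)%:E)%E.
  by apply: ge0_subset_integral => // x _; rewrite lee_fin.
have h2 : (\int[mu]_(x in Q) (f 0 / 2)%:E <= \int[mu]_(x in Q) (f x)%:E)%E.
  apply: ge0_le_integral => //.
  - by move=> x _; rewrite lee_fin divr_ge0// ltW.
  - move=> x Qx; have /andP[h2 h3] : - q <= x <= q by move: Qx; rewrite /Q /= in_itv.
    rewrite lee_fin hr//.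
    have qr : q <= r by rewrite ge_min lexx.
    by rewrite ler_norml; apply/andP; split; lra.
apply: lt_le_trans (le_trans h2 h1).
have muQ : mu Q = (q + q)%:E.
  by rewrite /Q lebesgue_measure_itv/= lte_fin ifT ?opprK -?EFinB ?opprK//; lra.
rewrite integral_cst//; apply: (@lt_le_trans _ _ ((f 0 / 2)%:E * (q + q)%:E)%E); last by rewrite -muQ.
by rewrite -EFinM lte_fin mulr_gt0 ?divr_gt0 ?addr_gt0.
Qed.

End one_dimension.

(** * Absence of a lattice process above the critical bandwidth *)

Section no_lattice_process.
Context {R : realType} d (T : measurableType d) (P : probability T R)
  (lambda : R) (w : point_process P) (a B : R).
Hypotheses (lambda_gt0 : 0 < lambda) (w_poisson : is_poisson lambda w).
Hypotheses (a_gt0 : 0 < a) (B_gt : 1 / a < B).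
Local Notation mu := (@lebesgue_measure R).

(** With [delta = pi m], the spectrum of [psi] lies within [2 delta / (2 pi) = m]. The first bound
    keeps it inside [[-B, B]] after a shift by [1 / a]. The second gives
    [2 delta <= pi / a < 2 pi / a], so the frequency [1 / a] is outside the spectrum. *)
Let m : R := Num.min (B - 1 / a) (1 / (2 * a)).
Let delta : R := pi * m.

Let m_gt0 : 0 < m.
Proof. by rewrite lt_min subr_gt0 B_gt divr_gt0// mulr_gt0. Qed.

Let delta_gt0 : 0 < delta.
Proof. by rewrite mulr_gt0// pi_gt0. Qed.

Let g t : R := flat 1 (delta + t) * flat 1 (delta - t).

Let bump_g : smooth_bump delta g.
Proof. exact: bump_flat. Qed.

Let phi := transform 0 g.
Let psi x := phi x * phi x.

Let wave_psi : wave delta psi.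
Proof. by apply: waveM; exact: wave_transform. Qed.

Lemma flat1_ge0 (s : R) : 0 <= flat 1 s.
Proof. by rewrite /flat; case: ifP => // _; rewrite hornerC mul1r expR_ge0. Qed.

Lemma flat1_gt0 (s : R) : 0 < s -> 0 < flat 1 s.
Proof. by rewrite /flat => ->; rewrite hornerC mul1r expR_gt0. Qed.

Lemma phi0_gt0 : 0 < phi 0.
Proof.
have tg := tame_bump delta_gt0 bump_g.
rewrite /phi /transform; under eq_Rintegral do rewrite mul0r addr0 cos0 mulr1.
have ig := integrable_fin_num measurableT (integrable_tame tg).
rewrite -lte_fin fineK//; apply: (integral_gt0 ltr01) => //; first exact: tg.1.
  by move=> t; rewrite mulr_ge0// flat1_ge0.
by rewrite mulr_gt0// flat1_gt0 ?addr0 ?subr0.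
Qed.

Lemma Rintegral_psi_gt0 : 0 < \int[mu]_x psi x.
Proof.
have tp := wave_tame delta_gt0 wave_psi.
have ip := integrable_fin_num measurableT (integrable_tame tp).
rewrite -lte_fin fineK//; apply: (integral_gt0 ltr01) => //; first exact: tp.1.
  by move=> t; exact: sqr_ge0 (phi t).
by rewrite mulr_gt0// phi0_gt0.
Qed.

(** The sine of [exp(i c x)] is written as a cosine with phase [-pi/2], so that both components are
    waves. *)
Let eta (c : R) (x : 'rV[R]_1) : R[i] :=
  Complex (onrow (fun x => psi x * cos (c * x + 0)) x)
          (onrow (fun x => psi x * cos (c * x + (- (pi / 2)))) x).

Let wave_c c th : wave delta (fun x => psi x * cos (c * x + th)).
Proof. exact: wave_cos. Qed.

Lemma schwartz_eta c : schwartz (eta c).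
Proof. exact: (schwartz_onrow delta_gt0). Qed.

Lemma cosBpi2 (y : R) : cos (y - pi / 2) = sin y.
Proof. by rewrite cosD cosN sinN cos_pihalf sin_pihalf mulr0 sub0r mulrN1 opprK. Qed.

Lemma etaE c x : eta c x = (psi (x 0 0))%:C%C * expi (c * x 0 0).
Proof.
rewrite /eta /onrow /expi addr0 cosBpi2.
by apply/eqP; rewrite eq_complex /= !mul0r subr0 addr0 !eqxx.
Qed.

Lemma fourier_eta c (xi : 'rV[R]_1) : 2 * delta < `|c - 2 * pi * xi 0 0| ->
  fourier (eta c) xi = 0.
Proof.
set y := c - _ => hy.
have E t : eta c (row_of_tuple t) * expi (- (2 * pi * dotr (row_of_tuple t) xi)) =
    eta y (row_of_tuple t).
  rewrite !etaE -mulrA -expiD; congr (_ * expi _).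
  by rewrite /dotr big_ord1 /y mulrBl -!mulrA [xi 0 0 * _]mulrC.
rewrite /fourier /lebesgue_integral_rV /cintegral.
have zero th : \int[lebesgue_tuple R 1]_t onrow (fun x => psi x * cos (y * x + th)) (row_of_tuple t) = 0.
  rewrite Rintegral_onrow; last exact: (wave_continuous delta_gt0 (wave_c y th)).
  exact: (Rintegral_square_cos delta_gt0).
rewrite -[RHS]/(Complex 0 0); congr Complex.
  by under eq_Rintegral do rewrite E; exact: (zero 0).
by under eq_Rintegral do rewrite E; exact: (zero (- (pi / 2))).
Qed.

Let ma : m <= 1 / (2 * a). Proof. by rewrite ge_min lexx orbT. Qed.
Let mB : m <= B - 1 / a. Proof. by rewrite ge_min lexx. Qed.

Lemma band_limited_eta c : `|c| <= 2 * pi / a -> band_limited B (eta c).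
Proof.
move=> ca xi fxi i; rewrite ord1 leNgt; apply/negP => Bxi; move/eqP: fxi; apply.
apply: fourier_eta.
have p0 : 0 < pi :> R := pi_gt0 R.
have h1 : 2 * delta + `|c| < `|2 * pi * xi 0 0|.
  rewrite normrM ger0_norm ?mulr_ge0 ?ltW//.
  apply: (@le_lt_trans _ _ (2 * pi * B)); last by rewrite ltr_pM2l// mulr_gt0.
  apply: (@le_trans _ _ (2 * delta + 2 * pi / a)); first by rewrite lerD2l.
  have -> : 2 * delta + 2 * pi / a = 2 * pi * (m + 1 / a) by rewrite /delta; ring.
  by rewrite ler_pM2l ?mulr_gt0// -lerBrDr.
by have := lerB_dist (2 * pi * xi 0 0) c; rewrite distrC; lra.
Qed.

Lemma cos_lattice (k : int) : cos (2 * pi / a * (a * k%:~R)) = 1.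
Proof.
have -> : 2 * pi / a * (a * k%:~R) = k%:~R * (2 * pi) :> R.
  by move: (pi : R) => p; field; exact: lt0r_neq0.
have cosn (n : nat) : cos (n%:R * (2 * pi)) = 1 :> R.
  elim: n => [|n IH]; first by rewrite mul0r cos0.
  by rewrite -natr1 mulrDl mul1r [X in cos (_ + X)]mulr_natl cosD2pi.
case: k => n; first exact: cosn.
by rewrite NegzE mulrNz mulNr cosN; exact: cosn.
Qed.

Lemma no_lattice_process : ~ exists (d' : measure_display) (T' : measurableType d')
  (P' : probability T' R) (v : point_process P'),
  [/\ ulm v, supported_on_lattice a v & mimics B v w].
Proof.
move=> [d' [T' [P' [v [_ vsupp vmim]]]]].
pose c0 : R := 2 * pi / a.
have p0 : 0 < pi :> R := pi_gt0 R.
have c00 : 0 < c0 by rewrite divr_gt0// mulr_gt0.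
have corr c : `|c| <= c0 -> complex.Re (correlation (eta c) v) = lambda * \int[mu]_x (psi x * cos (c * x + 0)).
  move=> cc; rewrite -(vmim 1%N isT _ (schwartz_eta c) (band_limited_eta cc)).
  have wc := wave_c c 0.
  have int1 : (lebesgue_tuple R 1).-integrable setT
      (EFin \o (fun t => onrow (fun x => psi x * cos (c * x + 0)) (row_of_tuple t))).
    have [C _ hC] := decay_bound (rapidly_decreasing_onrow delta_gt0 wc [::]).
    by apply: integrable_decay hC; have [] := smooth_onrow delta_gt0 wc [::].
  rewrite Re_correlation (poisson_rsum lambda_gt0 w_poisson (ltn0Sn 0) int1) expr1.
  by rewrite Rintegral_onrow//; exact: (wave_continuous delta_gt0).
have E : complex.Re (correlation (eta 0) v) = complex.Re (correlation (eta c0) v).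
  rewrite !Re_correlation; apply: eq_Rintegral => t _.
  rewrite /rsum; congr (fine _ - fine _); apply: eq_esum => j [_ /(_ ord0) hj].
    rewrite !funeposE /= /onrow mxE tnth_points.
    have [k ->] : exists k : int, (tnth j ord0).1 = a * k%:~R.
      by apply: (vsupp t); move: hj; case: multiplicity.
    by rewrite mul0r !addr0 cos0 cos_lattice.
  rewrite !funenegE /= /onrow mxE tnth_points.
  have [k ->] : exists k : int, (tnth j ord0).1 = a * k%:~R.
    by apply: (vsupp t); move: hj; case: multiplicity.
  by rewrite mul0r !addr0 cos0 cos_lattice.
move: E; rewrite !corr ?normr0 ?(ger0_norm (ltW c00)) ?(ltW c00)//.
rewrite [X in _ = _ * X -> _](Rintegral_square_cos delta_gt0)//; last first.
  rewrite (ger0_norm (ltW c00)).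
  apply: (@le_lt_trans _ _ (2 * (pi * (1 / (2 * a))))).
    by rewrite ler_pM2l// /delta ler_pM2l.
  have -> : 2 * (pi * (1 / (2 * a))) = pi / a.
    by move: (pi : R) => p; field; exact: lt0r_neq0.
  by rewrite /c0 ltr_pM2r ?invr_gt0// ltr_pMl// ltr1n.
under eq_Rintegral do rewrite mul0r addr0 cos0 mulr1.
move/eqP; rewrite mulr0 mulf_eq0 (gt_eqF lambda_gt0)/= => /eqP h.
by have := Rintegral_psi_gt0; rewrite h ltxx.
Qed.

End no_lattice_process.

Theorem theorem1p6 (R : realType) (lambda : R) (lambda_gt0 : 0 < lambda)
    (d : measure_display) (T : measurableType d) (P : probability T R)
    (w : point_process P) (w_poisson : is_poisson lambda w) :
  (forall a B : R, 0 < a -> 0 < B -> B <= 1 / a ->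
     exists (d' : measure_display) (T' : measurableType d')
            (P' : probability T' R) (v : point_process P'),
       [/\ ulm v, supported_on_lattice a v & mimics B v w]) /\
  (forall a B : R, 0 < a -> 1 / a < B ->
     ~ exists (d' : measure_display) (T' : measurableType d')
              (P' : probability T' R) (v : point_process P'),
         [/\ ulm v, supported_on_lattice a v & mimics B v w]).
Proof.
split=> [a B a_gt0 _ aB|a B a_gt0 aB].
  have [v hv] := lattice_process lambda_gt0 w_poisson a_gt0 aB.
  by exists d, T, P, v.
exact: (no_lattice_process lambda_gt0 w_poisson a_gt0 aB).
Qed.
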